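(* Let $n > 2$ and let $A = (a_{ij}) \in \mathbb{Z}^{2\times n}$ be a faithful weight matrix in standard form with $2\times2$ minors $d_{ij} = a_{1i}a_{2j} - a_{2i}a_{1j}$. The pole order of $\operatorname{Hilb}_A^{\mathit{on}}(t)$ at $t=1$ is $2n-4$, and the first nonzero Laurent coefficient $\gamma_0(A)$ of $\operatorname{Hilb}_A^{\mathit{on}}(t)$ (the coefficient of $(1-t)^{-(2n-4)}$ in the expansion at $t=1$) is given by $$\gamma_0(A) = \lim_{X\to A} \sum_{\substack{i\neq j \\ d_{ij} > 0}} \frac{c_{ij}^{2n-5}}{\prod\limits_{k\neq i,j}(c_{ij} - c_{ik} - c_{jk})(c_{ij} + c_{ik} + c_{jk})},$$ where $X=(x_{ij})$ is a real $2\times n$ matrix of parameters approximating $A$, $c_{ij} = x_{1i}x_{2j} - x_{2i}x_{1j}$, and the limit is taken over those $X$ with $c_{ij}+c_{ik}+c_{jk}\neq 0$ for all distinct $i,j,k$. In particular, for each $i,j,k$ with $d_{ij}>0$, the singularities of this expression (as a function of $X$ near $A$) corresponding to $d_{ij}-d_{ik}-d_{jk}=0$ and $d_{ij}+d_{ik}+d_{jk}=0$ are removable. If $A$ is generic, then $$\gamma_0(A) = \sum_{\substack{i\neq j \\ d_{ij} > 0}} \frac{d_{ij}^{2n-5}}{\prod\limits_{k\neq i,j}(d_{ij} - d_{ik} - d_{jk})(d_{ij} + d_{ik} + d_{jk})}.$$ All sums are over ordered pairs $(i,j)$ of distinct indices in $\{1,\dots,n\}$ with $d_{ij}>0$, and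 products are over $k\in\{1,\dots,n\}\setminus\{i,j\}$.
   Context: A weight matrix $A=(a_{ij})\in\mathbb{Z}^{2\times n}$ defines the unitary representation $V=V_A\cong\mathbb{C}^n$ of the torus $\mathbb{T}^2$ by $(z_1,z_2)\cdot(x_1,\ldots,x_n) = (z_1^{a_{11}}z_2^{a_{21}}x_1,\ldots,z_1^{a_{1n}}z_2^{a_{2n}}x_n)$. Let $\mathbb{R}[V]^{\mathbb{T}^2}$ be the algebra of real-valued $\mathbb{T}^2$-invariant real polynomial functions on the underlying real vector space of $V$, graded by polynomial degree. The moment map has components $J_i(x) = \frac12\sum_{j=1}^n a_{ij}x_j\overline{x_j}$, $i=1,2$. Let $I_J$ be the ideal of $\mathbb{R}[V]$ generated by $J_1,J_2$ and $I_J^{\mathbb{T}^2} = I_J\cap\mathbb{R}[V]^{\mathbb{T}^2}$. The Hilbert series of a graded algebra $R=\bigoplus_{d\ge0}R_d$ over a field is $\sum_d t^d\dim R_d$, and $\operatorname{Hilb}_A^{\mathit{on}}(t)$ denotes the Hilbert series of the graded algebra $\mathbb{R}[V]^{\mathbb{T}^2}/I_J^{\mathbb{T}^2}$; it is the power series of a rational function of $t$. $A$ is faithful if $\operatorname{rank}A=2$ and the gcd of all $2\times2$ minors $d_{ij}$ is $1$. $A$ is in standard form if $a_{1i}>0$ for every $i$. $A$ is generic if it is in standard form, $a_{1i}\neq a_{1j}$ for $i\ne j$, and $d_{ij}+d_{ik}+d_{jk}\neq0$ for all distinct $i,j,k$ (all orderings). *)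

(* Defs.v *)
From HB Require Import structures.
From mathcomp Require Import all_boot all_order all_algebra.
From mathcomp Require Import all_classical all_reals all_analysis.
From mathcomp Require Import complex.
From mathcomp Require mpoly.
(* The notations of mpoly clash with those of the analysis library; the import
   is still needed for the algebraic structures on [mpoly n R]. *)
Import -(notations) mpoly.

Set Implicit Arguments.
Unset Strict Implicit.
Unset Printing Implicit Defensive.

Import Order.TTheory GRing.Theory Num.Theory.
Import numFieldNormedType.Exports.

Local Open Scope ring_scope.
Local Open Scope complex_scope.
Local Open Scope classical_set_scope.

Section Weights.
Variable n : nat.

Definition minor2 (T : pzRingType) (X : 'M[T]_(2, n)) (i j : 'I_n) : T :=
  X 0 i * X 1 j - X 1 i * X 0 j.

Definition no_zero_triple (T : pzRingType) (X : 'M[T]_(2, n)) : Prop :=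
  forall i j k : 'I_n, i != j -> i != k -> j != k ->
    minor2 X i j + minor2 X i k + minor2 X j k != 0.

Definition faithful_weights (A : 'M[int]_(2, n)) : Prop :=
  \rank (map_mx intr A : 'M[rat]_(2, n)) = 2%N /\
  \big[gcdn/0%N]_(p : 'I_n * 'I_n) `|minor2 A p.1 p.2|%N = 1%N.

Definition standard_form (A : 'M[int]_(2, n)) : Prop :=
  forall i : 'I_n, 0 < A 0 i.

Definition generic_weights (A : 'M[int]_(2, n)) : Prop :=
  [/\ standard_form A,
      forall i j : 'I_n, i != j -> A 0 i != A 0 j &
      no_zero_triple A].

End Weights.

Section OnShell.
Variables (R : realType) (n : nat).
Implicit Types (A : 'M[int]_(2, n)) (v : 'rV[R[i]]_n) (p : mpoly (n + n) R).

(* R[V] is [mpoly (n + n) R]: the first n variables are the real parts of the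
   complex coordinates of V = C^n, the last n their imaginary parts. *)
Definition real_coords v (t : 'I_(n + n)) : R :=
  match fintype.split t with
  | inl j => complex.Re (v 0 j)
  | inr j => complex.Im (v 0 j)
  end.

Definition torus_act A (z1 z2 : R[i]) v : 'rV[R[i]]_n :=
  \row_j (z1 ^ A 0 j * z2 ^ A 1 j * v 0 j).

Definition torus_invariant A p : Prop :=
  forall (z1 z2 : R[i]) v, `|z1| = 1 -> `|z2| = 1 ->
    meval (real_coords (torus_act A z1 z2 v)) p = meval (real_coords v) p.

(* x_j * conj x_j = (Re x_j)^2 + (Im x_j)^2 *)
Definition moment A (i : 'I_2) : mpoly (n + n) R :=
  2^-1 *: \sum_(j < n) (A i j)%:~R *:
    (mpolyX R (mnm1 (lshift n j)) ^+ 2 + mpolyX R (mnm1 (rshift n j)) ^+ 2).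

Definition moment_ideal A p : Prop :=
  exists f : 'I_2 -> mpoly (n + n) R, p = \sum_(i < 2) f i * moment A i.

Definition invariant_deg A (d : nat) p : Prop :=
  p \is ishomog1 d (@mdeg (n + n)) /\ torus_invariant A p.

(* The classes of b_0, ..., b_(m-1) form a basis of the degree d part of
   R[V]^T / (I_J `&` R[V]^T); as I_J is homogeneous, this part is the quotient
   of the invariants of degree d by those that lie in I_J. *)
Definition onshell_basis A (d m : nat) (b : 'I_m -> mpoly (n + n) R) : Prop :=
  (forall i, invariant_deg A d (b i)) /\
  (forall p, invariant_deg A d p ->
    exists! c : 'rV[R]_m, moment_ideal A (p - \sum_(i < m) c 0 i *: b i)).

Definition hilb_on A (d : nat) : nat :=
  xget 0%N [set m | exists b : 'I_m -> mpoly (n + n) R, onshell_basis A d b].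

Lemma moment_ideal0 A : moment_ideal A 0.
Proof. by exists (fun=> 0); rewrite big1 // => i _; rewrite mul0r. Qed.

Lemma moment_idealD A p q :
  moment_ideal A p -> moment_ideal A q -> moment_ideal A (p + q).
Proof.
move=> [f ->] [g ->]; exists (fun i => f i + g i).
by rewrite -big_split; apply: eq_bigr => i _; rewrite mulrDl.
Qed.

Lemma moment_idealZ A a p : moment_ideal A p -> moment_ideal A (a *: p).
Proof.
move=> [f ->]; exists (fun i => a *: f i).
by rewrite scaler_sumr; apply: eq_bigr => i _; rewrite scalerAl.
Qed.

Lemma invariant_deg_free_bound A d m (b : 'I_m -> mpoly (n + n) R) :
  (forall i, invariant_deg A d (b i)) ->
  (forall c : 'rV[R]_m, moment_ideal A (\sum_(i < m) c 0 i *: b i) -> c = 0) ->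
  (m <= #|{: bmultinom (n + n) d.+1}|)%N.
Proof.
move=> hb hfree.
pose M : 'M[R]_(m, _) :=
  \matrix_(i < m, k < #|{: bmultinom (n + n) d.+1}|) mcoeff (enum_val k) (b i).
suff /eqP <- : row_free M by exact: rank_leq_col.
rewrite -kermx_eq0; apply/eqP/row_matrixP => i; rewrite row0.
set c := row i _; apply: hfree.
suff -> : \sum_(i < m) c 0 i *: b i = 0 by exact: moment_ideal0.
have hcM : c *m M = 0 by rewrite -row_mul mulmx_ker row0.
apply/mpolyP => u; rewrite mcoeff0 raddf_sum /=.
have [hu|hu] := ltnP (mdeg u) d.+1.
  have /rowP/(_ (enum_rank (BMultinom hu))) := hcM.
  rewrite !mxE => hs; rewrite -[RHS]hs; apply: eq_bigr => j _.
  by rewrite mcoeffZ [M _ _]mxE enum_rankK.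
apply: big1 => j _; have [hj _] := hb j.
rewrite mcoeffZ (dhomog_nemf_coeff hj) ?mulr0 //.
by rewrite gtn_eqF.
Qed.

(* [hilb_on] never takes the default value of [xget]. *)
Lemma hilb_onP A d :
  exists b : 'I_(hilb_on A d) -> mpoly (n + n) R, onshell_basis A d b.
Proof.
rewrite /hilb_on; case: xgetP => [m _ //|hno].
pose P m := `[< exists b : 'I_m -> mpoly (n + n) R,
  (forall i, invariant_deg A d (b i)) /\
  (forall c : 'rV[R]_m,
     moment_ideal A (\sum_(i < m) c 0 i *: b i) -> c = 0) >].
have P0 : exists m, P m.
  exists 0%N; apply/asboolP; exists (fun=> 0); split=> [[]//|c _].
  by apply/rowP => -[].
have Pub m : P m -> (m <= #|{: bmultinom (n + n) d.+1}|)%N.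
  by move=> /asboolP[b [hb hfree]]; exact: invariant_deg_free_bound hb hfree.
case: (ex_maxnP P0 Pub) => m /asboolP[b [hb hfree]] hmax.
exfalso; apply: (hno m); exists b; split=> // p hp.
have [c hc] : exists c : 'rV[R]_m,
    moment_ideal A (p - \sum_(i < m) c 0 i *: b i).
  apply: contrapT => hnc.
  have : P m.+1; last by move=> /hmax; rewrite ltnn.
  apply/asboolP; exists (fun i => if unlift ord0 i is Some j then b j else p).
  split=> [i|c]; first by case: unliftP.
  rewrite big_ord_recl unlift_none.
  under eq_bigr do rewrite liftK.
  move=> hc; have [c0|c0] := eqVneq (c 0 ord0) 0.
    move: hc; rewrite c0 scale0r add0r => hc.
    have hc0 : \row_j c 0 (lift ord0 j) = 0.
      by apply: hfree; under eq_bigr do rewrite mxE.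
    apply/rowP => i; rewrite [RHS]mxE.
    case: (unliftP ord0 i) => [j ->|-> //].
    by move/rowP: hc0 => /(_ j); rewrite !mxE.
  exfalso; apply: hnc; exists (\row_j (- (c 0 ord0)^-1 * c 0 (lift ord0 j))).
  have := moment_idealZ (c 0 ord0)^-1 hc.
  rewrite scalerDr scalerA mulVf // scale1r scaler_sumr -sumrN.
  under [in X in _ -> X]eq_bigr do
    rewrite mxE mulNr scaleNr opprK -scalerA.
  by [].
exists c; split=> // c' hc'.
apply/eqP; rewrite -subr_eq0; apply/eqP/hfree.
have := moment_idealD hc' (moment_idealZ (-1) hc).
rewrite scaleN1r opprB addrC addrA subrK -sumrB => h.
under eq_bigr do rewrite !mxE scalerBl.
by [].
Qed.

End OnShell.

Section Laurent.
Variable R : realType.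

(* P / Q is the rational function whose power series at 0 is \sum_d h_d t^d. *)
Definition series_of_ratio (h : nat -> nat) (P Q : {poly R}) : Prop :=
  Q != 0 /\
  forall d : nat, \sum_(i < d.+1) Q`_i * (h (d - i)%N)%:R = P`_d.

(* P / Q = \sum_k g_k (1 - t)^(k - m), read as an identity of power series in
   s = 1 - t after multiplication by s^m Q. *)
Definition laurent_at1 (P Q : {poly R}) (m : nat) (g : nat -> R) : Prop :=
  forall k : nat,
    \sum_(i < k.+1) (Q \Po (1 - 'X))`_i * g (k - i)%N
    = ('X^m * (P \Po (1 - 'X)))`_k.

(* The rational function with power series \sum_d h_d t^d has a pole of order m
   at t = 1, and gamma is the coefficient of (1 - t)^(-m) there. *)
Definition pole_at1 (h : nat -> nat) (m : nat) (gamma : R) : Prop :=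
  exists (P Q : {poly R}) (g : nat -> R),
    [/\ series_of_ratio h P Q, laurent_at1 P Q m g, (0 < m)%N,
        g 0%N != 0 & g 0%N = gamma].

End Laurent.

Section GammaSum.
Variables (R : realType) (n : nat).

(* The index set depends on the signs of the minors of A, not of X. *)
Definition gamma_sum (A : 'M[int]_(2, n)) (X : 'M[R]_(2, n)) : R :=
  \sum_(p : 'I_n * 'I_n | (p.1 != p.2) && (0 < minor2 A p.1 p.2))
    minor2 X p.1 p.2 ^+ (2 * n - 5) /
    \prod_(k < n | (k != p.1) && (k != p.2))
      ((minor2 X p.1 p.2 - minor2 X p.1 k - minor2 X p.2 k) *
       (minor2 X p.1 p.2 + minor2 X p.1 k + minor2 X p.2 k)).

(* [f], considered only where [no_zero_triple] holds, coincides near [Y] with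
   a rational function of the entries that has no pole at [Y]. *)
Definition regular_at (f : 'M[R]_(2, n) -> R) (Y : 'M[R]_(2, n)) : Prop :=
  exists N D : mpoly (2 * n) R,
    meval (mxvec Y 0) D != 0 /\
    \forall X \near Y, no_zero_triple X ->
      f X = meval (mxvec X 0) N / meval (mxvec X 0) D.

Definition removable_along (L f : 'M[R]_(2, n) -> R) (A : 'M[R]_(2, n)) :
    Prop :=
  \forall Y \near A, L Y = 0 -> regular_at f Y.

End GammaSum.

(* Main.v *)
(* Write b_1, ..., b_2n for the weights a_j and -a_j of the coordinates x_j and
   their conjugates. If d_pq <> 0, the two components of the moment map express
   x_p conj(x_p) and x_q conj(x_q) through the other x_j conj(x_j), so the
   invariant monomials divisible by neither form a basis of the quotient, and
   Hilb^on = (1 - t^2)^2 H, where H counts the z in N^2n with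
   sum z_k b_k = 0 by their degree.

   Let the coordinates have real weights w_k > 0 instead of degree 1. Elliott's
   subdivision of pairs (b_i, b_j) into (b_i, b_i + b_j) and (b_i + b_j, b_j)
   decomposes the solution set into translates of free monoids, for all w at
   once; hence H has a pole of order 2n - 2 at t = 1 whose leading coefficient
   is an explicit rational function of w. For w with no integral relation it
   equals a sum over the pairs (i, j) spanning the cone around a fixed ray:
   this sum is additive under subdivision, and on the pieces of the
   decomposition of sum z_k b_k = beta, for beta deep in a cone, the equality is
   a Lagrange interpolation identity. The leading coefficient does not depend
   on beta, as translation by a solution injects one set into the other.

   For w_k equal on x_k and its conjugate, four times the sum is
   prod w_k^-2 times gamma_sum at the matrix with columns a_k / w_k. On
   c_ij + c_ik + c_jk = 0 the residues of the terms (i, j) and (k, j) cancel, so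
   gamma_sum is regular near A, and w -> 1 gives the value of the limit. *)

Require Import Defs.
From HB Require Import structures.
From mathcomp Require Import all_boot all_order all_algebra.
From mathcomp Require Import all_classical all_reals all_analysis.
From mathcomp Require Import complex.
From mathcomp Require mpoly.
Import -(notations) mpoly.
From mathcomp Require Import zify ring lra.

Set Implicit Arguments.
Unset Strict Implicit.
Unset Printing Implicit Defensive.

Import Order.TTheory GRing.Theory Num.Theory.
Import numFieldNormedType.Exports.

Local Open Scope ring_scope.
Local Open Scope classical_set_scope.

(** * Vector partitions and Elliott's reduction *)

Section VectorPartitions.
Variable V : zmodType.
Implicit Types (u p : int * V) (us vs : seq (int * V)).

(** At right-hand side 0 a terminal family with two non-zero vectors has a solution even when its
    cone misses the fixed ray, so leaves and vertex pairs do not match one by one. For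
    [beta = (m, M)] with m large and M much larger, a terminal family whose cone misses the ray has
    no solution at all, and the match becomes exact. The symmetry of the weights carries the
    coefficient back to 0: by Cramer's rule every multiple of a minor, with either sign, is a
    reachable right-hand side. The weights w stay variable because vertex denominators may vanish at
    w = 1, and because each subdivision adds two weights. Agreement holds first for w without
    integral relation. Continuity is then used twice, since weights equal on a coordinate and its
    conjugate always satisfy a relation and are themselves only limits of such w. The ranks of the
    leaves bound the pole order from above, but do not show that a leaf of full rank exists. The
    leading coefficient is positive because the solutions outnumber a free monoid of rank 2n - 2;
    such counts are compared through the values of their series on ]0, 1[. *)

Fixpoint vpart us p : nat :=
  if us is u :: us' then (\sum_(j < `|p.1|.+1) vpart us' (p - u *+ j)%R)%N
  else (p == 0).

Definition posw us := all (fun u => 0 < u.1) us.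

Lemma fstMn u j : (u *+ j).1 = u.1 *+ j.
Proof. by elim: j => [|j IH]; rewrite ?mulr0n // !mulrS /= IH. Qed.

Lemma sndMn u j : (u *+ j).2 = u.2 *+ j.
Proof. by elim: j => [|j IH]; rewrite ?mulr0n // !mulrS /= IH. Qed.

Lemma fst_sub_lt p u : 0 < u.1 -> (p - u).1 < p.1.
Proof. by rewrite /= ltrBlDr ltrDl. Qed.

Lemma vpart_lt0 us p : posw us -> p.1 < 0 -> vpart us p = 0%N.
Proof.
elim: us p => [|u us IH] p /=.
  by move=> _; case: eqP => // ->.
case/andP=> hu hus hp; apply: big1 => j _; apply: IH => //.
rewrite /= fstMn; have : 0 <= u.1 *+ j by rewrite mulrn_wge0 // ltW.
lia.
Qed.

Lemma vpart_bound u us p k : posw (u :: us) -> (`|p.1| < k)%N ->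
  vpart (u :: us) p = (\sum_(j < k) vpart us (p - u *+ j)%R)%N.
Proof.
case/andP=> hu hus hk /=; rewrite (big_ord_widen k (fun j => vpart us (p - u *+ j))) //.
rewrite big_mkcond; apply: eq_bigr => j _; case: ltnP => // hj.
rewrite vpart_lt0 //= fstMn.
have : (j : int) <= u.1 *+ j by rewrite -mulr_natr natz ler_peMl //; lia.
lia.
Qed.

Lemma vpartS u us p : posw (u :: us) ->
  vpart (u :: us) p = (vpart us p + vpart (u :: us) (p - u)%R)%N.
Proof.
move=> h; pose k := (`|p.1| + `|p.1 - u.1|).+1.
rewrite (@vpart_bound _ _ p k.+1 h) ?(@vpart_bound _ _ (p - u) k h); first last.
- by rewrite /k; lia.
- by rewrite /k /=; lia.
rewrite big_ord_recl mulr0n subr0; congr addn; apply: eq_bigr => j _.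
by rewrite /= mulrS opprD addrA.
Qed.

Lemma eq_vpart_cons u us vs p : vpart us =1 vpart vs ->
  vpart (u :: us) p = vpart (u :: vs) p.
Proof. by move=> h /=; apply: eq_bigr => j _; exact: h. Qed.

Lemma leq_vpart_cons u us vs p : (forall q, vpart us q <= vpart vs q)%N ->
  (vpart (u :: us) p <= vpart (u :: vs) p)%N.
Proof. by move=> h /=; apply: leq_sum => j _; exact: h. Qed.

Arguments vpart : simpl never.

Lemma vpart_subS u us p : posw (u :: us) ->
  (vpart (u :: us) (p - u)%R <= vpart (u :: us) p)%N.
Proof. by move=> h; rewrite (vpartS p h) leq_addl. Qed.

(** Counts vanish in negative grade, so induction on an integer grade may take all negative grades
    as its base. *)
Lemma grade_ind (P : int * V -> Prop) :
  (forall p : int * V, p.1 < 0 -> P p) ->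
  (forall p : int * V, (forall q : int * V, q.1 < p.1 -> P q) -> P p) ->
  forall p, P p.
Proof.
move=> P0 PS p; have [n] := ubnP `|p.1|; elim: n p => // n IH p hp.
case: (ltP p.1 0) => [|hp0]; first exact: P0.
apply: PS => q hq; case: (ltP q.1 0) => [|hq0]; first exact: P0.
by apply: IH; lia.
Qed.

Lemma vpart_swapS u v us p : posw (u :: v :: us) ->
  vpart (u :: v :: us) p = (vpart (u :: us) p + vpart (u :: v :: us) (p - v)%R)%N.
Proof.
move=> h; have /and3P[hu hv hus] := h.
have huu : posw (u :: us) by apply/andP.
have hvv : posw (v :: us) by apply/andP.
elim/grade_ind: p => p.
  move=> hp; rewrite !vpart_lt0 //=; lia.
move=> IH; rewrite (vpartS p h) (IH (p - u)); last by rewrite /=; lia.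
rewrite (vpartS (p - v) h).
rewrite (_ : p - u - v = p - v - u); last by rewrite addrAC.
rewrite (vpartS p hvv) (vpartS p huu); lia.
Qed.

Lemma vpart_swap u v us p : posw (u :: v :: us) ->
  vpart (u :: v :: us) p = vpart (v :: u :: us) p.
Proof.
move=> h; have /and3P[hu hv hus] := h.
have h' : posw (v :: u :: us) by apply/and3P.
elim/grade_ind: p => p.
  by move=> hp; rewrite !vpart_lt0.
move=> IH; rewrite vpart_swapS // (vpartS p h') IH //=; lia.
Qed.

Lemma perm_posw us vs : perm_eq us vs -> posw us = posw vs.
Proof. exact: perm_all. Qed.

Lemma vpart_perm us vs : posw us -> perm_eq us vs -> vpart us =1 vpart vs.
Proof.
have hcat x s1 s2 : posw (s1 ++ x :: s2) ->
  vpart (s1 ++ x :: s2) =1 vpart (x :: s1 ++ s2).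
  elim: s1 => [|y s1 IH] //= /andP[hy h] p.
  rewrite (eq_vpart_cons _ _ (IH h)) vpart_swap // /posw /= hy /=.
  by move: h; rewrite /posw !all_cat /= => /and3P[-> -> ->].
elim: us vs => [|u us IH] vs; first by rewrite perm_sym => _ /perm_nilP ->.
move=> h hp; have /path.splitPr hin : u \in vs by rewrite -(perm_mem hp) mem_head.
case: hin hp => s1 s2 hp p; rewrite hcat; last by rewrite -(perm_posw hp).
apply: eq_vpart_cons; apply: IH; first by case/andP: h.
by rewrite -(perm_cons u) (perm_trans hp) // perm_catC /= perm_cons perm_catC.
Qed.

(* The points with [z_u >= z_v] and those with [z_u < z_v]. *)
Lemma vpart_split u v us p : posw (u :: v :: us) ->
  vpart (u :: v :: us) p =
  (vpart (u :: (u + v)%R :: us) p + vpart (v :: (u + v)%R :: us) (p - v)%R)%N.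
Proof.
move=> h; have /and3P[hu hv hus] := h.
have huv : 0 < (u + v).1 by rewrite /= addr_gt0.
have h1 : posw (u :: (u + v) :: us) by apply/and3P.
have h2 : posw (v :: (u + v) :: us) by apply/and3P.
have huu : posw (u :: us) by apply/andP.
have hvv : posw (v :: us) by apply/andP.
elim/grade_ind: p => p.
  move=> hp; rewrite !vpart_lt0 //=; lia.
move=> IH; rewrite (vpart_swapS p h1) (vpart_swapS (p - v) h2).
have -> : p - v - (u + v) = p - (u + v) - v by rewrite addrAC.
have IHp := IH (p - (u + v)) (fst_sub_lt p huv).
rewrite (vpartS p h) (vpart_swapS (p - u) h).
have -> : p - u - v = p - (u + v) by rewrite opprD addrA.
rewrite IHp (vpartS p hvv) (vpartS p huu); ring.
Qed.

Lemma vpart_drop u us p : posw (u :: us) -> (vpart us p <= vpart (u :: us) p)%N.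
Proof. by move=> h; rewrite (vpartS p h) leq_addr. Qed.

(** The count with head [u + x] is one of the two parts of [vpart_split]: the points that use [x] at
    least as often as [u]. The lower bound on the pole rests on this. *)
Lemma vpart_addhd u us x p : posw (u :: us) -> x \in us ->
  (vpart ((u + x)%R :: us) p <= vpart (u :: us) p)%N.
Proof.
move=> h hx; have /andP[hu hus] := h.
have hp : perm_eq us (x :: rem x us) by exact: perm_to_rem.
have hx1 : 0 < x.1 by move/allP: hus; apply.
have hr : posw (x :: rem x us) by rewrite -(perm_posw hp).
have e q : vpart (q :: us) p = vpart [:: q, x & rem x us] p.
  exact: eq_vpart_cons (vpart_perm hus hp).
rewrite (e (u + x)) (e u).
have hux : 0 < (u + x).1 by rewrite /= addr_gt0.
rewrite vpart_swap; last by apply/andP.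
rewrite [leqRHS]vpart_swap; last by apply/andP.
rewrite [leqRHS]vpart_split; first by rewrite addrC leq_addr.
by case/andP: hr => ? ?; apply/and3P.
Qed.

Lemma vpart_scalehd u us c p : posw (u :: us) ->
  (vpart ((u *+ c.+1)%R :: us) p <= vpart (u :: us) p)%N.
Proof.
move=> h; have /andP[hu hus] := h.
have hc : posw (u *+ c.+1 :: us) by apply/andP; rewrite /= fstMn pmulrn_rgt0.
elim/grade_ind: p => p; first by move=> hp; rewrite !vpart_lt0.
move=> IH; rewrite (vpartS p h) (vpartS p hc) leq_add2l.
have hlt : (p - u *+ c.+1).1 < p.1 by apply: fst_sub_lt; case/andP: hc.
apply: leq_trans (IH _ hlt) _; rewrite mulrS opprD addrA.
elim: c {IH hc hlt} => [|c IHc]; first by rewrite mulr0n subr0.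
apply: leq_trans IHc; rewrite mulrSr opprD addrA; exact: vpart_subS.
Qed.

Lemma leq_vpart_catl us vs r p :
  (forall q, vpart us q <= vpart vs q)%N -> (vpart (r ++ us) p <= vpart (r ++ vs) p)%N.
Proof.
move=> h; elim: r p => [|x r IH] p /=; first exact: h.
exact: leq_vpart_cons.
Qed.

End VectorPartitions.
Arguments vpart : simpl never.

(** * Indexed families and their decomposition into free monoids *)

Section Families.
Variable I : finType.

Definition upd T (f : I -> T) i x k := if k == i then x else f k.

Definition leaf := ({ffun I -> nat} * seq {ffun I -> nat})%type.

Definition dot (M : nmodType) (w : I -> M) (l : {ffun I -> nat}) : M :=
  \sum_k w k *+ l k.

(** The change of exponents dual to replacing [w j] by [w i + w j]: each use of the sum is one use
    of both summands. *)
Definition transfer (i j : I) (l : {ffun I -> nat}) : {ffun I -> nat} :=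
  [ffun k => if k == i then (l i + l j)%N else l k].

Lemma dot_upd (M : nmodType) (w : I -> M) i j l : i != j ->
  dot (upd w j (w i + w j)) l = dot w (transfer i j l).
Proof.
move=> hij; rewrite /dot (bigD1 i) // (bigD1 j) 1?eq_sym //=.
rewrite [RHS](bigD1 i) // (bigD1 j) 1?eq_sym //=.
rewrite /upd !ffunE (negbTE hij) !eqxx eq_sym (negbTE hij).
rewrite mulrnDl mulrnDr addrA addrAC -!addrA; congr (_ + _).
rewrite addrCA addrA addrC -!addrA addrC -!addrA; congr (_ + _).
rewrite addrC; congr (_ + _); apply: eq_bigr => k /andP[h1 h2].
by rewrite ffunE (negbTE h1) (negbTE h2).
Qed.

Definition gvec (w : I -> int) (b : I -> int * int) k : int * (int * int) :=
  (w k, b k).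

Definition vfam w b p := vpart [seq gvec w b k | k <- enum I] p.

Definition posf (w : I -> int) := forall k, 0 < w k.

Lemma posf_upd w i j : posf w -> posf (upd w i (w i + w j)).
Proof. by move=> h k; rewrite /upd; case: ifP => // _; rewrite addr_gt0. Qed.

Lemma posw_gvec w b s : posf w -> posw [seq gvec w b k | k <- s].
Proof. by move=> h; rewrite /posw all_map; apply/allP => k _; exact: h. Qed.

Lemma enum_perm2 (i j : I) : i != j ->
  perm_eq (enum I) (i :: j :: [seq k <- enum I | (k != i) && (k != j)]).
Proof.
move=> hij; apply: uniq_perm; rewrite ?enum_uniq //=.
  by rewrite inE !mem_filter !eqxx andbF (negbTE hij) filter_uniq // enum_uniq.
move=> k; rewrite fintype.mem_enum !in_cons mem_filter fintype.mem_enum !inE andbT.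
by case: (k == i) => //=; case: (k == j).
Qed.

Lemma vfam_perm w b s p : posf w -> perm_eq (enum I) s ->
  vfam w b p = vpart [seq gvec w b k | k <- s] p.
Proof.
by move=> hw hs; apply: vpart_perm; [exact: posw_gvec | exact: perm_map].
Qed.

Lemma vfam_split w b i j p : i != j -> posf w ->
  vfam w b p =
  (vfam (upd w j (w i + w j)%R) (upd b j (b i + b j)%R) p +
   vfam (upd w i (w i + w j)%R) (upd b i (b i + b j)%R) (p - gvec w b j)%R)%N.
Proof.
move=> hij hw; have hs := enum_perm2 hij.
have h1 : posf (upd w j (w i + w j)) by rewrite addrC; exact: posf_upd.
have h2 : posf (upd w i (w i + w j)) by exact: posf_upd.
rewrite !(vfam_perm _ _ _ hs) //= vpart_split; last first.
  exact: (posw_gvec b (i :: j :: _) hw).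
have hrest k0 x y : k0 \in [:: i; j] ->
  [seq gvec (upd w k0 x) (upd b k0 y) k | k <- enum I & (k != i) && (k != j)] =
  [seq gvec w b k | k <- enum I & (k != i) && (k != j)].
  move=> hk0; apply/eq_in_map => k; rewrite mem_filter => /andP[/andP[ki kj] _].
  rewrite /gvec /upd; case: eqP => // ek; move: hk0; rewrite -ek !inE.
  by rewrite (negbTE ki) (negbTE kj).
rewrite !hrest ?inE ?eqxx ?orbT //; congr addn.
  congr (vpart (_ :: _ :: _) _); rewrite /gvec /upd ?eqxx //.
  by rewrite (negbTE hij).
rewrite vpart_swap.
  congr (vpart (_ :: _ :: _) _); rewrite /gvec /upd ?eqxx //.
  by rewrite eq_sym (negbTE hij).
have /and3P[p1 p2 p3] := posw_gvec b (i :: j :: [seq k <- enum I | (k != i) && (k != j)]) hw.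
by apply/and3P; split=> //=; rewrite addr_gt0.
Qed.

(** Non-zero generators have positive degree for every positive weight, and a rank of at most
    [#|I| - 2], the dimension of the solution space, bounds the order of the pole. *)
Definition leaf_ok (la : leaf) :=
  (forall l, l \in la.2 -> exists k, (0 < l k)%N) /\ (size la.2 + 2 <= #|I|)%N.

Definition leaf_count (w : I -> int) (la : leaf) (d : int) : nat :=
  vpart [seq (dot w l, 0 : int * int) | l <- la.2] (d - dot w la.1, 0).

(* The solutions z of [\sum_k z_k b_k = beta] are the disjoint union of the
   translated free monoids e + <l_1, ..., l_r> for (e, [l_1; ...; l_r]) in L,
   expressed through generating functions for all the weights w at once. *)
Definition decomposes (b : I -> int * int) (beta : int * int) (L : seq leaf) :=
  (forall la, la \in L -> leaf_ok la) /\
  forall w, posf w -> forall d : int,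
    vfam w b (d, beta) = (\sum_(la <- L) leaf_count w la d)%N.

(** The coefficient of the pole of order [#|I| - 2]: a free monoid of lower rank has a smaller pole,
    and the translation of a leaf does not affect its leading term. *)
Definition leading (R : fieldType) (w : I -> R) (L : seq leaf) : R :=
  \sum_(la <- L | (size la.2 + 2 == #|I|)%N) \prod_(l <- la.2) (dot w l)^-1.

Definition leaf1 i j (la : leaf) : leaf :=
  (transfer i j la.1, map (transfer i j) la.2).

(** The extra unit at [j] makes the inequality [z_i < z_j] of the second part of a split strict. *)
Definition leaf2 i j (la : leaf) : leaf :=
  ([ffun k => transfer j i la.1 k + (k == j)]%N, map (transfer j i) la.2).

Lemma transfer_pos i j (l : {ffun I -> nat}) : (exists k, (0 < l k)%N) ->
  exists k, (0 < transfer i j l k)%N.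
Proof.
move=> [k hk]; exists k; rewrite ffunE; case: eqP => [<-|] //.
by rewrite addn_gt0 hk.
Qed.

Lemma decomposes_split b beta i j L1 L2 : i != j ->
  decomposes (upd b j (b i + b j)) beta L1 ->
  decomposes (upd b i (b i + b j)) (beta - b j) L2 ->
  decomposes b beta (map (leaf1 i j) L1 ++ map (leaf2 i j) L2).
Proof.
move=> hij [ok1 c1] [ok2 c2]; split=> [la|w hw d].
  rewrite mem_cat => /orP[] /mapP[la' hla' ->].
    have [h1 h2] := ok1 _ hla'; split; last by rewrite size_map.
    by move=> l /mapP[l' hl' ->]; exact/transfer_pos/h1.
  have [h1 h2] := ok2 _ hla'; split; last by rewrite size_map.
  by move=> l /mapP[l' hl' ->]; exact/transfer_pos/h1.
have hji : j != i by rewrite eq_sym.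
rewrite (vfam_split _ _ hij) // big_cat !big_map /=; congr addn.
  rewrite c1; last by rewrite addrC; exact: posf_upd.
  apply: eq_bigr => la _; rewrite /leaf_count /= dot_upd // -map_comp.
  by congr vpart; apply: eq_map => l /=; rewrite dot_upd.
rewrite (_ : (d, beta) - gvec w b j = (d - w j, beta - b j)) //.
rewrite c2; last exact: posf_upd.
apply: eq_bigr => la _; rewrite /leaf_count /= [w i + w j]addrC dot_upd // -map_comp.
congr vpart; first by apply: eq_map => l /=; rewrite dot_upd.
congr pair; rewrite -addrA -opprD; congr (_ - _); rewrite /dot.
under [RHS]eq_bigr do rewrite ffunE mulrnDr.
rewrite big_split /= addrC; congr (_ + _).
by rewrite (bigD1 j) //= eqxx big1 ?addr0 // => k /negbTE ->.
Qed.

Lemma leading_split (R : fieldType) (w : I -> R) i j L1 L2 : i != j ->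
  leading w (map (leaf1 i j) L1 ++ map (leaf2 i j) L2) =
  leading (upd w j (w i + w j)) L1 + leading (upd w i (w i + w j)) L2.
Proof.
move=> hij; rewrite /leading big_cat !big_map /=; congr (_ + _).
  apply: eq_big => [la|la _] /=; first by rewrite size_map.
  by rewrite big_map; apply: eq_bigr => l _; rewrite dot_upd.
rewrite addrC.
apply: eq_big => [la|la _] /=; first by rewrite size_map.
by rewrite big_map; apply: eq_bigr => l _; rewrite dot_upd // eq_sym.
Qed.

End Families.

(** * Elliott's reduction to families of one sign *)

Section ElliottReduction.
Variables (I : finType) (V : zmodType) (S : {pred I}).
Implicit Types (b : I -> V) (P : (I -> V) -> Prop).

Definition split_closed P := forall b i j,
  i \in S -> j \in S -> i != j ->
  P (upd b j (b i + b j)) -> P (upd b i (b i + b j)) -> P b.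

Definition one_signed (g : V -> int) b :=
  (forall k, k \in S -> 0 <= g (b k)) \/ (forall k, k \in S -> g (b k) <= 0).

Let bounded (g : V -> int) b (M : nat) := forall k, k \in S -> (`|g (b k)| <= M)%N.
Let extremal (g : V -> int) b (M : nat) := [set k in S | `|g (b k)|%N == M].
Let negative (g : V -> int) b := [set k in S | g (b k) < 0].

(** If [g (b i)] is the maximal value M + 1 and [g (b j)] is negative, the value of the sum lies in
    [0, M]. Written at [j], it removes a negative index and leaves [i] maximal; written at [i], it
    removes an extremal index. *)
Lemma elliott_step P (g : V -> int) M c : {morph g : x y / x + y} ->
  split_closed P -> (forall b, one_signed g b -> P b) ->
  (forall b, bounded g b M.+1 -> (#|extremal g b M.+1| < c)%N -> P b) ->
  forall q b, bounded g b M.+1 -> (#|extremal g b M.+1| <= c)%N ->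
  (exists2 i, i \in S & g (b i) = M.+1) -> (#|negative g b| <= q)%N -> P b.
Proof.
move=> gD Pcl Psg IHc; elim=> [|q IHq] b hb hc [i iS gi] hq.
  apply: Psg; left=> k kS; move: hq; rewrite leqn0 cards_eq0 => /eqP/finset.setP/(_ k).
  by rewrite !inE kS /= leNgt => ->.
have [/existsP[j /andP[jS hj]]|hn] := boolP [exists j, (j \in S) && (g (b j) < 0)];
  last first.
  apply: Psg; left=> k kS; rewrite leNgt; apply: contra hn => hk.
  by apply/existsP; exists k; rewrite kS.
have hij : i != j by apply: contraTneq hj => <-; rewrite gi.
have hbj := hb _ jS.
have gs : g (b i + b j) = M.+1%:Z + g (b j) by rewrite gD gi.
apply: (Pcl b i j) => //.
  apply: IHq.
  - move=> k kS; rewrite /upd; case: eqP => _; last exact: hb.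
    by rewrite gs; lia.
  - apply: leq_trans hc; apply: subset_leq_card; apply/fintype.subsetP => k.
    rewrite !inE /upd => /andP[-> /=]; case: (k =P j) => // ->; rewrite gs.
    by move=> /eqP h; exfalso; lia.
  - by exists i => //; rewrite /upd (negbTE hij).
  - rewrite -ltnS; apply: leq_trans hq; apply: proper_card.
    apply/properP; split; last first.
      exists j; rewrite !inE jS ?hj //= /upd eqxx gs -leNgt; lia.
    apply/fintype.subsetP => k; rewrite !inE /upd => /andP[-> /=].
    by case: eqP => // ->; rewrite gs => h; exfalso; lia.
apply: IHc.
  move=> k kS; rewrite /upd; case: eqP => _; last exact: hb.
  by rewrite gs; lia.
apply: leq_trans hc; apply: proper_card; apply/properP; split; last first.
  exists i; rewrite !inE iS ?gi //= /upd eqxx gs; lia.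
apply/fintype.subsetP => k; rewrite !inE /upd => /andP[-> /=].
case: (k =P i) => // ->; rewrite gs => /eqP h; exfalso; lia.
Qed.

(* Elliott's reduction: the largest absolute value of g, the number of indices
   attaining it and the number of indices of the opposite sign decrease
   lexicographically. *)
Lemma elliott_reduction P (g : V -> int) : {morph g : x y / x + y} ->
  split_closed P -> (forall b, one_signed g b -> P b) -> forall b, P b.
Proof.
move=> gD Pcl Psg.
suff H M b : bounded g b M -> P b.
  move=> b; apply: (H (\sum_k `|g (b k)|)%N) => k _.
  by rewrite (bigD1 k) //= leq_addr.
elim: M b => [|M IHM] b.
  by move=> hb; apply: Psg; left=> k kS; have := hb _ kS; lia.
have [c] := ubnP #|extremal g b M.+1|; elim: c b => // c IHc b hc hb.
have [he|] := posnP #|extremal g b M.+1|.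
  apply: IHM => k kS; have := hb _ kS; rewrite leq_eqVlt => /orP[/eqP h|//].
  by move/cards0_eq/finset.setP/(_ k): he; rewrite !inE kS h eqxx.
move=> hgt; have [ii hii] := card_gt0P hgt; move: ii hii => i; rewrite inE => /andP[iS /eqP hi].
have IHc' b' : bounded g b' M.+1 -> (#|extremal g b' M.+1| < c)%N -> P b'.
  by move=> h1 h2; apply: IHc.
have [gi|gi] := leP 0 (g (b i)).
  apply: (@elliott_step P g M c gD Pcl Psg IHc' _ b hb hc) (leqnn _).
  by exists i => //; lia.
(* An extremal index of negative value becomes one of positive value for the opposite form, which
   has the same bounds and the same extremal indices. *)
pose g' x := - g x.
have gD' : {morph g' : x y / x + y} by move=> x y; rewrite /g' gD opprD.
have Psg' b' : one_signed g' b' -> P b'.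
  by rewrite /g' => -[h|h]; apply: Psg; [right|left] => k kS; have := h _ kS; lia.
have ee b' : extremal g' b' M.+1 = extremal g b' M.+1.
  by apply/finset.setP => k; rewrite !inE abszN.
have eb b' : bounded g' b' M.+1 -> bounded g b' M.+1.
  by move=> h k kS; rewrite -abszN; exact: h.
apply: (@elliott_step P g' M c gD' Pcl Psg' _ _ b _ _ _ (leqnn _)).
- by move=> b' h1; rewrite ee => h2; apply: IHc' => //; exact: eb.
- by move=> k kS; rewrite abszN; exact: hb.
- by rewrite ee.
- by exists i => //; rewrite /g'; lia.
Qed.

End ElliottReduction.

(** The terminal families: their non-zero vectors lie in a common open half-plane, by
    [lexsigned_pointed]. *)
Definition lexsigned (I : finType) (b : I -> int * int) :=
  ((forall k, 0 <= (b k).1) \/ (forall k, (b k).1 <= 0)) /\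
  ((forall k, (b k).1 = 0 -> 0 <= (b k).2) \/
   (forall k, (b k).1 = 0 -> (b k).2 <= 0)).

(** Elliott's reduction is run twice, on the first coordinates of all indices and then on the second
    coordinates of the indices with first coordinate 0. The second run adds only vectors of the
    latter kind and so preserves what the first achieved. *)
Lemma lexsigned_ind (I : finType) (P : (I -> int * int) -> Prop) :
  (forall b i j, i != j -> P (upd b j (b i + b j)) ->
     P (upd b i (b i + b j)) -> P b) ->
  (forall b, lexsigned b -> P b) -> forall b, P b.
Proof.
move=> Pcl Pl.
apply: (@elliott_reduction _ _ predT P fst) => //.
  by move=> b i j _ _; exact: Pcl.
move=> b0 hb0.
pose S := [pred k | (b0 k).1 == 0].
pose Q b := (forall k, (b k).1 = (b0 k).1) -> P b.
suff : Q b0 by apply.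
apply: (@elliott_reduction _ _ S Q snd) => //.
  move=> b i j; rewrite !inE => /eqP iS /eqP jS ij h1 h2 hb.
  apply: (Pcl b i j ij); [apply: h1|apply: h2] => k;
    by rewrite /upd; case: eqP => // -> /=; rewrite !hb iS jS.
move=> b hs hb; apply: Pl; split.
  by case: hb0 => h; [left|right] => k; rewrite hb; exact: h.
by case: hs => h; [left|right] => k hk; apply: h; rewrite inE -hb hk.
Qed.

(** * Finitely many solutions in a half-plane *)

Section PointedFamilies.
Variable I : finType.
Implicit Types (b : I -> int * int) (z : {ffun I -> nat}).

Lemma vpart_trunc (V : zmodType) (u : int * V) us p n : posw (u :: us) ->
  (forall j, (n <= j)%N -> vpart us (p - u *+ j) = 0%N) ->
  vpart (u :: us) p = (\sum_(j <- iota 0 n) vpart us (p - u *+ j)%R)%N.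
Proof.
move=> h h0; pose m := (n + `|p.1|).+1.
rewrite (@vpart_bound _ _ _ _ m) //; last by rewrite ltnS leq_addl.
rewrite -(big_mkord predT (fun j => vpart us (p - u *+ j)%R)).
have hnm : (n <= m)%N by rewrite leqW ?leq_addr.
rewrite (big_cat_nat (leq0n _) hnm) /= [X in (_ + X)%N]big_nat_cond.
rewrite [X in (_ + X)%N]big1 => [|j /andP[/andP[hj _] _]]; last exact: h0.
by rewrite addn0 /index_iota subn0.
Qed.

Lemma vpart_snd_neq0 (V : zmodType) us (p : int * V) :
  (forall u, u \in us -> u.2 = 0) -> p.2 != 0 -> vpart us p = 0%N.
Proof.
elim: us p => [|u us IH] p h hp.
  by rewrite /vpart; case: (p =P 0) hp => // ->; rewrite eqxx.
rewrite /vpart -/(@vpart V); apply: big1 => j _; apply: IH.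
  by move=> x hx; apply: h; rewrite inE hx orbT.
by rewrite /= sndMn (h u) ?mem_head // mul0rn subr0.
Qed.

Definition setz z k j : {ffun I -> nat} := [ffun x => if x == k then j else z x].

Lemma dot_setz (M : zmodType) (w : I -> M) z k j : z k = 0%N ->
  dot w (setz z k j) = w k *+ j + dot w z.
Proof.
move=> hz; rewrite /dot (bigD1 k) //= [in RHS](bigD1 k) //= hz mulr0n add0r.
rewrite ffunE eqxx; congr (_ + _); apply: eq_bigr => x /negbTE hx.
by rewrite ffunE hx.
Qed.

Lemma setz_id z k : setz z k (z k) = z.
Proof. by apply/ffunP => x; rewrite ffunE; case: eqP => // ->. Qed.

Lemma setz_setz z k i j : setz (setz z k i) k j = setz z k j.
Proof. by apply/ffunP => x; rewrite !ffunE; case: eqP. Qed.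

(** A functional positive on the vectors of [s] bounds their multiplicities, so only finitely many
    solutions are supported on [s]; the zero vectors in [zs] remain free. Induction on [s] splits
    off the multiplicity of its head. *)
Lemma pointed_expand b (phi : int * int -> int) (s zs : seq I) :
  {morph phi : x y / x + y} -> uniq s ->
  (forall k, k \in s -> 0 < phi (b k)) -> (forall k, k \in zs -> b k = 0) ->
  forall beta : int * int, exists sols : seq {ffun I -> nat},
    [/\ uniq sols,
        forall z, (z \in sols) <->
          (forall k, k \notin s -> z k = 0%N) /\ dot b z = beta
      & forall w, posf w -> forall d : int,
        vpart ([seq gvec w b k | k <- s] ++ [seq gvec w b k | k <- zs]) (d, beta) =
        (\sum_(z <- sols)
           vpart [seq gvec w b k | k <- zs] (d - dot w z, 0)%R)%N].
Proof.
move=> phiD us hs hzs.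
have phi0 : phi 0 = 0 by apply: (addrI (phi 0)); rewrite -phiD !addr0.
have phiMn (x : int * int) j : phi (x *+ j) = phi x *+ j.
  by elim: j => [|j IH]; rewrite ?mulr0n // !mulrS phiD IH.
have phi_dot z : phi (dot b z) = \sum_k phi (b k) *+ z k.
  rewrite /dot (big_morph phi phiD phi0); apply: eq_bigr => k _; exact: phiMn.
elim: s us hs => [|k s IH] us hs beta.
  exists (if beta == 0 then [:: [ffun=> 0%N]] else [::]); split.
  - by case: ifP.
  - move=> z; split.
      case: eqP => // ->; rewrite inE => /eqP ->.
      by split=> [k _|]; rewrite ?ffunE // /dot big1 // => k _; rewrite ffunE.
    move=> [h0 <-]; have -> : z = [ffun=> 0%N].
      by apply/ffunP => k; rewrite ffunE h0.
    rewrite (_ : dot b _ = 0) ?eqxx ?mem_head //.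
    by rewrite /dot big1 // => k _; rewrite ffunE.
  move=> w hw d; case: eqP => [->|/eqP hb]; last first.
    rewrite big_nil; apply: vpart_snd_neq0 => // u /mapP[k hk ->] /=; exact: hzs.
  rewrite big_seq1 (_ : dot w _ = 0) ?subr0 //.
  by rewrite /dot big1 // => k _; rewrite ffunE.
have /andP[ks us'] := us.
have hs' x : x \in s -> 0 < phi (b x) by move=> hx; rewrite hs // inE hx orbT.
have {}IH := IH us' hs'.
have [f hf] := choice IH; clear IH.
have hk : 0 < phi (b k) by apply: hs; exact: mem_head.
(* Since [phi (b k)] is at least 1, the multiplicity of [k] is at most [phi beta], and there is no
   solution when this is negative. *)
pose js := iota 0 (if 0 <= phi beta then `|phi beta|.+1 else 0%N).
have hvan (w : I -> int) (d : int) (beta' : int * int) : posf w -> phi beta' < 0 ->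
    vpart ([seq gvec w b k | k <- s] ++ [seq gvec w b k | k <- zs]) (d, beta') = 0%N.
  move=> hw hlt; have [_ h2 ->//] := hf beta'.
  case: (f beta') h2 => [|z sl] h2; first by rewrite big_nil.
  have [hz0 hz] := (h2 z).1 (mem_head _ _).
  suff : 0 <= phi beta' by rewrite leNgt hlt.
  rewrite -hz phi_dot; apply: sumr_ge0 => x _.
  have [xs|/hz0->] := boolP (x \in s); last by rewrite mulr0n.
  by rewrite mulrn_wge0 // ltW // hs // inE xs orbT.
exists [seq setz z k j | j <- js, z <- f (beta - b k *+ j)]; split.
- apply: allpairs_uniq_dep.
  + exact: iota_uniq.
  + by move=> j _; have [] := hf (beta - b k *+ j).
  + have hz0 j z : z \in f (beta - b k *+ j) -> z k = 0%N.
      have [_ h2 _] := hf (beta - b k *+ j).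
      by move=> hz; have [h3 _] := (h2 z).1 hz; apply: h3.
    move=> t1 t2 /allpairsPdep[j1 [z1 [_ /hz0 h1 ->]]].
    move=> /allpairsPdep[j2 [z2 [_ /hz0 h2 ->]]] /= e.
    have e1 : j1 = j2 by move/ffunP/(_ k): e; rewrite !ffunE eqxx.
    subst j2; congr existT; apply/ffunP => x; move/ffunP/(_ x): e.
    by rewrite !ffunE; case: eqP => // ->; rewrite h1 h2.
- move=> z; split.
    case/allpairsPdep => j [z' [_ hz' ->]].
    have [_ h2 _] := hf (beta - b k *+ j); have [h3 h4] := (h2 z').1 hz'.
    split=> [x|]; last by rewrite dot_setz ?h3 // h4 addrC subrK.
    by rewrite inE negb_or ffunE => /andP[/negbTE -> hx]; exact: h3.
  move=> [h1 h2]; apply/allpairsPdep; exists (z k), (setz z k 0); split.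
  + rewrite mem_iota /=.
    have hz : (z k : int) <= phi beta.
      rewrite -h2 phi_dot (bigD1 k) //= -[leLHS]addr0; apply: lerD.
        by rewrite -mulr_natr natz ler_peMl //; lia.
      apply: sumr_ge0 => x _.
      have [xs|/h1->] := boolP (x \in k :: s); last by rewrite mulr0n.
      by rewrite mulrn_wge0 // ltW // hs.
    by rewrite (_ : 0 <= phi beta) //; lia.
  + have [_ h3 _] := hf (beta - b k *+ z k); apply/h3; split.
      move=> x hx; rewrite ffunE; case: eqP => // /eqP xk; apply: h1.
      by rewrite inE negb_or xk.
    have := dot_setz b (k := k) (z := setz z k 0) (z k).
    rewrite setz_setz setz_id h2 ffunE eqxx => /(_ erefl) ->.
    by rewrite addrC addrA addNr add0r.
  + by rewrite setz_setz setz_id.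
move=> w hw d; rewrite big_allpairs_dep /= (@vpart_trunc _ _ _ _ (size js)).
- rewrite size_iota; apply: eq_bigr => j _.
  have [_ h2 h3] := hf (beta - b k *+ j).
  rewrite (_ : (d, beta) - gvec w b k *+ j = (d - w k *+ j, beta - b k *+ j)); last first.
    by apply/eqP; rewrite xpair_eqE /= fstMn sndMn !eqxx.
  rewrite h3 //; apply: eq_big_seq => z hz.
  have [hz0 _] := (h2 z).1 hz.
  by rewrite dot_setz ?hz0 // opprD addrA.
- by rewrite -map_cat -(map_cons (gvec w b)); exact: posw_gvec.
move=> j; rewrite size_iota => hj.
rewrite (_ : (d, beta) - gvec w b k *+ j = (d - w k *+ j, beta - b k *+ j)); last first.
  by apply/eqP; rewrite xpair_eqE /= fstMn sndMn !eqxx.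
apply: hvan => //.
have -> : phi (beta - b k *+ j) = phi beta - phi (b k) *+ j.
  by apply: (addIr (phi (b k *+ j))); rewrite -phiD subrK phiMn subrK.
have : (j : int) <= phi (b k) *+ j.
  by rewrite -mulr_natr natz ler_peMl //; lia.
move: hj; case: ifP; lia.
Qed.

End PointedFamilies.

(** * Vertex sums *)

Section Residues.
Variables (R : realFieldType) (I : finType).
Implicit Types (w : I -> R) (b : I -> int * int) (x y : int * int).

Definition cross x y : int := x.1 * y.2 - x.2 * y.1.

(** The determinant of the columns (w, b). Divided by [cross (b i) (b j)], it is [w k] minus the
    value at [b k] of the linear functional taking [b i] to [w i] and [b j] to [w j]. *)
Definition det3 w b i j k : R :=
  w i * (cross (b j) (b k))%:~R - w j * (cross (b i) (b k))%:~R
    + w k * (cross (b i) (b j))%:~R.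

(* The side of the ray spanned by (0+, 1), an infinitesimal perturbation of the
   vertical half-line. *)
Definition clockwise x := (0 < x.1) || ((x.1 == 0) && (x.2 < 0)).
Definition counterclockwise x := (x.1 < 0) || ((x.1 == 0) && (0 < x.2)).

Definition vertex_cond b i j :=
  [&& clockwise (b i), counterclockwise (b j) & 0 < cross (b i) (b j)].

(** For distinct i, j among at least three indices this is the inverse of [cross (b i) (b j)] times
    the product over k of the inverses of [w k - lambda (b k)], with lambda the functional fixed by
    [b i] and [b j]: an iterated residue at lambda. *)
Definition vertex_term w b i j : R :=
  (cross (b i) (b j))%:~R ^+ (#|I| - 3) /
    \prod_(k | (k != i) && (k != j)) det3 w b i j k.

Definition vertex_sum w b : R :=
  \sum_i \sum_(j | vertex_cond b i j) vertex_term w b i j.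

Definition independent w :=
  forall m : I -> int, \sum_k w k *~ m k = 0 -> forall k, m k = 0.

Lemma upd_same T (f : I -> T) i v : upd f i v i = v.
Proof. by rewrite /upd eqxx. Qed.

Lemma upd_other T (f : I -> T) i v k : k != i -> upd f i v k = f k.
Proof. by rewrite /upd => /negbTE ->. Qed.

Lemma crossC x y : cross x y = - cross y x.
Proof. rewrite /cross; ring. Qed.

Lemma cross_self x : cross x x = 0.
Proof. rewrite /cross; ring. Qed.

Lemma crossDl x x' y : cross (x + x') y = cross x y + cross x' y.
Proof. rewrite /cross /=; ring. Qed.

Lemma crossDr x y y' : cross x (y + y') = cross x y + cross x y'.
Proof. rewrite /cross /=; ring. Qed.

Lemma independent_upd w i j : i != j -> independent w ->
  independent (upd w j (w i + w j)).
Proof.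
move=> hij h m hm.
have hm' k : upd m i (m i + m j) k = 0.
  apply: h; rewrite -[RHS]hm (bigD1 i) // (bigD1 j) 1?eq_sym //=.
  rewrite [RHS](bigD1 i) // (bigD1 j) 1?eq_sym //=.
  rewrite !upd_same !(upd_other _ _ hij) !upd_other 1?eq_sym //.
  rewrite mulrzDr mulrzDl -!addrA; congr (_ + (_ + (_ + _))).
  by apply: eq_bigr => x /andP[h1 h2]; rewrite !upd_other.
have hj : m j = 0 by rewrite -(hm' j) upd_other // eq_sym.
move=> k; have [->|ki] := eqVneq k i.
  by have := hm' i; rewrite upd_same hj addr0.
by rewrite -(hm' k) upd_other.
Qed.

Lemma independent_upd' w i j : i != j -> independent w ->
  independent (upd w i (w i + w j)).
Proof.
by move=> hij; rewrite addrC; apply: independent_upd; rewrite eq_sym.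
Qed.

Lemma det3_neq0 w b i j k : independent w ->
  i != j -> i != k -> j != k -> cross (b i) (b j) != 0 -> det3 w b i j k != 0.
Proof.
move=> h ij ik jk; apply: contra => /eqP h0; apply/eqP.
pose m (t : I) := if t == i then cross (b j) (b k) else
                  if t == j then - cross (b i) (b k) else
                  if t == k then cross (b i) (b j) else 0.
have := h m; rewrite (bigD1 i) // (bigD1 j) 1?eq_sym //= (bigD1 k) /=; last first.
  by rewrite ![k == _]eq_sym ik jk.
rewrite big1 => [|x /andP[/andP[h1 h2] h3]]; last first.
  by rewrite /m (negbTE h1) (negbTE h2) (negbTE h3) mulr0z.
move=> H; have := H _ k; rewrite /m !eqxx ![j == i]eq_sym ![k == _]eq_sym.
rewrite (negbTE ij) (negbTE ik) (negbTE jk); apply.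
by rewrite -[RHS]h0 /det3 !mulrzr addr0 mulrNz addrA.
Qed.

(** Sorts the pairs by how they meet the two indices changed by a split. *)
Lemma big_pair_split (g : I -> I -> R) a c : a != c ->
  \sum_i \sum_j g i j =
  (g a a + g c c) + (g a c + g c a)
  + \sum_(j | (j != a) && (j != c)) (g a j + g c j)
  + \sum_(i | (i != a) && (i != c)) (g i a + g i c)
  + \sum_(i | (i != a) && (i != c)) \sum_(j | (j != a) && (j != c)) g i j.
Proof.
move=> hac.
have e (f : I -> R) : \sum_j f j = f a + f c + \sum_(j | (j != a) && (j != c)) f j.
  by rewrite (bigD1 a) // (bigD1 c) 1?eq_sym //= addrA.
rewrite e (e (g a)) (e (g c)); under [X in _ + X = _]eq_bigr do rewrite e.
rewrite !big_split /=; ring.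
Qed.

Lemma vertex_condE w b i j :
  (if vertex_cond b i j then vertex_term w b i j else 0) = 
  vertex_term w b i j *+ vertex_cond b i j.
Proof. by case: ifP => _; rewrite ?mulr1n ?mulr0n. Qed.

Lemma vertex_sumE w b :
  vertex_sum w b = \sum_i \sum_j vertex_term w b i j *+ vertex_cond b i j.
Proof.
rewrite /vertex_sum; apply: eq_bigr => i _; rewrite big_mkcond.
by apply: eq_bigr => j _; rewrite vertex_condE.
Qed.

Lemma clockwiseD x y : clockwise x -> clockwise y -> clockwise (x + y).
Proof. rewrite /clockwise /=; lia. Qed.

Lemma counterclockwiseD x y :
  counterclockwise x -> counterclockwise y -> counterclockwise (x + y).
Proof. rewrite /counterclockwise /=; lia. Qed.

Lemma clockwiseN x : x != 0 -> clockwise x = ~~ counterclockwise x.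
Proof.
case: x => x1 x2; rewrite xpair_eqE /clockwise /counterclockwise /=; lia.
Qed.

Lemma cross_neq0 x y : cross x y != 0 -> [/\ x != 0, y != 0 & x + y != 0].
Proof.
move=> h; split; apply: contraNneq h.
- by move=> ->; rewrite /cross /= !mul0r subr0.
- by move=> ->; rewrite /cross /= !mulr0 subr0.
- move/eqP; rewrite addrC addr_eq0 => /eqP ->; apply/eqP; rewrite /cross /=; ring.
Qed.

(** The vector [x + y] cuts the cone of x and y in two, and a ray inside the cone lies in exactly
    one half. The perturbation of the vertical ray excludes the case that [x + y] lies on it. *)
Lemma cone_split x y : cross x y != 0 ->
  (clockwise x && counterclockwise y =
   clockwise x && counterclockwise (x + y) (+)
   clockwise (x + y) && counterclockwise y) /\
  ~~ ((clockwise x && counterclockwise (x + y)) &&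
      (clockwise (x + y) && counterclockwise y)).
Proof.
move=> /cross_neq0[hx hy hxy]; rewrite !clockwiseN //.
have := @counterclockwiseD x y; have := @clockwiseD x y; rewrite !clockwiseN //.
by case: counterclockwise; case: counterclockwise; case: counterclockwise => //= *;
  split=> //; try (exfalso; auto).
Qed.

End Residues.

Section ResiduesSplit.
Variables (R : realFieldType) (I : finType).
Implicit Types (w : I -> R) (b : I -> int * int).

Lemma big_prod_split (P : pred I) (g : I -> R) a c : P a -> P c -> a != c ->
  \prod_(k | P k) g k = g a * g c * \prod_(k | [&& P k, k != a & k != c]) g k.
Proof.
move=> Pa Pc hac; rewrite (bigD1 a) //= (bigD1 c) /=; last by rewrite Pc eq_sym.
by rewrite mulrA; congr (_ * _); apply: eq_bigl => k; rewrite andbA.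
Qed.

Let N3 := (#|I| - 3)%N.

(** Pairs inside {a, c} are governed by the subdivision of their cone. For pairs with one index in
    {a, c}, old terms are preserved and the two terms at the new vector cancel. Disjoint pairs give
    a partial fraction identity. *)
Lemma vertex_sum_split w b a c : a != c -> independent w ->
  vertex_sum w b =
  vertex_sum (upd w c (w a + w c)) (upd b c (b a + b c)) +
  vertex_sum (upd w a (w a + w c)) (upd b a (b a + b c)).
Proof.
move=> hac hw; have hca : c != a by rewrite eq_sym.
pose w1 := upd w c (w a + w c); pose b1 := upd b c (b a + b c).
pose w2 := upd w a (w a + w c); pose b2 := upd b a (b a + b c).
rewrite -/w1 -/b1 -/w2 -/b2.
have hw1 : independent w1 by exact: independent_upd.
have hw2 : independent w2 by exact: independent_upd'.
have w1o k : k != c -> w1 k = w k by exact: upd_other.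
have b1o k : k != c -> b1 k = b k by exact: upd_other.
have w2o k : k != a -> w2 k = w k by exact: upd_other.
have b2o k : k != a -> b2 k = b k by exact: upd_other.
have w1c : w1 c = w a + w c by exact: upd_same.
have b1c : b1 c = b a + b c by exact: upd_same.
have w2a : w2 a = w a + w c by exact: upd_same.
have b2a : b2 a = b a + b c by exact: upd_same.
rewrite !vertex_sumE !(big_pair_split _ hac).
have z0 w' b' (i : I) : vertex_term w' b' i i *+ vertex_cond b' i i = 0 :> R.
  by rewrite /vertex_cond cross_self ltxx !andbF mulr0n.
rewrite !z0 !addr0 !add0r.
have -> (x1 x2 x3 x4 y1 y2 y3 y4 : R) :
  (x1 + x2 + x3 + x4) + (y1 + y2 + y3 + y4) =
  (x1 + y1) + (x2 + y2) + (x3 + y3) + (x4 + y4) by ring.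
rewrite -!big_split /=; congr (_ + _ + _ + _).
- have tac : vertex_term w1 b1 a c = vertex_term w b a c.
    rewrite /vertex_term b1c b1o // !(crossDl, crossDr) !cross_self add0r; congr (_ / _).
    apply: eq_bigr => k /andP[ka kc]; rewrite /det3 w1c b1c !(w1o, b1o) // /cross /=; ring.
  have tac2 : vertex_term w2 b2 a c = vertex_term w b a c.
    rewrite /vertex_term b2a b2o // !(crossDl, crossDr) !cross_self addr0; congr (_ / _).
    apply: eq_bigr => k /andP[ka kc]; rewrite /det3 w2a b2a !(w2o, b2o) // /cross /=; ring.
  have tca : vertex_term w1 b1 c a = vertex_term w b c a.
    rewrite /vertex_term b1c b1o // !(crossDl, crossDr) !cross_self add0r; congr (_ / _).
    apply: eq_bigr => k /andP[ka kc]; rewrite /det3 w1c b1c !(w1o, b1o) // /cross /=; ring.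
  have tca2 : vertex_term w2 b2 c a = vertex_term w b c a.
    rewrite /vertex_term b2a b2o // !(crossDl, crossDr) !cross_self addr0; congr (_ / _).
    apply: eq_bigr => k /andP[ka kc]; rewrite /det3 w2a b2a !(w2o, b2o) // /cross /=; ring.
  rewrite tac tac2 tca tca2 addrACA -!mulrnDr.
  rewrite /vertex_cond b1c b2a b1o // b2o // !(crossDl, crossDr) !cross_self !addr0 !add0r.
  have [h0|h0] := eqVneq (cross (b a) (b c)) 0.
    by rewrite (crossC (b c)) h0 oppr0 ltxx !andbF.
  have h0' : cross (b c) (b a) != 0 by rewrite crossC oppr_eq0.
  have [e1 n1] := cone_split h0; have [e2 n2] := cone_split h0'.
  rewrite ![_ && (0 < _)]andbC !andbA ![_ && (0 < _)]andbC -!andbA.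
  congr (_ *+ _ + _ *+ _).
    case: (0 < cross (b a) (b c)); rewrite ?andbF // ?andbT; move: e1 n1.
    by case: (clockwise _ && _); case: (clockwise _ && _); case: (clockwise _ && _).
  case: (0 < cross (b c) (b a)); rewrite ?andbF // ?andbT; move: e2 n2.
  rewrite [b c + b a]addrC.
  by case: (clockwise _ && _); case: (clockwise _ && _); case: (clockwise _ && _).
- apply: eq_bigr => j /andP[ja jc].
  have -> : vertex_cond b1 a j = vertex_cond b a j by rewrite /vertex_cond !b1o.
  have -> : vertex_cond b2 c j = vertex_cond b c j by rewrite /vertex_cond !b2o.
  have -> : vertex_cond b2 a j = vertex_cond b1 c j.
    by rewrite /vertex_cond b1c b2a b1o // b2o.
  have -> : vertex_term w1 b1 a j = vertex_term w b a j.
    rewrite /vertex_term !b1o //; congr (_ / _); apply: eq_bigr => k /andP[ka kj].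
    rewrite /det3 [w1 a]w1o // [w1 j]w1o // [b1 a]b1o // [b1 j]b1o //.
    have [->|kc] := eqVneq k c; last by rewrite w1o // b1o.
    rewrite w1c b1c /cross /=; ring.
  have -> : vertex_term w2 b2 c j = vertex_term w b c j.
    rewrite /vertex_term !b2o //; congr (_ / _); apply: eq_bigr => k /andP[kc kj].
    rewrite /det3 [w2 c]w2o // [w2 j]w2o // [b2 c]b2o // [b2 j]b2o //.
    have [->|ka] := eqVneq k a; last by rewrite w2o // b2o.
    rewrite w2a b2a /cross /=; ring.
  (* The sum vector sits at [c] in the first family and at [a] in the second. The terms differ only
     in the determinant with the remaining one of the two vectors, where exchanging a and c changes
     the sign. *)
  suff -> : vertex_term w2 b2 a j = - vertex_term w1 b1 c j.
    by rewrite mulNrn; ring.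
  rewrite /vertex_term b1c b2a b1o // b2o // -mulrN; congr (_ * _).
  rewrite (bigD1 c) /=; last by rewrite hca eq_sym.
  rewrite [in RHS](bigD1 a) /=; last by rewrite hac eq_sym.
  rewrite -invrN -mulNr; congr (_ * _)^-1.
    rewrite /det3 w1c b1c w2a b2a !(w1o, b1o, w2o, b2o) // /cross /=; ring.
  apply: eq_big => [k|k /andP[/andP[h1 h2] h3]].
    by case: (k == a); case: (k == c); rewrite ?andbF ?andbT.
  by rewrite /det3 w1c b1c w2a b2a !(w1o, b1o, w2o, b2o).
- apply: eq_bigr => i /andP[ia ic].
  have -> : vertex_cond b1 i a = vertex_cond b i a by rewrite /vertex_cond !b1o.
  have -> : vertex_cond b2 i c = vertex_cond b i c by rewrite /vertex_cond !b2o.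
  have -> : vertex_cond b2 i a = vertex_cond b1 i c.
    by rewrite /vertex_cond b1c b2a b1o // b2o.
  have -> : vertex_term w1 b1 i a = vertex_term w b i a.
    rewrite /vertex_term !b1o //; congr (_ / _); apply: eq_bigr => k /andP[ki ka].
    rewrite /det3 [w1 a]w1o // [w1 i]w1o // [b1 a]b1o // [b1 i]b1o //.
    have [->|kc] := eqVneq k c; last by rewrite w1o // b1o.
    rewrite w1c b1c /cross /=; ring.
  have -> : vertex_term w2 b2 i c = vertex_term w b i c.
    rewrite /vertex_term !b2o //; congr (_ / _); apply: eq_bigr => k /andP[ki kc].
    rewrite /det3 [w2 c]w2o // [w2 i]w2o // [b2 c]b2o // [b2 i]b2o //.
    have [->|ka] := eqVneq k a; last by rewrite w2o // b2o.
    rewrite w2a b2a /cross /=; ring.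
  suff -> : vertex_term w2 b2 i a = - vertex_term w1 b1 i c.
    by rewrite mulNrn; ring.
  rewrite /vertex_term b1c b2a b1o // b2o // -mulrN; congr (_ * _).
  rewrite (bigD1 c) /=; last by rewrite hca eq_sym ic.
  rewrite [in RHS](bigD1 a) /=; last by rewrite hac eq_sym ia.
  rewrite -invrN -mulNr; congr (_ * _)^-1.
    rewrite /det3 w1c b1c w2a b2a !(w1o, b1o, w2o, b2o) // /cross /=; ring.
  apply: eq_big => [k|k /andP[/andP[h1 h2] h3]].
    by case: (k == a); case: (k == c); rewrite ?andbF ?andbT.
  by rewrite /det3 w1c b1c w2a b2a !(w1o, b1o, w2o, b2o).
apply: eq_bigr => i /andP[ia ic]; rewrite -big_split /=.
apply: eq_bigr => j /andP[ja jc].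
have -> : vertex_cond b1 i j = vertex_cond b i j by rewrite /vertex_cond !b1o.
have -> : vertex_cond b2 i j = vertex_cond b i j by rewrite /vertex_cond !b2o.
have [/and3P[_ _ hgt]|] := boolP (vertex_cond b i j); last by rewrite !mulr0n addr0.
rewrite !mulr1n /vertex_term !b1o // !b2o // -mulrDr; congr (_ * _).
have hij : i != j by apply: contraTneq hgt => ->; rewrite cross_self.
have hd : cross (b i) (b j) != 0 by rewrite gt_eqF.
have Pa : (a != i) && (a != j) by rewrite ![a == _]eq_sym ia ja.
have Pc : (c != i) && (c != j) by rewrite ![c == _]eq_sym ic jc.
rewrite !(big_prod_split _ Pa Pc hac).
have -> : \prod_(k | [&& (k != i) && (k != j), k != a & k != c]) det3 w1 b1 i j k =
          \prod_(k | [&& (k != i) && (k != j), k != a & k != c]) det3 w b i j k.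
  by apply: eq_bigr => k /and3P[_ ka kc]; rewrite /det3 !(w1o, b1o).
have -> : \prod_(k | [&& (k != i) && (k != j), k != a & k != c]) det3 w2 b2 i j k =
          \prod_(k | [&& (k != i) && (k != j), k != a & k != c]) det3 w b i j k.
  by apply: eq_bigr => k /and3P[_ ka kc]; rewrite /det3 !(w2o, b2o).
(* What remains is 1/(xy) = 1/(x(x+y)) + 1/((x+y)y), with x and y the determinants at [a] and
   [c]. *)
rewrite !invfM -mulrDl; congr (_ * _).
have -> : det3 w1 b1 i j a = det3 w b i j a by rewrite /det3 !(w1o, b1o).
have -> : det3 w2 b2 i j c = det3 w b i j c by rewrite /det3 !(w2o, b2o).
have e1 : det3 w1 b1 i j c = det3 w b i j a + det3 w b i j c.
  by rewrite /det3 w1c b1c !(w1o, b1o) // /cross /=; ring.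
have -> : det3 w2 b2 i j a = det3 w b i j a + det3 w b i j c.
  by rewrite /det3 w2a b2a !(w2o, b2o) // /cross /=; ring.
have hs : det3 w b i j a + det3 w b i j c != 0.
  by rewrite -e1; apply: det3_neq0 => //; rewrite !b1o.
rewrite e1.
have ha : det3 w b i j a != 0 by apply: det3_neq0.
have hc : det3 w b i j c != 0 by apply: det3_neq0.
by field; rewrite ha hc hs.
Qed.

End ResiduesSplit.

(** * Lagrange interpolation identities *)

Section Lagrange.
Variables (R : fieldType) (I : finType).

(** The polynomial of degree below [#|S|] interpolating the constant 1 on [S] is 1; the left-hand
    side is its coefficient in degree [#|S| - 1]. *)
Lemma lagrange_sum (S : {set I}) (x : I -> R) : {in S &, injective x} ->
  (1 < #|S|)%N ->
  \sum_(j in S) (\prod_(k in S | k != j) (x j - x k))^-1 = 0.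
Proof.
move=> xinj hS.
pose c j := (\prod_(k in S | k != j) (x j - x k))^-1.
pose f j := \prod_(k in S | k != j) ('X - (x k)%:P).
have c0 j : j \in S -> \prod_(k in S | k != j) (x j - x k) != 0.
  move=> jS; apply/prodf_neq0 => k /andP[kS kj]; rewrite subr_eq0.
  by apply: contraNneq kj => e; apply/eqP/xinj.
have szf j : j \in S -> size (f j) = #|S|.
  move=> jS; rewrite /f -big_filter size_prod_XsubC -sum1_size big_filter.
  rewrite (cardD1 j) jS -sum1_card; congr _.+1.
  by apply: eq_bigl => k; rewrite !inE andbC.
pose p := \sum_(j in S) c j *: f j.
have szp : (size p <= #|S|)%N.
  apply: leq_trans (size_sum _ _ _) _; apply/bigmax_leqP => j jS.
  by apply: leq_trans (size_scale_leq _ _) _; rewrite szf.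
have px i : i \in S -> p.[x i] = 1.
  move=> iS; rewrite horner_sum (bigD1 i) //= big1 => [|j /andP[jS ji]].
    rewrite addr0 hornerZ horner_prod; under eq_bigr do rewrite hornerXsubC.
    by rewrite mulVf // c0.
  rewrite hornerZ horner_prod (bigD1 i) /=; last by rewrite iS eq_sym.
  by rewrite hornerXsubC subrr mul0r mulr0.
have p1 : p = 1.
  apply/eqP; rewrite -subr_eq0; apply/eqP.
  apply: (@roots_geq_poly_eq0 _ _ [seq x i | i <- enum S]).
  - apply/allP => z /mapP[k]; rewrite fintype.mem_enum => kS ->.
    by rewrite /root !hornerE px // subrr.
  - by rewrite map_inj_in_uniq ?enum_uniq // => i j; rewrite !fintype.mem_enum; exact: xinj.
  - rewrite size_map -cardE; apply: leq_trans (size_polyD _ _) _.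
    by rewrite geq_max szp size_polyN size_poly1 ltnW.
have : p`_(#|S|.-1) = 0 by rewrite p1 coef1; case: #|S| hS => [|[|]].
rewrite coef_sum => {2}<-; apply: eq_bigr => j jS; rewrite coefZ.
have /monicP : f j \is monic by apply: rpred_prod => k _; exact: monicXsubC.
by rewrite lead_coefE szf // => ->; rewrite mulr1.
Qed.

(** The homogeneous form, for points (q_j : y_j) of the projective line. Points at infinity
    contribute only the factor [y k] each and powers of [q j]; on the others [lagrange_sum] applies
    with x_j = - y_j / q_j. *)
Lemma lagrange_det (U : {set I}) (q y : I -> R) :
  (forall j k, j \in U -> k \in U -> j != k -> q j != 0 ->
     q j * y k - q k * y j != 0) ->
  (exists i j, [/\ i \in U, j \in U, i != j, q i != 0 & q j != 0]) ->
  \sum_(j in U | q j != 0) q j ^+ (#|U| - 2) /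
     \prod_(k in U | k != j) (q j * y k - q k * y j) = 0.
Proof.
move=> hd [i0 [j0 [iU jU ij qi qj]]].
pose S := [set j in U | q j != 0]; pose x j := - (y j / q j).
have SU j : j \in S -> j \in U by rewrite inE => /andP[].
have Sq j : j \in S -> q j != 0 by rewrite inE => /andP[].
have i0S : i0 \in S by rewrite inE iU.
have j0S : j0 \in S by rewrite inE jU.
have hS : (1 < #|S|)%N.
  by rewrite (cardD1 i0) i0S (cardD1 j0) inE j0S eq_sym ij.
have hSU : (#|S| <= #|U|)%N.
  by apply: subset_leq_card; apply/fintype.subsetP => j; exact: SU.
have hzero : #|[set k in U | q k == 0]| = (#|U| - #|S|)%N.
  rewrite -(cardsID [set k | q k == 0] U) (_ : U :\: _ = S) ?addnK.
    by apply: eq_card => k; rewrite !inE.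
  by apply/finset.setP => k; rewrite !inE andbC.
pose Y := \prod_(k in U | q k == 0) y k; pose Q := \prod_(k in S) q k.
have xinj : {in S &, injective x}.
  move=> j k jS kS /eqP e; apply/eqP; apply: contraTT e => jk.
  rewrite /x eqr_opp eqr_div ?Sq // -subr_eq0.
  rewrite (_ : _ - _ = - (q j * y k - q k * y j)); last by ring.
  by rewrite oppr_eq0; apply: hd => //; [exact: SU | exact: SU | exact: Sq].
rewrite (eq_bigl (fun j => j \in S)) => [|j]; last by rewrite !inE.
transitivity ( \sum_(j in S) (Y * Q)^-1 * (\prod_(k in S | k != j) (x j - x k))^-1);
  last first.
  by rewrite -mulr_sumr lagrange_sum // mulr0.
apply: eq_bigr => j jS; have qj0 := Sq _ jS.
have -> : \prod_(k in U | k != j) (q j * y k - q k * y j) =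
  q j ^+ (#|U| - #|S|) * Y * (q j ^+ (#|S| - 2) * Q *
     \prod_(k in S | k != j) (x j - x k)).
  rewrite (bigID (fun k => q k == 0)) /=; congr (_ * _).
    rewrite (eq_bigl (fun k => (k \in U) && (q k == 0))) => [|k]; last first.
      by have [->|] := eqVneq k j; rewrite ?andbT // (negbTE qj0) !andbF.
    rewrite (eq_bigr (fun k => q j * y k)) => [|k /andP[_ /eqP ->]]; last first.
      by rewrite mul0r subr0.
    rewrite big_split /= prodr_const; congr (_ ^+ _ * _).
    by rewrite -hzero; apply: eq_card => k; rewrite !inE.
  rewrite (eq_bigl (fun k => (k \in S) && (k != j))) => [|k]; last first.
    by rewrite !inE andbAC.
  rewrite (eq_bigr (fun k => q j * (q k * (x j - x k)))) => [|k /andP[kS _]]; last first.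
    by have qk0 := Sq _ kS; rewrite /x; field; rewrite qk0 qj0.
  rewrite !big_split /= prodr_const mulrA; congr (_ * _).
  rewrite /Q [in RHS](bigD1 j) //= mulrA -exprSr; congr (_ ^+ _ * _).
  transitivity #|S :\ j|; last by move: (cardsD1 j S); rewrite jS; lia.
  by apply: eq_card => k; rewrite [LHS]unfold_in !inE andbC.
have Yn0 : Y != 0.
  apply/prodf_neq0 => k /andP[kU /eqP qk]; have := hd j k (SU _ jS) kU.
  rewrite qk mul0r subr0 mulf_eq0 negb_or => H.
  by have /andP[] := H (contraNneq (fun e => introT eqP (etrans (congr1 q e) qk)) qj0) qj0.
have Qn0 : Q != 0 by apply/prodf_neq0 => k kS; exact: Sq.
have -> : (#|U| - 2 = (#|U| - #|S|) + (#|S| - 2))%N by move: hS hSU; lia.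
have e1 : q j ^+ (#|U| - #|S|) != 0 by rewrite expf_neq0.
have e2 : q j ^+ (#|S| - 2) != 0 by rewrite expf_neq0.
have Xn0 : \prod_(k in S | k != j) (x j - x k) != 0.
  apply/prodf_neq0 => k /andP[kS kj]; rewrite subr_eq0.
  by apply: contraNneq kj => e; apply/eqP/xinj.
rewrite exprD; field.
by rewrite Yn0 Qn0 e1 e2 Xn0.
Qed.

End Lagrange.

(** * Decompositions with known leading coefficient *)

Section Decomposition.
Variables (R : realFieldType) (I : finType).
Implicit Types (b : I -> int * int) (L : seq (leaf I)).

(** Stated through common divisors, it is easily carried through a split; the divisor 0 shows that
    some minor is non-zero. *)
Definition unimodular b :=
  forall g : int, (forall i j, (g %| cross (b i) (b j))%Z) -> (g %| 1)%Z.

(** M is chosen after m, so that the right-hand sides (m, M) follow the ray (0+, 1). The condition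
    is stable under the translations that subdivision causes. *)
Definition eventually2 (P : int -> int -> Prop) :=
  exists m0, forall m, m0 <= m -> exists M0, forall M, M0 <= M -> P m M.

Lemma eventually2I (P Q : int -> int -> Prop) :
  eventually2 P -> eventually2 Q -> eventually2 (fun m M => P m M /\ Q m M).
Proof.
move=> [m1 h1] [m2 h2]; exists (Num.max m1 m2) => m; rewrite ge_max => /andP[le1 le2].
have [M1 {}h1] := h1 _ le1; have [M2 {}h2] := h2 _ le2.
exists (Num.max M1 M2) => M; rewrite ge_max => /andP[le3 le4].
by split; [exact: h1 | exact: h2].
Qed.

Lemma eventually2_shift (P : int -> int -> Prop) (u v : int) :
  eventually2 P -> eventually2 (fun m M => P (m - u) (M - v)).
Proof.
move=> [m0 h]; exists (m0 + u) => m hm.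
have [|M0 {}h] := h (m - u); first by rewrite lerBrDr.
by exists (M0 + v) => M hM; apply: h; rewrite lerBrDr.
Qed.

Lemma eventually2_mono (P Q : int -> int -> Prop) :
  (forall m M, P m M -> Q m M) -> eventually2 P -> eventually2 Q.
Proof.
move=> PQ [m0 h]; exists m0 => m hm; have [M0 {}h] := h _ hm.
by exists M0 => M hM; apply/PQ/h.
Qed.

Definition residue_decomposition b (beta : int * int) := exists L,
  decomposes b beta L /\
  forall w : I -> R, independent w -> leading w L = vertex_sum w b.

Lemma unimodular_upd b i j : i != j -> unimodular b ->
  unimodular (upd b j (b i + b j)).
Proof.
move=> hij h g hg; apply: h => k l.
have bi k' : k' != j -> b k' = upd b j (b i + b j) k' by move=> ?; rewrite upd_other.
have bj : b j = upd b j (b i + b j) j - upd b j (b i + b j) i.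
  by rewrite upd_same upd_other // addrC addKr.
move: (upd b j _) hg bi bj => b1 hg bi bj.
have crossNr x y : cross x (- y) = - cross x y by rewrite /cross /=; ring.
have crossNl x y : cross (- x) y = - cross x y by rewrite /cross /=; ring.
have [->|kj] := eqVneq k j; have [->|lj] := eqVneq l j.
- by rewrite cross_self dvdz0.
- by rewrite (bi l lj) bj crossDl crossNl rpredB //; apply: hg.
- by rewrite (bi k kj) bj crossDr crossNr rpredB //; apply: hg.
- by rewrite (bi k kj) (bi l lj).
Qed.

Lemma unimodular_pair b : unimodular b -> exists i j, cross (b i) (b j) != 0.
Proof.
move=> h; have [/existsP[i /existsP[j ij]]|hn] :=
    boolP [exists i, exists j, cross (b i) (b j) != 0].
  by exists i, j.
have := h 0; rewrite dvd0z => H; have : (1 : int) == 0; last by [].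
apply: H => i j; rewrite dvd0z; apply: contraNT hn => ij.
by apply/existsP; exists i; apply/existsP; exists j.
Qed.

Lemma decomposition_split b i j : i != j ->
  let b1 := upd b j (b i + b j) in let b2 := upd b i (b i + b j) in
  (forall beta, exists L, decomposes b1 beta L) ->
  (forall beta, exists L, decomposes b2 beta L) ->
  (forall beta, exists L, decomposes b beta L).
Proof.
move=> ij b1 b2 h1 h2 beta; have [L1 {}h1] := h1 beta.
have [L2 {}h2] := h2 (beta - b j).
by exists (map (leaf1 i j) L1 ++ map (leaf2 i j) L2); exact: decomposes_split.
Qed.

Lemma residue_decomposition_split b i j beta : i != j ->
  let b1 := upd b j (b i + b j) in let b2 := upd b i (b i + b j) in
  residue_decomposition b1 beta -> residue_decomposition b2 (beta - b j) ->
  residue_decomposition b beta.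
Proof.
move=> ij b1 b2 [L1 [h1 e1]] [L2 [h2 e2]].
exists (map (leaf1 i j) L1 ++ map (leaf2 i j) L2); split.
  exact: decomposes_split.
move=> w hw; rewrite leading_split // (vertex_sum_split b ij hw) e1 ?e2 //.
  exact: independent_upd'.
exact: independent_upd.
Qed.

(** In a pointed family each solution on the non-zero vectors is the origin of a free monoid,
    generated by the indices of the zero vectors. *)
Definition unit_leaves b (sols : seq {ffun I -> nat}) : seq (leaf I) :=
  [seq (z, [seq [ffun x => (x == k) : nat] | k <- enum I & b k == 0]) | z <- sols].

Lemma dot_unit (M : nmodType) (w : I -> M) k :
  dot w [ffun x => (x == k) : nat] = w k.
Proof.
rewrite /dot (bigD1 k) //= ffunE eqxx mulr1n big1 ?addr0 // => x /negbTE hx.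
by rewrite ffunE hx mulr0n.
Qed.

Lemma pointed_decomposes b (phi : int * int -> int) :
  {morph phi : x y / x + y} -> (forall k, b k != 0 -> 0 < phi (b k)) ->
  (2 <= #|[pred k | b k != 0%R]|)%N ->
  forall beta, exists sols : seq {ffun I -> nat},
    [/\ uniq sols,
        forall z, (z \in sols) <->
          (forall k, b k = 0 -> z k = 0%N) /\ dot b z = beta
      & decomposes b beta (unit_leaves b sols)].
Proof.
move=> phiD hphi h2 beta.
pose s := [seq k <- enum I | b k != 0]; pose zs := [seq k <- enum I | b k == 0].
have hs k : k \in s -> 0 < phi (b k) by rewrite mem_filter => /andP[/hphi].
have hzs k : k \in zs -> b k = 0 by rewrite mem_filter => /andP[/eqP].
have us : uniq s by rewrite filter_uniq // enum_uniq.
have [sols [h3 h4 h5]] := pointed_expand phiD us hs hzs beta.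
exists sols; split=> //.
  move=> z; rewrite h4; split=> -[h6 h7]; split=> // k.
    by move=> hk; apply: h6; rewrite mem_filter hk eqxx.
  by rewrite mem_filter fintype.mem_enum !inE andbT negbK => /eqP; exact: h6.
have szs : (size zs + #|[pred k | b k != 0%R]| = #|I|)%N.
  rewrite -(cardC [pred k | b k != 0]) addnC; congr (_ + _)%N.
  have /card_uniqP <- : uniq zs by rewrite filter_uniq // enum_uniq.
  apply: eq_card => k; by rewrite mem_filter fintype.mem_enum !inE andbT negbK.
split=> [la /mapP[z _ ->] /=|w hw d].
  split=> [l /mapP[k _ ->]|]; first by exists k; rewrite ffunE eqxx.
  by rewrite size_map -/zs -szs leq_add2l.
have hp : perm_eq (enum I) (s ++ zs).
  rewrite -(perm_filterC (fun k => b k != 0) (enum I)) -/s perm_cat2l.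
  by rewrite (@eq_filter _ _ (fun k => b k == 0)) // => k /=; rewrite negbK.
rewrite (vfam_perm _ _ hw hp) map_cat h5 // big_map; apply: eq_bigr => z _.
rewrite /leaf_count /= -map_comp; congr vpart.
by apply/eq_in_map => k hk /=; rewrite dot_unit /gvec hzs.
Qed.

End Decomposition.

Section LeafResidues.
Variables (R : realFieldType) (I : finType).
Implicit Types (b : I -> int * int) (z : {ffun I -> nat}) (w : I -> R).

Lemma dot_fst b z : (dot b z).1 = \sum_k (b k).1 * (z k)%:Z.
Proof.
rewrite /dot (big_morph fst (id1 := 0) (op1 := +%R)) //.
by apply: eq_bigr => k _; rewrite fstMn -mulr_natr natz.
Qed.

Lemma dot_snd b z : (dot b z).2 = \sum_k (b k).2 * (z k)%:Z.
Proof.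
rewrite /dot (big_morph snd (id1 := 0) (op1 := +%R)) //.
by apply: eq_bigr => k _; rewrite sndMn -mulr_natr natz.
Qed.

Lemma lexsigned_pointed b : lexsigned b -> exists phi : int * int -> int,
  {morph phi : x y / x + y} /\ forall k, b k != 0 -> 0 < phi (b k).
Proof.
move=> [h1 h2].
have [s1 hs1] : exists s1 : int, forall k, (b k).1 != 0 -> 0 < s1 * (b k).1.
  by case: h1 => h; [exists 1|exists (-1)] => k; have := h k; lia.
have [s2 hs2] : exists s2 : int, forall k, (b k).1 = 0 -> (b k).2 != 0 -> 0 < s2 * (b k).2.
  by case: h2 => h; [exists 1|exists (-1)] => k; have := h k; lia.
(* K exceeds every second coordinate in absolute value, so a non-zero first coordinate decides the
   sign. *)
pose K : int := 1 + \sum_k `|s2 * (b k).2|.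
exists (fun x => K * (s1 * x.1) + s2 * x.2); split=> [x y /=|k]; first by ring.
have [e|n1] := eqVneq (b k).1 0.
  move=> hb; rewrite e !mulr0 add0r; apply: hs2 => //.
  by apply: contra hb => /eqP e2; rewrite [b k]surjective_pairing e e2.
move=> _; have hK : `|s2 * (b k).2| < K.
  by rewrite /K (bigD1 k) //= addrCA ltrDl ltr_pwDl // sumr_ge0.
have hu := hs1 _ n1; have K0 : 0 <= K by apply: le_trans (ltW hK).
have : K <= K * (s1 * (b k).1) by rewrite ler_peMr.
move: hK; clear; set u := K * _; set v := s2 * _; lia.
Qed.

Lemma unimodular_support b : unimodular b -> (2 <= #|[pred k | b k != 0%R]|)%N.
Proof.
move=> /unimodular_pair[i [j ij]]; have [hi hj _] := cross_neq0 ij.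
have nij : j != i by apply: contraNneq ij => ->; rewrite cross_self.
by rewrite (cardD1 i) inE hi (cardD1 j) !inE nij hj.
Qed.

Lemma unit_leaves_size b (sols : seq {ffun I -> nat}) la :
  la \in unit_leaves b sols -> (size la.2 + #|[pred k | b k != 0%R]|)%N = #|I|.
Proof.
move=> /mapP[z _ ->] /=; rewrite size_map -(cardC [pred k | b k != 0]) addnC.
congr (_ + _)%N; have /card_uniqP <- : uniq [seq k <- enum I | b k == 0].
  by rewrite filter_uniq // enum_uniq.
by apply: eq_card => k; rewrite mem_filter fintype.mem_enum !inE andbT negbK.
Qed.

Lemma residue_empty b beta : lexsigned b -> unimodular b ->
  (forall z, dot b z <> beta) -> (forall w, vertex_sum w b = 0) ->
  residue_decomposition R b beta.
Proof.
move=> hb hu hz hv; have [phi [phiD hphi]] := lexsigned_pointed hb.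
have [sols [_ h1 h2]] := pointed_decomposes phiD hphi (unimodular_support hu) beta.
have s0 : sols = [::].
  case: sols h1 {h2} => // z s h1; have [_ e] := (h1 z).1 (mem_head _ _).
  by case: (hz z).
exists (unit_leaves b sols); split=> // w _.
by rewrite s0 hv /leading /= big_nil.
Qed.

Lemma vertex_sum_eq0 w b : (forall i j, ~~ vertex_cond b i j) -> vertex_sum w b = 0.
Proof.
move=> h; rewrite /vertex_sum big1 // => i _; apply: big1 => j.
by rewrite (negbTE (h i j)).
Qed.

Lemma vertex_cond_lex b i j :
  (forall k, 0 <= (b k).1) -> (forall k, (b k).1 = 0 -> 0 <= (b k).2) ->
  vertex_cond b i j = [&& 0 < (b i).1, (b j).1 == 0 & 0 < (b j).2].
Proof.
move=> h1 h2; rewrite /vertex_cond /clockwise /counterclockwise /cross.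
have := h1 i; have := h1 j; have := h2 i; have := h2 j => hj hi gj gi.
apply/and3P/and3P => [[c1 c2 c3]|[c1 /eqP c2 c3]].
  have e1 : 0 < (b i).1 by lia.
  by split=> //; lia.
rewrite c1 c2 eqxx c3; split=> //=; nia.
Qed.

(** With more than two non-zero vectors no leaf has full rank, so the vertex sum has to vanish. If
    two vectors have positive first coordinate, the sum over i vanishes for each vertical j;
    otherwise the only possible i is fixed and the sum over j vanishes. In both cases the
    determinants reduce to 2 x 2 ones, as in [lagrange_det]. *)
Lemma vertex_sum_lagrange w b : independent w ->
  (forall k, 0 <= (b k).1) -> (forall k, (b k).1 = 0 -> 0 <= (b k).2) ->
  (2 < #|[pred k | b k != 0%R]|)%N -> vertex_sum w b = 0.
Proof.
move=> hw h1 h2 hs.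
have N3 : (2 < #|I|)%N by apply: leq_trans hs (max_card _).
have term0 i j : vertex_cond b i j -> i != j.
  by move=> /and3P[_ _ h]; apply: contraTneq h => ->; rewrite cross_self.
have [/existsP[i1 /existsP[i2 /and3P[i12 p1 p2]]]|hP] :=
  boolP [exists i1, exists i2, [&& i1 != i2, 0 < (b i1).1 & 0 < (b i2).1]].
  rewrite vertex_sumE exchange_big /=; apply: big1 => j _.
  have [/andP[/eqP j1 j2]|hj] := boolP (((b j).1 == 0) && (0 < (b j).2)); last first.
    by apply: big1 => i _; rewrite vertex_cond_lex // (negbTE hj) andbF mulr0n.
  pose q i : R := (b i).1%:~R.
  pose y k : R := (b j).2%:~R * w k - w j * (b k).2%:~R.
  pose U : {set I} := [set~ j]%SET.
  have detE i k : det3 w b i j k = q i * y k - q k * y i.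
    rewrite /det3 /cross j1 /q /y; ring.
  have cU : #|U| = #|I|.-1 by rewrite cardsC1.
  have condE i : vertex_cond b i j = (i \in U) && (q i != 0).
    rewrite vertex_cond_lex // j1 eqxx j2 !inE /q intr_eq0 andbT.
    have := h1 i; have [->|] := eqVneq i j; first by rewrite j1.
    by lia.
  have := @lagrange_det _ _ U q y _ _.
  rewrite cU (_ : (#|I|.-1 - 2 = #|I| - 3)%N); last by lia.
  move=> H; rewrite -[RHS](mulr0 ((b j).2%:~R ^+ (#|I| - 3))) -[in RHS]H.
  - rewrite mulr_sumr [RHS]big_mkcond /=; apply: eq_bigr => i _; rewrite condE.
    case: ifP => hi; last by rewrite mulr0n.
    rewrite mulr1n /vertex_term mulrA; congr (_ / _).
      rewrite /cross j1 mulr0 subr0 rmorphM /= exprMn mulrC //.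
    apply: eq_big => [k|k _]; last exact: detE.
    by rewrite !inE andbC.
  - move=> i k iU kU ik qi; rewrite -detE; apply: det3_neq0 => //.
    + by move: iU; rewrite !inE.
    + by move: kU; rewrite !inE eq_sym.
    + have : vertex_cond b i j by rewrite condE iU.
      by move=> /and3P[_ _]; case: ltgtP.
  - have nj k : 0 < (b k).1 -> k != j.
      by move=> h; apply: contraTneq h => ->; rewrite j1.
    by exists i1, i2; rewrite /q !intr_eq0 !inE !nj // !gt_eqF.
have hP' i1 i2 : 0 < (b i1).1 -> 0 < (b i2).1 -> i1 = i2.
  move=> p1 p2; apply/eqP; apply: contraNT hP => i12.
  by apply/existsP; exists i1; apply/existsP; exists i2; rewrite i12 p1.
rewrite /vertex_sum; apply: big1 => i _.
have [pi|pi] := boolP (0 < (b i).1); last first.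
  by apply: big1 => j; rewrite vertex_cond_lex // (negbTE pi).
have b10 k : k != i -> (b k).1 = 0.
  move=> ki; apply/eqP; apply: contraNT ki => k1.
  by apply/eqP; apply: hP' => //; rewrite lt_neqAle eq_sym k1 h1.
pose q k : R := (b k).2%:~R.
pose p : R := (b i).1%:~R.
have p0 : p != 0 by rewrite intr_eq0 gt_eqF.
pose U : {set I} := [set~ i]%SET.
have cU : #|U| = #|I|.-1 by rewrite cardsC1.
have condE j : vertex_cond b i j = (j \in U) && (q j != 0).
  rewrite vertex_cond_lex // pi !inE /q intr_eq0 /=.
  have [->|ji] := eqVneq j i; first by rewrite gt_eqF.
  by have := b10 _ ji; have := h2 j; lia.
have detE j k : j != i -> k != i -> det3 w b i j k = p * (q j * w k - q k * w j).
  move=> ji ki; rewrite /det3 /cross (b10 _ ji) (b10 _ ki) /q /p; ring.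
have := @lagrange_det _ _ U q w _ _.
rewrite cU (_ : (#|I|.-1 - 2 = #|I| - 3)%N); last by lia.
move=> H; rewrite -[RHS](mulr0 (p ^+ (#|I| - 3) / p ^+ (#|I| - 2))) -[in RHS]H.
- rewrite mulr_sumr; apply: eq_big => [j|j]; first by rewrite condE.
  rewrite condE => /andP[]; rewrite !inE => ji qj.
  rewrite /vertex_term (_ : (cross (b i) (b j))%:~R = p * q j); last first.
    by rewrite /cross (b10 _ ji) mulr0 subr0 rmorphM.
  rewrite exprMn mulf_div; congr (_ / _).
  rewrite (eq_bigr (fun k => p * (q j * w k - q k * w j))) => [|k /andP[ki _]];
    last exact: detE.
  rewrite big_split prodr_const /=; congr (_ ^+ _ * _).
    rewrite (_ : #|_| = #|U :\ j|); last first.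
      by apply: eq_card => k; rewrite [LHS]unfold_in !inE andbC.
    by have := cardsD1 j U; rewrite cU !inE ji subn2 => ->.
  by apply: eq_bigl => k; rewrite !inE andbC.
- move=> j k; rewrite !inE => ji ki jk qj.
  suff : det3 w b i j k != 0 by rewrite detE // mulf_eq0 negb_or => /andP[].
  apply: det3_neq0 => //; rewrite 1?eq_sym //.
  have : vertex_cond b i j by rewrite condE !inE ji.
  by move=> /and3P[_ _]; case: ltgtP.
have : (1 < #|[predD1 [pred k | b k != 0%R] & i]|)%N.
  by move: hs; rewrite (cardD1 i); case: (i \in _); rewrite ?add1n ?add0n => // /ltnW.
have hq k : k \in [predD1 [pred k | b k != 0%R] & i] -> (k \in U) && (q k != 0).
  rewrite !inE => /andP[ki hk]; rewrite ki /q intr_eq0; apply: contra hk => /eqP e.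
  by rewrite [b k]surjective_pairing b10 // e.
move=> /card_gt1P[j [k [/hq/andP[jU qj] /hq/andP[kU qk] jk]]].
by exists j, k.
Qed.

End LeafResidues.

Section MainDecomposition.
Variables (R : realFieldType) (I : finType).
Implicit Types (b : I -> int * int) (z : {ffun I -> nat}) (w : I -> R).

(** All minors are 0 or, up to sign, [cross (b i) (b j)], so unimodularity makes this 1. Then [b i]
    and [b j] form a lattice basis, (m, M) has exactly one solution, and both sides are the product
    of the inverse weights of the zero vectors. *)
Lemma residue_two b i j (m M : int) : lexsigned b -> unimodular b ->
  (forall k, 0 <= (b k).1) -> (forall k, (b k).1 = 0 -> 0 <= (b k).2) ->
  0 < (b i).1 -> (b j).1 = 0 -> 0 < (b j).2 ->
  (#|[pred k | b k != 0%R]| <= 2)%N -> 0 <= m -> m * (b i).2 <= M ->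
  residue_decomposition R b (m, M).
Proof.
move=> hb hu h1 h2 pi j1 j2 hs hm hM.
have ji : j != i by apply: contraTneq pi => <-; rewrite j1.
have bi0 : b i != 0 by apply: contraTneq pi => ->.
have bj0 : b j != 0 by apply: contraTneq j2 => ->.
have bk0 k : k != i -> k != j -> b k = 0.
  move=> ki kj; apply/eqP; apply: contraLR hs => hk; rewrite -ltnNge.
  by rewrite (cardD1 i) (cardD1 j) (cardD1 k) !inE bi0 ji bj0 ki kj hk.
have supp2 : #|[pred k | b k != 0%R]| = 2%N.
  by apply/eqP; rewrite eqn_leq hs unimodular_support.
have c1 : cross (b i) (b j) = 1.
  pose c := cross (b i) (b j).
  have hc : 0 < c by rewrite /c /cross j1 mulr0 subr0 mulr_gt0.
  suff : (c %| 1)%Z by rewrite dvdz1 => /eqP; rewrite -/c; lia.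
  apply: hu => k l.
  have cr0 x : cross 0 x = 0 by rewrite /cross /= !mul0r subr0.
  have cr0' x : cross x 0 = 0 by rewrite /cross /= !mulr0 subr0.
  have [->|ki] := eqVneq k i; have [->|li] := eqVneq l i.
  - by rewrite cross_self dvdz0.
  - by have [->|lj] := eqVneq l j; rewrite ?dvdzz // [b l]bk0 // cr0' dvdz0.
  - have [->|kj] := eqVneq k j; first by rewrite crossC rpredN dvdzz.
    by rewrite [b k]bk0 // cr0 dvdz0.
  - have [kj|kj] := eqVneq k j; last by rewrite [b k]bk0 // cr0 dvdz0.
    have [->|lj] := eqVneq l j; first by rewrite kj cross_self dvdz0.
    by rewrite [b l]bk0 // cr0' dvdz0.
have bij : (b i).1 * (b j).2 = 1 by move: c1; rewrite /cross j1 mulr0 subr0.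
have i1 : (b i).1 = 1 by nia.
have j21 : (b j).2 = 1 by nia.
have [phi [phiD hphi]] := lexsigned_pointed hb.
have [sols [us hsol hdec]] :=
  pointed_decomposes phiD hphi (unimodular_support hu) (m, M).
pose z0 := setz (setz [ffun=> 0%N] i (absz m)) j (absz (M - m * (b i).2)%R).
have sumE (T : nmodType) (f : I -> T) : (forall k, k != i -> k != j -> f k = 0) ->
    \sum_k f k = f i + f j.
  move=> h; rewrite (bigD1 i) //= (bigD1 j) //= big1 ?addr0 // => k /andP[]; exact: h.
have dotE z : dot b z = ((z i)%:Z, (b i).2 * (z i)%:Z + (z j)%:Z).
  rewrite [LHS]surjective_pairing dot_fst dot_snd !sumE.
  - by rewrite i1 j1 j21 !mul1r mul0r addr0.
  - by move=> k ki kj; rewrite bk0 // mul0r.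
  - by move=> k ki kj; rewrite bk0 // mul0r.
have z0i : z0 i = absz m by rewrite !ffunE eq_sym (negbTE ji) eqxx.
have z0j : z0 j = absz (M - m * (b i).2)%R by rewrite !ffunE eqxx.
have sols0 : sols = [:: z0].
  apply: perm_small_eq => //; apply: uniq_perm => // z; rewrite inE.
  apply/idP/eqP => [/hsol[hz0]|->].
    rewrite dotE => -[e1 e2]; apply/ffunP => k.
    have [->|kj] := eqVneq k j; first by rewrite z0j -e1 -e2 [_ * (b i).2]mulrC addrAC subrr add0r absz_nat.
    have [->|ki] := eqVneq k i; first by rewrite z0i -e1.
    by rewrite hz0 ?bk0 // !ffunE (negbTE kj) (negbTE ki).
  apply/hsol; split=> [k hk|].
    rewrite !ffunE; case: eqP => [kj|_]; first by rewrite -kj hk eqxx in bj0.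
    by case: eqP => // ki; rewrite -ki hk eqxx in bi0.
  rewrite dotE z0i z0j; congr pair; first by lia.
  by rewrite !gez0_abs ?subr_ge0 // mulrC subrKC.
exists (unit_leaves b sols); split=> // w hw.
have big1leaf := @unit_leaves_size _ b sols.
rewrite /leading big_seq_cond (eq_bigl (mem (unit_leaves b sols))); last first.
  move=> la /=; have [hla|//] := boolP (la \in _).
  by rewrite -(big1leaf _ hla) supp2 eqxx.
rewrite -big_seq sols0 big_seq1 /= big_map big_filter.
have -> : vertex_sum w b = vertex_term w b i j.
  rewrite vertex_sumE (bigD1 i) //= (bigD1 j) //= vertex_cond_lex // pi j1 j2 eqxx mulr1n.
  rewrite !big1 ?addr0 // => k hk.
    apply: big1 => l _; rewrite vertex_cond_lex //.
    have [->|kj] := eqVneq k j; first by rewrite j1 ltxx mulr0n.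
    by rewrite (bk0 k).
  have [->|ki] := eqVneq k i; first by rewrite vertex_cond_lex // gt_eqF ?andbF.
  by rewrite vertex_cond_lex // (bk0 k) // ltxx !andbF.
rewrite /vertex_term c1 expr1n div1r -prodfV big_enum_cond.
apply: eq_big => [k|k].
  have [->|ki] := eqVneq k i; first by rewrite (negbTE bi0).
  have [->|kj] := eqVneq k j; first by rewrite (negbTE bj0).
  by rewrite bk0.
move=> /eqP hk; rewrite dot_unit /det3 c1 hk /cross /=.
by rewrite !mulr0 subr0 add0r mulr1.
Qed.

(** If the cone misses the ray, there is neither a solution nor a vertex pair. Otherwise two
    non-zero vectors fall under [residue_two], while with more of them both sides vanish. *)
Lemma residue_leaf b : lexsigned b -> unimodular b ->
  eventually2 (fun m M => residue_decomposition R b (m, M)).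
Proof.
move=> hb hu; have [hl1 hl2] := hb.
have [hneg|hpos] := pselect (forall k, (b k).1 <= 0).
  exists 1 => m hm; exists 0 => M hM; apply: residue_empty => //.
    move=> z /(congr1 fst); rewrite dot_fst /= => e.
    suff : m <= 0 by lia.
    by rewrite -e; apply: sumr_le0 => k _; rewrite mulr_le0_ge0.
  move=> w; apply: vertex_sum_eq0 => i j; apply/negP => /and3P[].
  rewrite /clockwise /counterclockwise /cross => c1 c2 c3.
  have := hneg i; have := hneg j => hj hi.
  have [e1 e2] : (b i).1 = 0 /\ (b i).2 < 0 by lia.
  by move: c3; rewrite e1 mul0r sub0r; nia.
have h1 : forall k, 0 <= (b k).1 by case: hl1.
have [hneg2|hpos2] := pselect (forall k, (b k).1 = 0 -> (b k).2 <= 0).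
  (* Vectors with first coordinate 0 do not point upwards here, so the second coordinate of any
     solution is at most C times the first. *)
  exists 0 => m hm; pose C := \sum_k `|(b k).2|.
  have hC k : `|(b k).2| <= C.
    by rewrite /C (bigD1 k) //= lerDl sumr_ge0.
  exists (C * m + 1) => M hM; apply: residue_empty => //.
    move=> z e; have := congr1 fst e; have := congr1 snd e.
    rewrite dot_fst dot_snd /= => e2 e1.
    suff : M <= C * m by lia.
    rewrite -e2 -e1 mulr_sumr; apply: ler_sum => k _; rewrite mulrA ler_wpM2r //.
    have := h1 k; have := hneg2 k; have := hC k; have [->|/=] := eqVneq (b k).1 0.
      by move=> _ /(_ erefl); rewrite mulr0.
    by nia.
  move=> w; apply: vertex_sum_eq0 => i j; apply/negP => /and3P[].
  rewrite /clockwise /counterclockwise /cross => c1 c2 c3.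
  by have := h1 j; have := hneg2 j; lia.
have h2 : forall k, (b k).1 = 0 -> 0 <= (b k).2 by case: hl2.
have [i hi] : exists i, 0 < (b i).1.
  by move/existsNP: hpos => [i hi]; exists i; lia.
have [j [j1 j2]] : exists j, (b j).1 = 0 /\ 0 < (b j).2.
  by move/existsNP: hpos2 => [j /not_implyP[e hj]]; exists j; split=> //; lia.
have [hs|hs] := leqP #|[pred k | b k != 0%R]| 2.
  exists 0 => m hm; exists (m * (b i).2) => M hM.
  exact: (@residue_two b i j).
exists 0 => m _; exists 0 => M _.
have [phi [phiD hphi]] := lexsigned_pointed hb.
have [sols [us hsol hdec]] :=
  pointed_decomposes phiD hphi (unimodular_support hu) (m, M).
exists (unit_leaves b sols); split=> // w hw.
rewrite vertex_sum_lagrange // /leading big_seq_cond big1 // => la.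
move=> /andP[/unit_leaves_size <-]; rewrite eqn_add2l => /eqP e.
by rewrite -e ltnn in hs.
Qed.

(** The right-hand side that matters is 0, where a decomposition exists but its leading coefficient
    is not identified; the second half identifies it deep in the cone. *)
Theorem decomposition_exists b : unimodular b ->
  (forall beta, exists L, decomposes b beta L) /\
  eventually2 (fun m M => residue_decomposition R b (m, M)).
Proof.
apply: (lexsigned_ind (P := fun b => unimodular b ->
  (forall beta, exists L, decomposes b beta L) /\
  eventually2 (fun m M => residue_decomposition R b (m, M)))) => {}b.
  move=> i j ij IH1 IH2 hu.
  have [d1 r1] := IH1 (unimodular_upd ij hu).
  have [|d2 r2] := IH2.
    by rewrite addrC; apply: unimodular_upd; rewrite // eq_sym.
  split; first exact: decomposition_split d1 d2.
  have := eventually2I r1 (eventually2_shift (b j).1 (b j).2 r2).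
  apply: eventually2_mono => m M [s1 s2].
  exact: (residue_decomposition_split ij s1 s2).
move=> hb hu; split; last exact: residue_leaf.
move=> beta; have [phi [phiD hphi]] := lexsigned_pointed hb.
have [sols [_ _ hdec]] := pointed_decomposes phiD hphi (unimodular_support hu) beta.
by exists (unit_leaves b sols).
Qed.

End MainDecomposition.

(** * Power series with a pole at 1 *)

Section Convolution.
Variable R : comNzRingType.
Implicit Types (P Q : {poly R}) (h : nat -> R).

Definition conv Q h d : R := \sum_(i < d.+1) Q`_i * h (d - i)%N.

Lemma conv_trunc Q h d D : (d < D)%N ->
  conv Q h d = (Q * \poly_(i < D) h i)`_d.
Proof.
move=> hd; rewrite coefM; apply: eq_bigr => i _.
by rewrite coef_poly (leq_ltn_trans (leq_subr _ _) hd).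
Qed.

Lemma conv_mul P Q h : conv (P * Q) h =1 conv P (conv Q h).
Proof.
move=> d; rewrite (conv_trunc _ _ (ltnSn d)) -mulrA coefM.
apply: eq_bigr => i _; congr (_ * _); rewrite -conv_trunc //.
by rewrite ltnS leq_subr.
Qed.

Lemma conv_coef P Q : conv P (fun d => Q`_d) =1 (fun d => (P * Q)`_d).
Proof. by move=> d; rewrite coefM. Qed.

Lemma eq_conv Q h1 h2 : h1 =1 h2 -> conv Q h1 =1 conv Q h2.
Proof. by move=> e d; apply: eq_bigr => i _; rewrite e. Qed.

Lemma convD P Q h d : conv (P + Q) h d = conv P h d + conv Q h d.
Proof. by rewrite -big_split; apply: eq_bigr => i _; rewrite coefD mulrDl. Qed.

Lemma convDr Q h1 h2 d :
  conv Q (fun k => h1 k + h2 k) d = conv Q h1 d + conv Q h2 d.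
Proof. by rewrite -big_split; apply: eq_bigr => i _; rewrite mulrDr. Qed.

Lemma convN Q h d : conv (- Q) h d = - conv Q h d.
Proof. by rewrite -sumrN; apply: eq_bigr => i _; rewrite coefN mulNr. Qed.

Lemma conv_Xn l h d : conv 'X^l h d = if (l <= d)%N then h (d - l)%N else 0.
Proof.
rewrite /conv; case: leqP => hl.
  rewrite (bigD1 (Ordinal (hl : l < d.+1)%N)) //= coefXn eqxx mul1r big1 ?addr0 //.
  move=> i hi; rewrite coefXn (_ : (i == l :> nat) = false) ?mul0r //.
  by apply: contraNF hi => /eqP e; apply/eqP/val_inj.
apply: big1 => i _; rewrite coefXn (_ : (i == l :> nat) = false) ?mul0r //.
by apply/negbTE; rewrite neq_ltn (leq_trans (ltn_ord i) hl).
Qed.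

Lemma conv_1Xn l h d :
  conv (1 - 'X^l) h d = h d - (if (l <= d)%N then h (d - l)%N else 0).
Proof.
by rewrite convD convN conv_Xn -(expr0 'X) conv_Xn leq0n subn0.
Qed.

End Convolution.

(** Division of power series, with the quotient built as a growing list of coefficients. *)
Lemma conv_ex (R : fieldType) (P Q : {poly R}) : Q`_0 != 0 ->
  exists g : nat -> R, forall d, conv Q g d = P`_d.
Proof.
move=> Q0.
pose next s := (P`_(size s) -
  \sum_(i < size s) Q`_i.+1 * s`_(size s - i.+1)) / Q`_0.
pose gs := fix gs k := if k is k'.+1 then rcons (gs k') (next (gs k')) else [::].
have szg k : size (gs k) = k by elim: k => //= k IH; rewrite size_rcons IH.
have nthg k j : (j < k)%N -> (gs k)`_j = (gs j.+1)`_j.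
  elim: k => // k IH; rewrite ltnS leq_eqVlt => /orP[/eqP -> //|hj] /=.
  by rewrite nth_rcons szg hj IH.
exists (fun k => (gs k.+1)`_k) => d; rewrite /conv big_ord_recl subn0.
have -> : \sum_(i < d) Q`_(lift ord0 i) * (gs (d - lift ord0 i).+1)`_(d - lift ord0 i)
    = \sum_(i < d) Q`_i.+1 * (gs d)`_(d - i.+1).
  apply: eq_bigr => i _; rewrite lift0; congr (_ * _); rewrite [RHS]nthg //.
  by rewrite ltn_subrL (leq_ltn_trans _ (ltn_ord i)).
by rewrite [gs d.+1]/= nth_rcons szg ltnn eqxx /next szg mulrC divfK // subrK.
Qed.

Section PolarSeries.
Variable R : realType.
Implicit Types (P Q : {poly R}) (h : nat -> R) (m : nat).

(* The power series with coefficients h converges on [0, 1[ to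
   P / ((1 - 'X)^m Q), where Q has no zero in ]0, 1]; gamma = P(1) / Q(1) is
   the coefficient of (1 - t)^(-m). *)
Definition polar h m (gamma : R) := exists P Q,
  [/\ forall t : R, 0 < t <= 1 -> 0 < Q.[t],
      forall d, conv ((1 - 'X) ^+ m * Q) h d = P`_d,
      forall t : R, 0 < t < 1 -> series (fun d => h d * t ^+ d) @ \oo -->
        P.[t] / ((1 - t) ^+ m * Q.[t])
    & gamma = P.[1] / Q.[1] ].

Lemma polarD h1 h2 m g1 g2 : polar h1 m g1 -> polar h2 m g2 ->
  polar (fun d => h1 d + h2 d) m (g1 + g2).
Proof.
move=> [P1 [Q1 [p1 f1 s1 ->]]] [P2 [Q2 [p2 f2 s2 ->]]].
exists (P1 * Q2 + P2 * Q1), (Q1 * Q2); split.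
- by move=> t ht; rewrite hornerM mulr_gt0 ?p1 ?p2.
- move=> d; rewrite convDr coefD; congr (_ + _).
    rewrite (_ : (1 - 'X) ^+ m * (Q1 * Q2) = Q2 * ((1 - 'X) ^+ m * Q1)); last by ring.
    by rewrite conv_mul (eq_conv _ f1) conv_coef mulrC.
  rewrite (_ : (1 - 'X) ^+ m * (Q1 * Q2) = Q1 * ((1 - 'X) ^+ m * Q2)); last by ring.
  by rewrite conv_mul (eq_conv _ f2) conv_coef mulrC.
- move=> t ht; have ht' : 0 < t <= 1 by case/andP: ht => -> /ltW ->.
  have e1 := p1 _ ht'; have e2 := p2 _ ht'.
  have t1 : 1 - t != 0 by rewrite subr_eq0; case/andP: ht => _ h; rewrite gt_eqF.
  have -> : series (fun d => (h1 d + h2 d) * t ^+ d) =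
      (fun n => series (fun d => h1 d * t ^+ d) n + series (fun d => h2 d * t ^+ d) n).
    apply/funext => n; rewrite /series /= -big_split /=.
    by apply: eq_bigr => i _; rewrite mulrDl.
  have -> : (P1 * Q2 + P2 * Q1).[t] / ((1 - t) ^+ m * (Q1 * Q2).[t]) =
      P1.[t] / ((1 - t) ^+ m * Q1.[t]) + P2.[t] / ((1 - t) ^+ m * Q2.[t]).
    have tm : (1 - t) ^+ m != 0 by rewrite expf_neq0.
    have f1' : Q1.[t] != 0 by rewrite gt_eqF.
    have f2' : Q2.[t] != 0 by rewrite gt_eqF.
    rewrite hornerD !hornerM; move: tm f1' f2'.
    move: ((1 - t) ^+ m) P1.[t] Q1.[t] P2.[t] Q2.[t] => u a b c d hu hb hd.
    by field; rewrite hu hb hd.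
  exact: cvgD (s1 _ ht) (s2 _ ht).
have h1' : 0 < (1 : R) <= 1 by rewrite ltr01 /=.
have f1' : Q1.[1] != 0 by rewrite gt_eqF // (p1 _ h1').
have f2' : Q2.[1] != 0 by rewrite gt_eqF // (p2 _ h1').
rewrite hornerD !hornerM; move: f1' f2'.
move: P1.[1] Q1.[1] P2.[1] Q2.[1] => a b c d hb hd.
by field; rewrite hb hd.
Qed.

Lemma polar0 m : polar (fun=> 0) m 0.
Proof.
exists 0, 1; split.
- by move=> t _; rewrite hornerE.
- by move=> d; rewrite /conv coef0 big1 // => i _; rewrite mulr0.
- move=> t _; rewrite horner0 mul0r.
  have -> : series (fun d => 0 * t ^+ d) = fun=> 0 :> R.
    by apply/funext => n; rewrite /series /= big1 // => i _; rewrite mul0r.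
  exact: cvg_cst.
by rewrite horner0 mul0r.
Qed.

Lemma eq_polar h1 h2 m g : h1 =1 h2 -> polar h1 m g -> polar h2 m g.
Proof. by move=> /funext ->. Qed.

Lemma polar_sum (T : eqType) (s : seq T) (h : T -> nat -> R) (g : T -> R) m :
  (forall x, x \in s -> polar (h x) m (g x)) ->
  polar (fun d => \sum_(x <- s) h x d) m (\sum_(x <- s) g x).
Proof.
elim: s => [|x s IH] hs.
  rewrite big_nil; apply: eq_polar (polar0 m) => d; by rewrite big_nil.
rewrite big_cons; apply: (@eq_polar (fun d => h x d + \sum_(y <- s) h y d)).
  by move=> d; rewrite big_cons.
apply: polarD; first by apply: hs; exact: mem_head.
by apply: IH => y hy; apply: hs; rewrite inE hy orbT.
Qed.

(** Division of a generating function by 1 - t^l, with c = t^l. Non-negativity makes the partial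
    sums of b monotone and bounded; their limit s' then solves s' = s + c s'. *)
Lemma cvg_geometric_step (a b : nat -> R) (c s : R) (l : nat) :
  0 <= c < 1 -> (0 < l)%N -> (forall d, 0 <= b d) -> (forall d, 0 <= a d) ->
  (forall d, b d = a d + (if (l <= d)%N then c * b (d - l)%N else 0)) ->
  series a @ \oo --> s -> series b @ \oo --> s / (1 - c).
Proof.
move=> /andP[c0 c1] l0 b0 a0 hb hs.
have c1' : 0 < 1 - c by rewrite subr_gt0.
have eS n : series b n = series a n + c * series b (n - l)%N.
  rewrite /series /= (eq_bigr _ (fun i _ => hb i)) big_split /=; congr (_ + _).
  case: (leqP l n) => hn; last first.
    rewrite (_ : (n - l)%N = 0%N); last by apply/eqP; rewrite subn_eq0 ltnW.
    rewrite [in RHS]big_geq // mulr0 big_nat_cond big1 // => i /andP[/andP[_ hi] _].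
    by rewrite leqNgt (ltn_trans hi hn).
  rewrite (big_cat_nat (leq0n l) hn) /= big_nat_cond big1 ?add0r; last first.
    by move=> i /andP[/andP[_ hi] _]; rewrite leqNgt hi.
  rewrite -{1}[l]add0n big_addn mulr_sumr; apply: eq_bigr => i _.
  by rewrite leq_addl addnK.
have nd : nondecreasing_seq (series b).
  by apply/nondecreasing_seqP => n; rewrite /series /= big_nat_recr //= lerDl.
have nda : nondecreasing_seq (series a).
  by apply/nondecreasing_seqP => n; rewrite /series /= big_nat_recr //= lerDl.
have bnd n : series b n <= s / (1 - c).
  rewrite ler_pdivlMr //; apply: le_trans (_ : series a n <= s); last first.
    have <- : lim (series a @ \oo) = s by apply: cvg_lim.
    apply: nondecreasing_cvgn_le => //; apply/cvg_ex; by exists s.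
  rewrite mulrBr mulr1 lerBlDr {1}eS lerD2l mulrC; apply: ler_wpM2r => //.
  exact/nd/leq_subr.
have cb : cvgn (series b).
  apply: nondecreasing_is_cvgn => //.
  by exists (s / (1 - c)) => _ [n _ <-].
pose s' := limn (series b); have hs' : series b @ \oo --> s' by exact: cb.
suff -> : s / (1 - c) = s' by [].
have e2 : series b (n + l)%N @[n --> \oo] --> s + c * s'.
  have -> : (fun n => series b (n + l)%N) =
      (fun n => series a (n + l)%N + c * series b n).
    by apply/funext => n; rewrite eS addnK.
  apply: cvgD; first by rewrite (cvg_shiftn l (series a)).
  by apply: cvgMr.
have e3 : series b (n + l)%N @[n --> \oo] --> s' by rewrite (cvg_shiftn l (series b)).
have e : s' = s + c * s' by apply: (cvg_unique _ e3 e2).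
have -> : s = s' * (1 - c) by rewrite mulrBr mulr1 [s' * c]mulrC {1}e addrK.
by rewrite mulfK // gt_eqF.
Qed.

End PolarSeries.

(** * Poles of free monoids and comparison of leading coefficients *)

Section PolarLeaves.
Variable R : realType.
Implicit Types (P Q : {poly R}) (ls : seq nat).

Definition lvec (l : nat) : int * (int * int) := (l%:Z, 0).

Definition lcount ls e (d : nat) : nat := vpart (map lvec ls) (d%:Z - e%:Z, 0).

Lemma posw_lvec ls : all (fun l => (0 < l)%N) ls -> posw (map lvec ls).
Proof. by rewrite /posw all_map. Qed.

Lemma lcount_cons l ls e d : (0 < l)%N -> all (fun l => (0 < l)%N) ls ->
  lcount (l :: ls) e d =
  (lcount ls e d + (if (l <= d)%N then lcount (l :: ls) e (d - l) else 0))%N.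
Proof.
move=> l0 hls; have hp : posw (map lvec (l :: ls)).
  by apply: posw_lvec; rewrite /= l0.
rewrite {1}/lcount (vpartS _ hp) -/(lcount ls e d); congr addn.
rewrite (_ : _ - lvec l = (d%:Z - e%:Z - l%:Z, 0)) //.
case: leqP => hd; last by rewrite vpart_lt0 //=; lia.
by rewrite /lcount; congr (vpart _ (_, _)); lia.
Qed.

Lemma lcount_nil e d : lcount [::] e d = (d == e).
Proof.
rewrite /lcount /vpart; congr nat_of_bool; apply/eqP/eqP => [/(congr1 fst)/=|->].
  by lia.
by rewrite subrr.
Qed.

Lemma lcount_conv ls e : all (fun l => (0 < l)%N) ls ->
  forall d, conv (\prod_(l <- ls) (1 - 'X^l)) (fun d => (lcount ls e d)%:R : R) d
    = ('X^e)`_d.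
Proof.
elim: ls => [|l ls IH] /= => [_ d|/andP[l0 hls] d].
  rewrite big_nil -(expr0 'X) conv_Xn leq0n subn0 lcount_nil coefXn.
  by case: eqP.
rewrite big_cons mulrC conv_mul -[RHS](IH hls); apply: eq_conv => {}d.
rewrite conv_1Xn lcount_cons // natrD; case: leqP => _; first by rewrite addrK.
by rewrite mulr0n addr0 subr0.
Qed.

Lemma lcount_series ls e : all (fun l => (0 < l)%N) ls ->
  forall t : R, 0 < t < 1 ->
  series (fun d => (lcount ls e d)%:R * t ^+ d) @ \oo -->
    t ^+ e / \prod_(l <- ls) (1 - t ^+ l).
Proof.
elim: ls => [|l ls IH] /= => [_ t ht|/andP[l0 hls] t /andP[t0 t1]].
  rewrite big_nil divr1 -(cvg_shiftn e.+1).
  rewrite (_ : (fun n => _) = fun=> t ^+ e); first exact: cvg_cst.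
  apply/funext => n; rewrite /series /= big_mkord.
  have he : (e < n + e.+1)%N by rewrite addnS ltnS leq_addl.
  rewrite (bigD1 (Ordinal he)) //= lcount_nil eqxx mul1r big1 ?addr0 // => i hi.
  rewrite lcount_nil (_ : (i == e :> nat) = false) ?mul0r //.
  by apply: contraNF hi => /eqP h; apply/eqP/val_inj.
rewrite big_cons invfM mulrCA mulrC.
apply: (@cvg_geometric_step _ (fun d => (lcount ls e d)%:R * t ^+ d) _ (t ^+ l) _ l) => //.
- by rewrite exprn_ge0 ?ltW //= exprn_ilt1 // ?ltW // -lt0n.
- by move=> d; rewrite mulr_ge0 // exprn_ge0 // ltW.
- by move=> d; rewrite mulr_ge0 // exprn_ge0 // ltW.
- move=> d; rewrite lcount_cons // natrD mulrDl; congr (_ + _).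
  case: leqP => hd; last by rewrite mul0r.
  by rewrite mulrCA -exprD subnKC.
by apply: IH => //; rewrite t0.
Qed.

Lemma polar_lcount ls e m : all (fun l => (0 < l)%N) ls -> (size ls <= m)%N ->
  polar (fun d => (lcount ls e d)%:R : R) m
    (if size ls == m then \prod_(l <- ls) (l%:R)^-1 else 0).
Proof.
(* Extracting 1 - X from each factor 1 - X^l leaves [br l], which is positive on ]0, 1] and equals l
   at 1; hence the factor 1/l. *)
move=> hls hm; pose br (l : nat) : {poly R} := \sum_(i < l) 'X^i.
pose Q := \prod_(l <- ls) br l.
have brE l : 1 - 'X^l = (1 - 'X) * br l :> {poly R}.
  have := subrX1 ('X : {poly R}) l => h.
  by rewrite -[LHS]opprB h -mulNr opprB.
have prodE : \prod_(l <- ls) (1 - 'X^l) = (1 - 'X) ^+ size ls * Q.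
  rewrite /Q; elim: ls {hls hm Q} => [|l ls IH]; first by rewrite !big_nil mulr1.
  by rewrite !big_cons IH brE /= exprS; ring.
have br_gt0 l (t : R) : (0 < l)%N -> 0 < t -> 0 < (br l).[t].
  case: l => // l _ t0; rewrite /br horner_sum big_ord_recl hornerXn expr0.
  by rewrite ltr_pwDl // sumr_ge0 // => i _; rewrite hornerXn exprn_ge0 // ltW.
have Q_gt0 (t : R) : 0 < t <= 1 -> 0 < Q.[t].
  move=> /andP[t0 _]; rewrite /Q horner_prod; move/allP: hls => hls.
  by rewrite big_seq; apply: prodr_gt0 => l /hls hl; exact: br_gt0.
exists ((1 - 'X) ^+ (m - size ls) * 'X^e), Q; split=> //.
- move=> d; rewrite -{1}(subnK hm) exprD -mulrA -prodE conv_mul.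
  by rewrite (eq_conv _ (@lcount_conv ls e hls)) conv_coef.
- move=> t ht; have /andP[t0 t1] := ht.
  have t1' : 1 - t != 0 by rewrite subr_eq0 gt_eqF.
  have := @lcount_series ls e hls _ ht.
  have -> : \prod_(l <- ls) (1 - t ^+ l) = (1 - t) ^+ size ls * Q.[t].
    have := congr1 (horner^~ t) prodE; rewrite /= horner_prod.
    rewrite !hornerE => <-; apply: eq_bigr => l _; by rewrite !hornerE.
  have Q0 : Q.[t] != 0 by rewrite gt_eqF // Q_gt0 // t0 ltW.
  rewrite !hornerE -{2}(subnK hm) exprD.
  have := expf_neq0 (size ls) t1'; have := expf_neq0 (m - size ls) t1'.
  move: ((1 - t) ^+ (m - size ls)) ((1 - t) ^+ size ls) (t ^+ e) Q0.
  move: Q.[t] => q a b c q0 a0 b0.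
  rewrite (_ : a * c / (a * b * q) = c / (b * q)) //.
  by field; rewrite a0 b0 q0.
rewrite !hornerE expr1n mulr1 subrr expr0n subn_eq0.
have -> : Q.[1] = \prod_(l <- ls) l%:R.
  rewrite /Q horner_prod; apply: eq_bigr => l _.
  rewrite /br horner_sum (eq_bigr (fun=> 1)) => [|i _]; last by rewrite hornerXn expr1n.
  by rewrite sumr_const card_ord.
case: (ltngtP (size ls) m) hm => // h _; first by rewrite mul0r.
by rewrite mul1r prodfV.
Qed.

(** In (1 - X^2)^2 = (1 - X)^2 (1 + X)^2 the first factor lowers the pole order by two, and the
    second has the value 4 at 1. *)
Lemma polar_pole (h : nat -> nat) (hon : nat -> nat) m gamma : (2 < m)%N ->
  polar (fun d => (h d)%:R : R) m gamma -> gamma != 0 ->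
  (forall d, (hon d)%:R = conv ((1 - 'X^2) ^+ 2) (fun d => (h d)%:R : R) d) ->
  pole_at1 hon (m - 2) (4 * gamma).
Proof.
move=> hm [P [Q [Qpos hP _ eg]]] g0 hh.
have Q1 : 0 < Q.[1] by apply: Qpos; rewrite ltr01 /=.
pose P' := (1 + 'X) ^+ 2 * P; pose Q' := (1 - 'X) ^+ (m - 2) * Q.
pose Pt := P' \Po (1 - 'X); pose Qt := Q \Po (1 - 'X).
have c0 (p : {poly R}) : (p \Po (1 - 'X))`_0 = p.[1].
  by rewrite -horner_coef0 horner_comp !hornerE subr0.
have Qt0 : Qt`_0 != 0 by rewrite c0 gt_eqF.
have [g hg] := conv_ex Pt Qt0.
have XX : (1 - 'X) \Po (1 - 'X) = 'X :> {poly R}.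
  by rewrite comp_polyB comp_polyC comp_polyX opprB addrCA subrr addr0.
have QtE : Q' \Po (1 - 'X) = 'X^(m - 2) * Qt.
  by rewrite /Q' comp_polyM rmorphXn /= XX.
have g0E : g 0%N = 4 * gamma.
  have := hg 0%N; rewrite /conv big_ord_recl big_ord0 addr0 subn0 !c0 eg.
  move=> h0; apply: (mulfI (lt0r_neq0 Q1)); rewrite h0 /P' hornerM horner_exp hornerD hornerX -polyC1 hornerC.
  by move: (lt0r_neq0 Q1); move: Q.[1] P.[1] => q p q0; field.
exists P', Q', g; split.
- split.
    have : 0 < Q'.[2^-1].
      rewrite /Q' !hornerE mulr_gt0 ?exprn_gt0 //; first by lra.
      by apply: Qpos; lra.
    by apply: contraTneq => ->; rewrite horner0 ltxx.
  move=> d; transitivity (conv Q' (conv ((1 - 'X^2) ^+ 2) (fun d => (h d)%:R)) d).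
    by apply: eq_bigr => i _; rewrite hh.
  rewrite -conv_mul (_ : Q' * _ = (1 + 'X) ^+ 2 * ((1 - 'X) ^+ m * Q)); last first.
    rewrite /Q' -{2}(subnK (ltnW hm)) exprD; ring.
  by rewrite conv_mul (eq_conv _ hP) conv_coef.
- move=> k; rewrite -[LHS]/(conv (Q' \Po (1 - 'X)) g k) QtE conv_mul.
  by rewrite (eq_conv _ hg) conv_coef.
- by lia.
- by rewrite g0E mulf_neq0.
exact: g0E.
Qed.

(** The hypothesis gives t^c H(t) <= H'(t) on ]0, 1[. Cleared of denominators, this is an inequality
    between polynomials, which persists at t = 1. *)
Lemma polar_le (h h' : nat -> R) m gamma gamma' c :
  (forall d, 0 <= h' d) -> (forall d, h d <= h' (d + c)%N) ->
  polar h m gamma -> polar h' m gamma' -> gamma <= gamma'.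
Proof.
move=> h'0 hh [P [Q [Qpos _ hs ->]]] [P' [Q' [Q'pos _ hs' ->]]].
have h1 : 0 < (1 : R) <= 1 by rewrite ltr01 /=.
rewrite ler_pdivrMr ?Qpos // mulrAC ler_pdivlMr ?Q'pos //.
pose F := P' * Q - 'X^c * P * Q'.
have Fge0 t : 0 < t < 1 -> 0 <= F.[t].
  move=> ht; have ht' : 0 < t <= 1 by case/andP: ht => -> /ltW ->.
  have /andP[t0 t1] := ht.
  have le_lim : t ^+ c * (P.[t] / ((1 - t) ^+ m * Q.[t])) <=
                P'.[t] / ((1 - t) ^+ m * Q'.[t]).
    have e1 : (fun n => t ^+ c * series (fun d => h d * t ^+ d) n) @ \oo -->
        t ^+ c * (P.[t] / ((1 - t) ^+ m * Q.[t])).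
      by apply: cvgMr; exact: hs.
    have e2 := hs' _ ht; move: e2; rewrite -(cvg_shiftn c) => e2.
    apply: (ler_cvg_to e1 e2); apply: nearW => n.
    rewrite /series /= mulr_sumr (big_cat_nat (leq0n c) (leq_addl n c)) /=.
    rewrite -[leLHS]add0r; apply: lerD.
      by apply: sumr_ge0 => i _; rewrite mulr_ge0 // exprn_ge0 // ltW.
    rewrite -{2}[c]add0n big_addn addnK; apply: ler_sum => i _.
    rewrite mulrCA -exprD [(c + i)%N]addnC ler_wpM2r ?hh //.
    by rewrite exprn_ge0 // ltW.
  have u0 : 0 < (1 - t) ^+ m by rewrite exprn_gt0 // subr_gt0.
  have q0 := Qpos _ ht'; have q0' := Q'pos _ ht'.
  move: le_lim; rewrite -subr_ge0 /F hornerD hornerN !hornerM hornerXn.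
  move: ((1 - t) ^+ m) Q.[t] Q'.[t] P.[t] P'.[t] (t ^+ c) u0 q0 q0'.
  move=> u q q' p p' tc u0 q0 q0' h0.
  have -> : p' * q - tc * p * q' =
      (p' / (u * q') - tc * (p / (u * q))) * (u * q * q').
    by field; rewrite !gt_eqF.
  by rewrite mulr_ge0 // ltW // !mulr_gt0.
have F1 : F.[1] = P'.[1] * Q.[1] - P.[1] * Q'.[1].
  by rewrite /F hornerD hornerN !hornerM hornerXn expr1n mul1r.
suff : 0 <= F.[1] by rewrite F1 subr_ge0.
have cF : horner F t @[t --> 1^'-] --> F.[1].
  exact/cvg_at_left_filter/continuous_horner.
apply: (cvgr_to_ge cF); near=> t; apply: Fge0; apply/andP; split; near: t.
  by apply: nbhs_left_gt; exact: ltr01.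
exact: nbhs_left_lt.
Unshelve. all: by end_near. Qed.

End PolarLeaves.

(** * Families closed under negation *)

Section SymmetricFamilies.
Variables (R : realType) (I : finType).
Implicit Types (b : I -> int * int) (z l : {ffun I -> nat}).

Definition vone : I -> int := fun=> 1.

Lemma posf_one : posf vone. Proof. by []. Qed.

Lemma dot_one (S : nzSemiRingType) l : dot (fun=> 1 : S) l = (\sum_k l k)%:R.
Proof. by rewrite /dot natr_sum. Qed.

Lemma polar_decomposes b beta L : (2 <= #|I|)%N -> decomposes b beta L ->
  polar (fun d => (vfam vone b (d%:Z, beta))%:R : R) (#|I| - 2)
    (leading (fun=> 1) L).
Proof.
move=> hI [hok hdec].
pose s l := (\sum_k l k)%N.
have spos l : (exists k, (0 < l k)%N) -> (0 < s l)%N.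
  by move=> [k hk]; rewrite /s (bigD1 k) //= addn_gt0 hk.
have cE la d : leaf_count vone la (Posz d) = lcount [seq s l | l <- la.2] (s la.1) d.
  rewrite /leaf_count /lcount -map_comp dot_one natz; congr vpart.
  by apply: eq_map => l; rewrite /= dot_one natz.
apply: (@eq_polar _ (fun d => \sum_(la <- L)
    (lcount [seq s l | l <- la.2] (s la.1) d)%:R)).
  move=> d; rewrite hdec // natr_sum; apply: eq_bigr => la _; by rewrite cE.
rewrite /leading big_mkcond /=.
rewrite (eq_bigr (fun la : leaf I => if size [seq s l | l <- la.2] == (#|I| - 2)%N
  then \prod_(n <- [seq s l | l <- la.2]) (n%:R : R)^-1 else 0)); last first.
  move=> la _; rewrite size_map big_map.
  rewrite (_ : (size la.2 == #|I| - 2)%N = (size la.2 + 2 == #|I|)%N); last first.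
    by rewrite -[in RHS](subnK hI) eqn_add2r.
  by case: ifP => // _; apply: eq_bigr => l _; rewrite dot_one.
apply: polar_sum => la hla; apply: polar_lcount.
  by apply/allP => n /mapP[l hl ->]; apply/spos; have [h _] := hok _ hla; exact: h.
by rewrite size_map leq_subRL // addnC; have [] := hok _ hla.
Qed.

Lemma vpart_addr (V : zmodType) us (u p : int * V) : posw us -> u \in us ->
  (vpart us p <= vpart us (p + u)%R)%N.
Proof.
move=> hus hu; have hp := perm_to_rem hu.
rewrite !(vpart_perm hus hp) -{1}[p](addrK u); apply: vpart_subS.
by rewrite -(perm_posw hp).
Qed.

Lemma vfam_addr b z d beta :
  (vfam vone b (d, beta) <= vfam vone b (d + (\sum_k z k)%N%:Z, beta + dot b z)%R)%N.
Proof.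
have h1 k n p : (vfam vone b p <= vfam vone b (p + gvec vone b k *+ n)%R)%N.
  elim: n p => [|n IH] p; first by rewrite mulr0n addr0.
  apply: leq_trans (IH p) _; rewrite mulrSr addrA; apply: vpart_addr.
    exact: posw_gvec.
  by apply: map_f; rewrite fintype.mem_enum.
have h2 (s : seq I) p :
    (vfam vone b p <= vfam vone b (p + \sum_(k <- s) gvec vone b k *+ z k)%R)%N.
  elim: s p => [|k s IH] p; first by rewrite big_nil addr0.
  by rewrite big_cons addrA; apply: leq_trans (h1 k (z k) p) (IH _).
apply: leq_trans (h2 (index_enum I) _) _; rewrite leq_eqVlt; apply/orP; left.
apply/eqP; congr (vfam _ _ _).
have -> : \sum_k gvec vone b k *+ z k = ((\sum_k z k)%N%:Z, dot b z).
  rewrite [LHS]surjective_pairing (big_morph fst (id1 := 0) (op1 := +%R)) //.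
  rewrite (big_morph snd (id1 := 0) (op1 := +%R)) //; congr pair.
    rewrite -[RHS]natz natr_sum; apply: eq_bigr => k _; by rewrite fstMn.
  by apply: eq_bigr => k _; rewrite sndMn.
by [].
Qed.

Variables (b : I -> int * int) (sg : I -> I).
Hypothesis bsym : forall k, b (sg k) = - b k.

Let reach x := exists z, dot b z = x.

Lemma reachD x y : reach x -> reach y -> reach (x + y).
Proof.
move=> [z <-] [z' <-]; exists [ffun k => z k + z' k]%N.
by rewrite /dot -big_split; apply: eq_bigr => k _; rewrite ffunE mulrnDr.
Qed.

Lemma reachMz k (a : int) : reach (b k *~ a).
Proof.
have h k' n : reach (b k' *+ n).
  exists [ffun x => if x == k' then n else 0%N].
  rewrite /dot (bigD1 k') //= ffunE eqxx big1 ?addr0 // => x /negbTE hx.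
  by rewrite ffunE hx mulr0n.
case: a => n; first exact: h.
by rewrite NegzE mulrNz -mulNrz -bsym; exact: h.
Qed.

Lemma pairMz (y : int * int) (a : int) : y *~ a = (y.1 * a, y.2 * a).
Proof.
have h n : y *+ n = (y.1 * n, y.2 * n).
  by rewrite [LHS]surjective_pairing fstMn sndMn -[y.1 *+ n]mulr_natr -[y.2 *+ n]mulr_natr !natz.
case: a => n; first exact: h.
by rewrite NegzE mulrNz -[_ *~ Posz _]/(y *+ n.+1) h !mulrN.
Qed.

(** Cramer's rule in the plane. *)
Lemma cross_span x i j :
  x *~ cross (b i) (b j) = b i *~ cross x (b j) + b j *~ cross (b i) x.
Proof.
rewrite !pairMz /cross; congr pair => /=; ring.
Qed.

Lemma reach_cross x i j : reach (x *~ cross (b i) (b j)).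
Proof. by rewrite cross_span; apply: reachD; exact: reachMz. Qed.

(* Adding a fixed solution z of [\sum_k z_k b_k = beta] embeds the solutions for
   one right-hand side into those for another, up to a shift of the degree. *)
Lemma polar_beta_eq beta g g' : reach beta -> reach (- beta) ->
  polar (fun d => (vfam vone b (d%:Z, 0))%:R : R) (#|I| - 2) g ->
  polar (fun d => (vfam vone b (d%:Z, beta))%:R : R) (#|I| - 2) g' -> g = g'.
Proof.
move=> [z hz] [z' hz'] h h'; apply/le_anti/andP; split.
  apply: (polar_le (c := (\sum_k z k)%N) _ _ h h') => // d; rewrite ler_nat.
  by apply: leq_trans (vfam_addr b z _ _) _; rewrite hz add0r PoszD.
apply: (polar_le (c := (\sum_k z' k)%N) _ _ h' h) => // d; rewrite ler_nat.
by apply: leq_trans (vfam_addr b z' _ _) _; rewrite hz' addrN PoszD.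
Qed.

(** The leaves come from a right-hand side deep in the cone, the series from right-hand side 0;
    [polar_beta_eq] identifies the two leading coefficients. *)
Theorem polar_symmetric : unimodular b -> exists L : seq (leaf I),
  [/\ forall la, la \in L -> leaf_ok la,
      polar (fun d => (vfam vone b (d%:Z, 0))%:R : R) (#|I| - 2)
        (leading (fun=> 1) L)
    & forall w : I -> R, independent w -> leading w L = vertex_sum w b].
Proof.
move=> hu; have hI : (2 <= #|I|)%N.
  by apply: leq_trans (unimodular_support hu) (max_card _).
have [d1 [m0 hm0]] := decomposition_exists R hu.
have [i [j cij]] := unimodular_pair hu.
pose c := cross (b i) (b j).
(* Choosing both coordinates as multiples of the minor c makes the right-hand side and its opposite
   reachable. *)
have big (x : int) : exists y : int, x <= y * c.
  case: (ltgtP c 0) cij => // c0 _; [exists (- `|x|)|exists `|x|]; nia.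
have [m hm] := big m0; have [M0 hM0] := hm0 _ hm; have [M hM] := big M0.
have [L [hL eL]] := hM0 _ hM; exists L; split=> //; first by case: hL.
have [L0 hL0] := d1 0.
have p0 := polar_decomposes hI hL0; have p1 := polar_decomposes hI hL.
have e : (m * c, M * c) = (m, M) *~ c.
  by rewrite pairMz.
suff <- : leading (fun=> 1) L0 = leading (fun=> 1) L :> R by [].
apply: (polar_beta_eq _ _ p0 p1); rewrite e; first exact: reach_cross.
by rewrite -mulNrz; exact: reach_cross.
Qed.

End SymmetricFamilies.

(** * Lower bounds by free monoids *)

Section LowerBound.
Variable V : zmodType.
Implicit Types (u v p : int * V) (us vs T : seq (int * V)).

Lemma fst_sum_gt0 u us : 0 < u.1 -> posw us -> 0 < (u + \sum_(x <- us) x).1.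
Proof.
elim: us u => [|x us IH] u hu; first by rewrite big_nil addr0.
move=> /andP[hx hus]; rewrite big_cons addrA; apply: IH => //.
exact: addr_gt0.
Qed.

Lemma vpart_addmany u us xs p : 0 < u.1 -> posw us -> {subset xs <= us} ->
  (vpart ((u + \sum_(x <- xs) x)%R :: us) p <= vpart (u :: us) p)%N.
Proof.
elim: xs u => [|x xs IH] u hu hus hx; first by rewrite big_nil addr0.
have xus : x \in us by apply: hx; exact: mem_head.
rewrite big_cons addrA; apply: leq_trans (IH _ _ hus _) _.
- by apply: addr_gt0 => //; move/allP: hus; apply.
- by move=> y hy; apply: hx; rewrite inE hy orbT.
by apply: vpart_addhd => //; apply/andP.
Qed.

Definition killable T u := exists c xs,
  {subset xs <= T} /\ (u *+ c.+1 + \sum_(x <- xs) x).2 = 0.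

(** Passing to a multiple of a vector and adding vectors of [T] can only lower the count, by
    [vpart_scalehd] and [vpart_addhd]; so each vector is replaced by one of weight zero while [T] is
    kept. *)
Lemma vpart_kill T us : posw T -> posw us -> {in us, forall u, killable T u} ->
  exists vs, [/\ size vs = size us, posw vs, {in vs, forall v, v.2 = 0}
    & forall p, (vpart (vs ++ T) p <= vpart (us ++ T) p)%N].
Proof.
move=> hT; elim: us => [|u us IH] hus hk; first by exists [::].
have /andP[hu hus'] := hus.
have [|vs [sz pvs zvs le]] := IH hus'.
  by move=> x hx; apply: hk; rewrite inE hx orbT.
have [c [xs [hxs h0]]] := hk u (mem_head _ _).
have hc : 0 < (u *+ c.+1).1 by rewrite fstMn pmulrn_rgt0.
have pxs : posw xs by apply/allP => x /hxs; move/allP: hT; apply.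
exists ((u *+ c.+1 + \sum_(x <- xs) x) :: vs); split.
- by rewrite /= sz.
- by apply/andP; split; first exact: fst_sum_gt0.
- by move=> v; rewrite inE => /orP[/eqP -> //|]; exact: zvs.
have pvT : posw (vs ++ T) by rewrite /posw all_cat -!/(posw _) pvs.
move=> p; rewrite !cat_cons; apply: leq_trans (vpart_addmany _ hc pvT _) _.
  by move=> x /hxs hx; rewrite mem_cat hx orbT.
apply: leq_trans (vpart_scalehd _ _ _) _; first by apply/andP.
exact: leq_vpart_cons.
Qed.

End LowerBound.

Section Positivity.
Variables (R : realType) (I : finType) (b : I -> int * int) (sg : I -> I).
Hypothesis bsym : forall k, b (sg k) = - b k.
Let u k := gvec (@vone I) b k.

(** Cramer's rule turns a multiple of [b k] into a combination of [b i] and [b j]; [sg] supplies the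
    negatives that its signs require. *)
Lemma span_killable i j k T : cross (b i) (b j) != 0 ->
  {subset [:: u i; u j; u (sg i); u (sg j)] <= T} -> killable T (u k).
Proof.
move=> cij hT.
have h l (a : int) : exists xs, {subset xs <= [:: u l; u (sg l)]} /\
    (\sum_(x <- xs) x).2 = b l *~ a.
  exists (nseq (absz a) (if 0 <= a then u l else u (sg l))); split.
    by move=> x; rewrite mem_nseq => /andP[_ /eqP ->]; case: ifP; rewrite !inE eqxx ?orbT.
  rewrite big_nseq -/(_ *+ absz a) iter_addr_0 sndMn; case: (lerP 0 a) => ha.
    by rewrite -[in RHS](gez0_abs ha).
  by rewrite /= bsym -[in RHS](opprK a) -(ltz0_abs ha) mulrNz -mulNrz.
have key : exists c (a a' : int), b k *+ c.+1 + (b i *~ a + b j *~ a') = 0.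
  have := cross_span b (b k) i j.
  move: (cross (b k) _) (cross _ (b k)) cij => al be.
  move: (cross (b i) (b j)) => [[|n]|n] // _ e.
    exists n, (- al), (- be); rewrite !mulrNz -opprD -e; exact: subrr.
  exists n, al, be; rewrite -e NegzE mulrNz; exact: subrr.
have [c [a [a' e]]] := key; have [xs [hx1 hx2]] := h i a.
have [ys [hy1 hy2]] := h j a'; exists c, (xs ++ ys); split.
  move=> x; rewrite mem_cat => /orP[/hx1|/hy1]; rewrite !inE => /orP[] /eqP ->;
    by apply: hT; rewrite !inE eqxx ?orbT.
by rewrite big_cat /= sndMn hx2 hy2.
Qed.

(** Two independent vectors and their opposites yield two generators of weight zero, and killing
    each remaining index with these four yields one more. The result is a free monoid of full rank
    [#|I| - 2], whose leading coefficient is positive. *)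
Theorem polar_symmetric_gt0 g : unimodular b ->
  polar (fun d => (vfam (@vone I) b (d%:Z, 0))%:R : R) (#|I| - 2) g -> 0 < g.
Proof.
move=> hu hg; have [i [j cij]] := unimodular_pair hu.
have [bi0 bj0 _] := cross_neq0 cij.
have self k : b k != 0 -> sg k != k.
  move=> hk; apply: contra hk => /eqP e; move: (bsym k); rewrite e.
  move=> /eqP; rewrite -addr_eq0 [b k]surjective_pairing xpair_eqE /= xpair_eqE => /andP[].
  by move=> /eqP h1 /eqP h2; apply/andP; split; apply/eqP; lia.
have cN x y : cross x (- y) = - cross x y by rewrite /cross /=; ring.
have cN' x y : cross (- x) y = - cross x y by rewrite /cross /=; ring.
have ij : i != j by apply: contraNneq cij => ->; rewrite cross_self.
have isj : i != sg j.
  by apply: contraNneq cij => ->; rewrite bsym cN' cross_self oppr0.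
have jsi : j != sg i.
  by apply: contraNneq cij => ->; rewrite bsym cN cross_self oppr0.
have sij : sg i != sg j.
  by apply: contraNneq cij => e; rewrite -[cross _ _]opprK -cN -cN' -!bsym e cross_self.
pose S := [:: i; j; sg i; sg j].
have uS : uniq S.
  rewrite /= !inE !negb_or ij isj jsi sij ![_ == sg _]eq_sym (negbTE (self i bi0)).
  by rewrite (negbTE (self j bj0)).
pose rest := [seq k <- enum I | k \notin S].
have hp : perm_eq (enum I) (rest ++ S).
  apply: uniq_perm; first exact: enum_uniq.
    rewrite cat_uniq filter_uniq ?enum_uniq // uS andbT; apply/hasPn => k kS.
    by rewrite mem_filter kS.
  move=> k; rewrite fintype.mem_enum mem_cat mem_filter fintype.mem_enum andbT.
  by rewrite orNb.
have pos s : posw [seq u k | k <- s] by exact: posw_gvec.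
have [|vs [szvs pvs zvs le]] := @vpart_kill _ [seq u k | k <- S] _ (pos S) (pos rest).
  by move=> _ /mapP[k _ ->]; apply: (span_killable _ cij).
pose z1 := u (sg i) + u i; pose z2 := u (sg j) + u j.
have perm4 (x1 x2 x3 x4 : int * (int * int)) :
    perm_eq [:: x1; x2; x3; x4] [:: x3; x1; x4; x2] /\
    perm_eq [:: x1; x2; x3; x4] [:: x3; x4; x1; x2] /\
    perm_eq [:: x1; x2; x3; x4] [:: x2; x4; x1; x3].
  by split; last split; apply/permP => a /=; ring.
have leS p : (vpart [:: z2; z1] p <= vpart [seq u k | k <- S] p)%N.
  have pz : posw [:: z2; z1] by [].
  have [e1 _] := perm4 (u i) (u j) (u (sg i)) (u (sg j)).
  have [_ [e2 _]] := perm4 z1 (u i) (u (sg j)) (u j).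
  have [_ [_ e3]] := perm4 z2 (u j) z1 (u i).
  rewrite (vpart_perm (pos S) e1).
  apply: leq_trans (vpart_addhd _ _ (_ : u i \in _)); rewrite ?inE ?eqxx //.
  rewrite -/z1 (vpart_perm _ e2) //.
  apply: leq_trans (vpart_addhd _ _ (_ : u j \in _)); rewrite ?inE ?eqxx //.
  rewrite -/z2 (vpart_perm _ e3) //.
  by apply: leq_trans (vpart_drop _ _); [exact: vpart_drop | by []].
pose zs := vs ++ [:: z2; z1].
have lez p : (vpart zs p <= vfam (@vone I) b p)%N.
  rewrite (vfam_perm _ _ (@posf_one I) hp) map_cat.
  by apply: leq_trans (le p); apply: leq_vpart_catl.
have pzs : posw zs by rewrite /posw all_cat -!/(posw _) pvs.
have zs0 x : x \in zs -> x.2 = 0.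
  rewrite mem_cat => /orP[/zvs//|]; rewrite !inE => /orP[] /eqP ->;
  by rewrite /= bsym addNr.
pose ls := [seq absz x.1 | x <- zs].
have lsE : zs = map lvec ls.
  rewrite -map_comp -[LHS]map_id; apply/eq_in_map => x hx /=.
  rewrite [LHS]surjective_pairing /lvec (zs0 _ hx) gez0_abs //.
  by apply: ltW; move/allP: pzs; apply.
have hls : all (fun l => (0 < l)%N) ls.
  by apply/allP => l /mapP[x hx ->]; rewrite absz_gt0 gt_eqF //; move/allP: pzs; apply.
have szls : size ls = (#|I| - 2)%N.
  by rewrite size_map size_cat szvs size_map cardE (perm_size hp) size_cat -addnBA.
have := polar_lcount R 0 hls (leqnn _); rewrite eqxx szls => hpol.
apply: lt_le_trans (polar_le (c := 0%N) _ _ hpol hg) => //.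
  by rewrite big_seq; apply: prodr_gt0 => l hl; rewrite invr_gt0 ltr0n; move/allP: hls; apply.
move=> d; rewrite addn0 ler_nat /lcount -lsE subr0; exact: lez.
Qed.

End Positivity.

(** * Removable singularities of gamma_sum *)

(** Uniqueness of digits in base D. *)
Lemma sum_expn_inj n D (m m' : 'I_n -> nat) :
  (forall i, m i < D)%N -> (forall i, m' i < D)%N ->
  (\sum_i m i * D ^ i = \sum_i m' i * D ^ i)%N -> m =1 m'.
Proof.
elim: n m m' => [|n IH] m m' hm hm'; first by move=> _ [].
have D0 : (0 < D)%N by apply: leq_ltn_trans (hm ord0).
have e (f : 'I_n.+1 -> nat) : (\sum_(i < n.+1) f i * D ^ i =
    f ord0 + (\sum_(i < n) f (lift ord0 i) * D ^ i) * D)%N.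
  rewrite big_ord_recl muln1 big_distrl /=; congr addn; apply: eq_bigr => i _.
  by rewrite /= /bump leq0n expnS; ring.
rewrite !e => h.
have h0 : m ord0 = m' ord0.
  by have := congr1 (modn^~ D) h; rewrite /= ![(_ + _ * D)%N]addnC !modnMDl !modn_small.
have h1 : (\sum_(i < n) m (lift ord0 i) * D ^ i = \sum_(i < n) m' (lift ord0 i) * D ^ i)%N.
  by move: h; rewrite h0 => /addnI/eqP; rewrite eqn_pmul2r // => /eqP.
move=> i; case: (unliftP ord0 i) => [j ->|-> //].
by apply: (IH (fun j => m (lift ord0 j)) (fun j => m' (lift ord0 j))) h1 _.
Qed.

(** Kronecker's substitution of X^(D^i) for the i-th variable separates the monomials of p and
    leaves a polynomial in one variable that vanishes at all naturals. Testing natural points only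
    allows complex polynomials to be tested at real points. *)
Lemma mpoly_eq0 (F : numFieldType) n (p : mpoly n F) :
  (forall v : 'I_n -> nat, meval (fun i => (v i)%:R) p = 0) -> p = 0.
Proof.
move=> h; pose D := msize p.
pose h' (i : 'I_n) : {poly F} := 'X^(D ^ i).
pose q := mmap (@polyC F) h' p.
pose N (m : multinom n) := (\sum_i m i * D ^ i)%N.
have qE : q = \sum_(m <- msupp p) (mcoeff m p)%:P * 'X^(N m).
  rewrite /q /mmap; apply: eq_bigr => m _; congr (_ * _).
  rewrite /mmap1 /h' /N -prodrXr; apply: eq_bigr => i _.
  by rewrite -exprM mulnC.
have q0 : q = 0.
  have qt (t : nat) : q.[t%:R] = 0.
    rewrite qE horner_sum; have := h (fun i => (t ^ (D ^ i))%N); rewrite mevalE.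
    move=> ht; rewrite -[RHS]ht.
    apply: eq_bigr => m _; rewrite hornerM hornerC hornerXn; congr (_ * _).
    rewrite -prodrXr; apply: eq_bigr => i _.
    by rewrite natrX -exprM mulnC.
  apply: (@roots_geq_poly_eq0 _ _ [seq t%:R | t <- iota 0 (size q)]).
  - by apply/allP => x /mapP[t _ ->]; apply/rootP.
  - rewrite map_inj_uniq ?iota_uniq // => a b /eqP; rewrite eqr_nat; exact: eqP.
  - by rewrite size_map size_iota.
apply/mpolyP => m; rewrite mcoeff0.
have [hm|hm] := boolP (m \in msupp p); last exact: memN_msupp_eq0.
have : q`_(N m) = 0 by rewrite q0 coef0.
rewrite qE coef_sum (bigD1_seq m) ?msupp_uniq //= coefCM coefXn eqxx mulr1.
rewrite big_seq_cond big1 ?addr0 // => m' /andP[hm' mm'].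
rewrite coefCM coefXn; case: eqP => // e; last by rewrite mulr0.
case/eqP: mm'; apply/mnmP.
have hD m1 : m1 \in msupp p -> forall i, (m1 i < D)%N.
  move=> /msize_mdeg_lt h1 i; apply: leq_ltn_trans h1.
  by rewrite mdegE (bigD1 i) //= leq_addr.
by apply: (@sum_expn_inj _ D) => //; exact: hD.
Qed.

(** * Division by polynomials linear in one variable *)

Section MpolyDivision.
Variables (F : numFieldType) (N : nat).
Implicit Types (p q s al be P Q W : mpoly N F) (v : 'I_N -> F) (ka : 'I_N).

Lemma mpoly_eq0_fun p : (forall v, meval v p = 0) -> p = 0.
Proof. by move=> h; apply: mpoly_eq0 => v; exact: h. Qed.

Lemma mpoly_ring_ind (C : mpoly N F -> Prop) :
  (forall c, C (mpolyC N c)) -> (forall i, C (mpolyX F (mnm1 i))) ->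
  (forall p q, C p -> C q -> C (p + q)) -> (forall p q, C p -> C q -> C (p * q)) ->
  forall p, C p.
Proof.
move=> hc hx hD hM p; elim/mpolyind: p => [|c m p hm hc' IH]; first by rewrite -mpolyC0.
apply: hD => //; rewrite -mul_mpolyC; apply: (hM) => //.
have h1 : C 1 by rewrite -mpolyC1.
rewrite mpolyXE_id; apply: (big_ind C h1 hM) => i _.
by elim: (m i) => [|k IHk]; rewrite ?expr0 // exprS; apply: (hM).
Qed.

(** Not involving the variable [ka], expressed through values, as the proofs move points along that
    coordinate. *)
Definition free_of ka p := forall v r, meval (upd v ka r) p = meval v p.

Lemma pseudo_division ka s al be : s = al * mpolyX F (mnm1 ka) + be ->
  free_of ka al -> free_of ka be ->
  forall P, exists e Q R, al ^+ e * P = s * Q + R /\ free_of ka R.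
Proof.
move=> es fal fbe; apply: mpoly_ring_ind.
- move=> c; exists 0%N, 0, (mpolyC N c); split; first by rewrite expr0 mul1r mulr0 add0r.
  by move=> v r; rewrite !mevalC.
- move=> i; have [->|ik] := eqVneq i ka.
    exists 1%N, 1, (- be); split; first by rewrite es expr1; ring.
    by move=> v r; rewrite !mevalN fbe.
  exists 0%N, 0, (mpolyX F (mnm1 i)); split; first by rewrite expr0 mul1r mulr0 add0r.
  by move=> v r; rewrite !mevalXU upd_other.
- move=> p q [e [Q [R [h1 f1]]]] [e' [Q' [R' [h2 f2]]]].
  exists (e + e')%N, (al ^+ e' * Q + al ^+ e * Q'), (al ^+ e' * R + al ^+ e * R'); split.
    rewrite exprD (_ : _ * (p + q) = al ^+ e' * (al ^+ e * p) + al ^+ e * (al ^+ e' * q));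
      last by ring.
    by rewrite h1 h2; ring.
  by move=> v r; rewrite !mevalD !mevalM !rmorphXn /= !fal f1 f2.
move=> p q [e [Q [R [h1 f1]]]] [e' [Q' [R' [h2 f2]]]].
exists (e + e')%N, (Q * (s * Q' + R') + R * Q'), (R * R'); split.
  rewrite exprD (_ : _ * (p * q) = (al ^+ e * p) * (al ^+ e' * q)); last by ring.
  by rewrite h1 h2; ring.
by move=> v r; rewrite !mevalM f1 f2.
Qed.

(* Since s is linear in the variable ka, a polynomial divides out s up to
   powers of the leading coefficient as soon as it vanishes at the zeros of s
   outside proper subvarieties. *)
Lemma linear_divides ka s al be (ws : seq (mpoly N F)) P :
  s = al * mpolyX F (mnm1 ka) + be -> free_of ka al -> free_of ka be ->
  (exists v, meval v al != 0) ->
  (forall W, W \in ws -> exists v, [/\ meval v s = 0, meval v al != 0 & meval v W != 0]) ->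
  (forall v, meval v s = 0 -> meval v al != 0 ->
     (forall W, W \in ws -> meval v W != 0) -> meval v P = 0) ->
  exists e Q, al ^+ e * P = s * Q.
Proof.
move=> es fal fbe [v1 al1] hws hP.
have dv := pseudo_division es fal fbe.
have [e [Q [R [h1 f1]]]] := dv P; exists e, Q; rewrite h1.
suff -> : R = 0 by rewrite addr0.
(* On s = 0 each W agrees with its remainder modulo s up to a power of al. The product Z of the
   remainders does not involve [ka], and it is non-zero because each W is non-zero somewhere on s =
   0 with al non-zero. *)
have [Z [Z0 fZ hZ]] : exists Z, [/\ Z != 0, free_of ka Z & forall v,
    meval v s = 0 -> meval v Z != 0 -> forall W, W \in ws -> meval v W != 0].
  elim: ws hws {hP} => [|W ws IH] hws.
    by exists 1; split; [exact: oner_neq0 | by move=> v r; rewrite !meval1 | ].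
  have [|Z [Z0 fZ hZ]] := IH; first by move=> W' hW'; apply: hws; rewrite inE hW' orbT.
  have [f [Q' [RW [h2 f2]]]] := dv W.
  have ev v : meval v s = 0 -> meval v RW = meval v al ^+ f * meval v W.
    by move=> sv; rewrite -rmorphXn /= -mevalM h2 mevalD mevalM sv mul0r add0r.
  exists (RW * Z); split.
  - rewrite mulf_neq0 //; have [v [sv av Wv]] := hws W (mem_head _ _).
    have : meval v RW != 0 by rewrite ev // mulf_neq0 // expf_neq0.
    by apply: contraNneq => ->; rewrite meval0.
  - by move=> v r; rewrite !mevalM f2 fZ.
  move=> v sv; rewrite mevalM mulf_eq0 negb_or => /andP[RWv Zv] W'.
  rewrite inE => /orP[/eqP ->|]; last exact: hZ.
  by move: RWv; rewrite ev // mulf_eq0 negb_or => /andP[].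
have al0 : al != 0 by apply: contraNneq al1 => ->; rewrite meval0.
(* A point with al non-zero can be moved along [ka] onto s = 0 without changing al, R or Z. *)
have : al * R * Z = 0.
  apply: mpoly_eq0_fun => v; rewrite !mevalM.
  have [->|av] := eqVneq (meval v al) 0; first by rewrite !mul0r.
  pose r := - (meval v be / meval v al); pose v' := upd v ka r.
  have sv' : meval v' s = 0.
    by rewrite es mevalD mevalM mevalXU fal fbe /v' upd_same /r; field.
  have [Zv|Zv] := eqVneq (meval v' Z) 0; first by rewrite -(fZ v r) Zv mulr0.
  have Pv : meval v' P = 0 by apply: hP => //; [rewrite fal | exact: hZ].
  suff -> : meval v R = 0 by rewrite mulr0 mul0r.
  have := congr1 (meval v') h1; rewrite !(mevalD, mevalM) Pv sv' mulr0 mul0r add0r.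
  by rewrite f1 => <-.
move/eqP; rewrite !mulf_eq0 (negbTE al0) (negbTE Z0) orbF /= => /eqP; by [].
Qed.

(** The divisors are removed one at a time: after division by [s t] the quotient still vanishes on
    the others, since [s t] is non-zero at the points where vanishing is tested. Only the leading
    coefficients [al t] enter the extra denominator D. *)
Lemma divide_all (T : eqType) (bad all : seq T) (s al be : T -> mpoly N F)
    (ka : T -> 'I_N) P :
  uniq bad -> {subset bad <= all} ->
  (forall t, t \in bad -> [/\ s t = al t * mpolyX F (mnm1 (ka t)) + be t,
     free_of (ka t) (al t) & free_of (ka t) (be t)]) ->
  (forall t, t \in bad -> exists v, meval v (al t) != 0) ->
  (forall t t', t \in bad -> t' \in all -> t' != t ->
     exists v, [/\ meval v (s t) = 0, meval v (al t) != 0 & meval v (s t') != 0]) ->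
  (forall t v, t \in bad -> meval v (s t) = 0 -> meval v (al t) != 0 ->
     (forall t', t' \in all -> t' != t -> meval v (s t') != 0) -> meval v P = 0) ->
  exists D Q, D * P = (\prod_(t <- bad) s t) * Q /\
    forall v, (forall t, t \in bad -> meval v (al t) != 0) -> meval v D != 0.
Proof.
move=> ub sub hs hal hsep.
suff H ts : uniq ts -> {subset ts <= bad} -> forall P,
  (forall t v, t \in ts -> meval v (s t) = 0 -> meval v (al t) != 0 ->
     (forall t', t' \in all -> t' != t -> meval v (s t') != 0) -> meval v P = 0) ->
  exists D Q, D * P = (\prod_(t <- ts) s t) * Q /\
    forall v, (forall t, t \in ts -> meval v (al t) != 0) -> meval v D != 0.
  by move=> hP; apply: H.
elim: ts => [|t ts IH] uts subts {}P hP.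
  exists 1, P; rewrite big_nil !mul1r; split=> // v _.
  by rewrite meval1 oner_neq0.
have /andP[tts uts'] := uts.
have tb : t \in bad by apply: subts; exact: mem_head.
have [es fal fbe] := hs _ tb.
have [||e [Q hQ]] := @linear_divides _ _ _ _ [seq s t' | t' <- all & t' != t] P es fal fbe (hal _ tb).
- move=> W /mapP[t']; rewrite mem_filter => /andP[tt' ht'] ->; exact: hsep.
- move=> v sv av hW; apply: (hP t) => //; first exact: mem_head.
  move=> t' ht' tt'; apply: hW; apply/mapP; exists t' => //.
  by rewrite mem_filter tt'.
have [||D [Q' [hQ' hD]]] := IH uts' _ Q.
- by move=> x hx; apply: subts; rewrite inE hx orbT.
- move=> t' v ht' sv av hall; have tt' : t != t' by apply: contraNneq tts => ->.
  have : meval v (al t ^+ e * P) = 0.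
    rewrite mevalM (hP t' v) ?mulr0 //; by rewrite inE ht' orbT.
  rewrite hQ mevalM => /eqP; rewrite mulf_eq0 => /orP[|/eqP //].
  by rewrite (negbTE (hall _ (sub _ tb) tt')).
exists (D * al t ^+ e), Q'; split.
  by rewrite -mulrA hQ big_cons mulrCA hQ' mulrA.
move=> v hv; rewrite mevalM mulf_neq0 //.
  by apply: hD => t' ht'; apply: hv; rewrite inE ht' orbT.
by rewrite rmorphXn expf_neq0 // hv // mem_head.
Qed.

End MpolyDivision.

(** * The polar divisors of the summands *)

Section Triples.
Variables (n : nat) (T : comNzRingType).
Implicit Types (X : 'M[T]_(2, n)) (i j k : 'I_n).

Definition triple X i j k : T := minor2 X i j + minor2 X i k + minor2 X j k.

Lemma triple_rev X i j k : triple X k j i = - triple X i j k.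
Proof. rewrite /triple /minor2; ring. Qed.

Lemma minor2C X i j : minor2 X j i = - minor2 X i j.
Proof. rewrite /minor2; ring. Qed.

Definition star X i j : T := \prod_(k < n | (k != i) && (k != j)) triple X i j k.

(** The sign between [star] and the product of [tval]: the ends of a triple are ordered, and
    reversing them negates it. *)
Definition star_sign i j : T :=
  \prod_(k < n | (k != i) && (k != j)) (if (i < k)%N then 1 else -1).

Lemma star_sign_sqr i j : star_sign i j * star_sign i j = 1.
Proof.
rewrite /star_sign -big_split /=; apply: big1 => k _.
by case: ifP; rewrite ?mulr1 // mulrNN mulr1.
Qed.

(* A triple (c, a, b) with a < b stands for the polar divisor
   c_ac + c_ab + c_cb = 0, centred at c with unordered ends {a, b}. *)
Definition is_triple (t : 'I_n * 'I_n * 'I_n) : bool :=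
  [&& (t.1.2 < t.2)%N, t.1.1 != t.1.2 & t.1.1 != t.2].

Definition on_edge i j (t : 'I_n * 'I_n * 'I_n) : bool :=
  (t.1.1 == j) && ((t.1.2 == i) || (t.2 == i)).

Definition tval X (t : 'I_n * 'I_n * 'I_n) : T := triple X t.1.2 t.1.1 t.2.

Lemma star_reindex X i j : i != j ->
  \prod_(t | is_triple t && on_edge i j t) tval X t = star_sign i j * star X i j.
Proof.
move=> ij; rewrite /star_sign /star -big_split /=.
pose h k := if (i < k)%N then (j, i, k) else (j, k, i).
pose h' (t : 'I_n * 'I_n * 'I_n) := if t.1.2 == i then t.2 else t.1.2.
rewrite (reindex_onto h h') /=; last first.
  move=> [[c a] b]; rewrite /is_triple /on_edge /h /h' /= => /andP[/and3P[ab _ _]].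
  move=> /andP[/eqP -> hab]; have [e|ai] := eqVneq a i; first by rewrite -e ab.
  move: hab; rewrite (negbTE ai) /= => /eqP e.
  by rewrite -e ltnNge (ltnW ab) /= e.
apply: eq_big => [k|k /andP[ki kj]].
  rewrite /is_triple /on_edge /h /h'; case: (ltnP i k) => ik /=.
    have ki : k != i by apply: contraTneq ik => ->; rewrite ltnn.
    by rewrite ik !eqxx ki /= ?eqxx ?andbT [j == i]eq_sym ij /= eq_sym.
  have [->|ki] := eqVneq k i; first by rewrite ltnn.
  rewrite (_ : (k < i)%N) ?eqxx ?andbT ?orbT /=; last by rewrite ltn_neqAle ik andbT.
  by rewrite [j == i]eq_sym ij !andbT eq_sym.
rewrite /h; case: (ltnP i k) => ik; rewrite /tval /=; first by rewrite mul1r.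
by rewrite triple_rev mulN1r.
Qed.

Variable act : pred ('I_n * 'I_n * 'I_n).
Hypothesis act_triple : forall t, act t -> is_triple t.

Definition off_edges i j t := ~~ on_edge i j t && ~~ on_edge j i t.

(** The numerator of the summand (i, j) over the common denominator [total]. The sign arises when
    the denominator is written as [star X i j * star X j i] and the triples are then ordered. *)
Definition edge_num X i j : T :=
  (-1) ^+ n * star_sign i j * star_sign j i * minor2 X i j ^+ (2 * n - 5) *
  \prod_(t | act t && off_edges i j t) tval X t.

Definition total X : T := \prod_(t | act t) tval X t.

Lemma edge_num_star X i j : i != j ->
  (forall t, is_triple t -> on_edge i j t || on_edge j i t -> act t) ->
  edge_num X i j * star X i j * star X j i =
  (-1) ^+ n * minor2 X i j ^+ (2 * n - 5) * total X.
Proof.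
move=> ij hact; rewrite /total (bigID (on_edge i j)) /=.
rewrite (bigID (on_edge j i) (fun t => act t && ~~ on_edge i j t)) /=.
rewrite (eq_bigl (fun t => is_triple t && on_edge i j t)); last first.
  move=> t; have [h|] := boolP (on_edge i j t); last by rewrite !andbF.
  rewrite !andbT; apply/idP/idP => [/act_triple //|ht]; apply: hact => //.
  by rewrite h.
rewrite (star_reindex _ ij).
rewrite (eq_bigl (fun t => is_triple t && on_edge j i t)); last first.
  move=> t; have [h|] := boolP (on_edge j i t); last by rewrite !andbF.
  rewrite !andbT (_ : ~~ on_edge i j t) ?andbT.
    apply/idP/idP => [/act_triple //|ht]; apply: hact => //.
    by rewrite h orbT.
  move: h; rewrite /on_edge => /andP[/eqP -> _].
  by rewrite (negbTE ij).
rewrite (star_reindex _ (_ : j != i)) 1?eq_sym //.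
rewrite (eq_bigl (fun t => act t && off_edges i j t)); last first.
  by move=> t; rewrite /off_edges andbA.
rewrite /edge_num.
move: (\prod_(t | _) _) (star X i j) (star X j i) (minor2 X i j ^+ _) => P S S' m.
have := star_sign_sqr i j; have := star_sign_sqr j i.
move: (star_sign i j) (star_sign j i) ((-1) ^+ n) => e e' c h' h.
rewrite (_ : c * m * (e * S * (e' * S' * P)) = c * e * e' * m * P * S * S') //.
ring.
Qed.

Lemma star_split X i j k : k != i -> k != j ->
  star X i j = triple X i j k *
    \prod_(l < n | [&& l != i, l != j & l != k]) triple X i j l.
Proof.
move=> ki kj; rewrite /star (bigD1 k) /=; last by rewrite ki kj.
by congr (_ * _); apply: eq_bigl => l; rewrite andbA.
Qed.

End Triples.

Lemma rmorph_minor2 (T S : comNzRingType) (f : {rmorphism T -> S}) n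
    (X : 'M[T]_(2, n)) i j : minor2 (map_mx f X) i j = f (minor2 X i j).
Proof. by rewrite /minor2 !mxE rmorphB !rmorphM. Qed.

Lemma rmorph_triple (T S : comNzRingType) (f : {rmorphism T -> S}) n
    (X : 'M[T]_(2, n)) i j k : triple (map_mx f X) i j k = f (triple X i j k).
Proof. by rewrite /triple !rmorph_minor2 !rmorphD. Qed.

(** * Cancellation of residues along the polar divisors *)

Section GammaRational.
Variables (R : realType) (n : nat) (A : 'M[int]_(2, n)).
Hypothesis hn : (2 < n)%N.
Hypothesis hstandard : standard_form A.
Local Notation K := (2 * n)%N.
Local Notation triples := ('I_n * 'I_n * 'I_n)%type.
Implicit Types (X Y : 'M[R]_(2, n)) (t : 'I_n * 'I_n * 'I_n).

Definition ev X : mpoly K R -> R := meval (mxvec X 0).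
HB.instance Definition _ X := GRing.RMorphism.copy (ev X) (meval (mxvec X 0)).

Definition coordp : 'M[mpoly K R]_(2, n) :=
  \matrix_(i, j) mpolyX R (mnm1 (mxvec_index i j)).

Lemma ev_coordp X : map_mx (ev X) coordp = X.
Proof. by apply/matrixP => i j; rewrite !mxE /ev mevalXU mxvecE. Qed.

Lemma ev_minor2 X i j : ev X (minor2 coordp i j) = minor2 X i j.
Proof. by rewrite -rmorph_minor2 ev_coordp. Qed.

Lemma ev_tval X t : ev X (tval coordp t) = tval X t.
Proof. by rewrite /tval -rmorph_triple ev_coordp. Qed.

Lemma ev_star X i j : ev X (star coordp i j) = star X i j.
Proof.
rewrite /star rmorph_prod; apply: eq_bigr => k _.
by rewrite -rmorph_triple ev_coordp.
Qed.

Definition matv (v : 'I_K -> R) : 'M[R]_(2, n) := vec_mx (\row_i v i).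

Lemma meval_matv v p : meval v p = ev (matv v) p.
Proof. by apply: meval_eq => i; rewrite vec_mxK mxE. Qed.

(** The divisors that do occur: the centre forms with some end a pair of non-zero minor, hence a
    pair of the index set in one of its orders. *)
Definition active t := is_triple t &&
  ((minor2 A t.1.2 t.1.1 != 0) || (minor2 A t.2 t.1.1 != 0)).

(** Both pairs formed by the centre and an end are summed over in the same orientation, so that
    their residues can cancel. The other active divisors avoid A, by [tval_standard]. *)
Definition removable t := is_triple t &&
  ((0 < minor2 A t.1.2 t.1.1) && (0 < minor2 A t.2 t.1.1) ||
   (minor2 A t.1.2 t.1.1 < 0) && (minor2 A t.2 t.1.1 < 0)).

Lemma removable_active t : removable t -> active t.
Proof.
move=> /andP[h1 h2]; rewrite /active h1 /=.
by case/orP: h2 => /andP[h _]; rewrite ?(gt_eqF h) ?(lt_eqF h).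
Qed.

Lemma active_triple t : active t -> is_triple t.
Proof. by case/andP. Qed.

Definition nondegenerate X := forall t, active t -> tval X t != 0.

Lemma no_zero_triple_nondegenerate X : no_zero_triple X -> nondegenerate X.
Proof.
move=> h [[c a] b] /active_triple/and3P[/= ab ca cb]; apply: h => //=.
- by rewrite eq_sym.
- by apply: contraTneq ab => ->; rewrite ltnn.
Qed.

Let edge (p : 'I_n * 'I_n) := (p.1 != p.2) && (0 < minor2 A p.1 p.2).

Lemma edge_active i j t : edge (i, j) || edge (j, i) ->
  is_triple t -> on_edge i j t || on_edge j i t -> active t.
Proof.
move=> he ht ho; rewrite /active ht /=.
have h1 : minor2 A i j != 0.
  case/orP: he => /andP[_ /= h]; first by rewrite gt_eqF.
  by rewrite minor2C oppr_eq0 gt_eqF.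
have h2 : minor2 A j i != 0 by rewrite minor2C oppr_eq0.
by case/orP: ho => /andP[/eqP -> /orP[] /eqP ->]; rewrite ?h1 ?h2 ?orbT.
Qed.

Definition gamma_num : mpoly K R :=
  \sum_(p : 'I_n * 'I_n | edge p) edge_num active coordp p.1 p.2.

Lemma card_off_pair (i j : 'I_n) : i != j ->
  (#|[pred k : 'I_n | (k != i) && (k != j)]| + 2)%N = n.
Proof.
move=> ij; have := cardsC ([set i; j]%SET); rewrite cards2 ij card_ord => e.
rewrite -[RHS]e addnC; congr (_ + _)%N; apply: eq_card => k.
by rewrite !inE negb_or.
Qed.

Lemma gamma_denomE X i j : i != j ->
  \prod_(k < n | (k != i) && (k != j))
    ((minor2 X i j - minor2 X i k - minor2 X j k) *
     (minor2 X i j + minor2 X i k + minor2 X j k)) =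
  (-1) ^+ n * (star X i j * star X j i).
Proof.
move=> ij; rewrite big_split /= mulrCA mulrC; congr (_ * _).
have sgE m : (m + 2)%N = n -> (-1) ^+ n = (-1) ^+ m :> R.
  by move=> <-; rewrite exprD sqrrN expr1n mulr1.
rewrite (sgE _ (card_off_pair ij)) /star.
rewrite (eq_bigr (fun k => - triple X j i k)) => [|k _]; last first.
  by rewrite /triple /minor2; ring.
rewrite prodrN; congr (_ * _); apply: eq_bigl => k; exact: andbC.
Qed.

Lemma star_neq0 X i j : edge (i, j) || edge (j, i) -> nondegenerate X ->
  star X i j != 0.
Proof.
move=> he hX; have ij : i != j.
  by case/orP: he => /andP[/= + _]; rewrite // eq_sym.
have := star_reindex X ij => h.
have : star_sign R i j * star X i j != 0.
  rewrite -h; apply/prodf_neq0 => t /andP[h1 h2]; apply: hX.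
  by apply: (edge_active he h1); rewrite h2.
by rewrite mulf_eq0 negb_or => /andP[].
Qed.

Lemma ev_edge_num X i j : ev X (edge_num active coordp i j) = edge_num active X i j.
Proof.
have hs (k l : 'I_n) : ev X (star_sign _ k l) = star_sign R k l.
  rewrite /star_sign rmorph_prod; apply: eq_bigr => x _.
  by case: ifP => _; rewrite ?rmorphN ?rmorph1.
rewrite /edge_num !rmorphM !rmorphXn rmorphN1 /= !hs ev_minor2 rmorph_prod /=.
by congr (_ * _); apply: eq_bigr => t _; exact: ev_tval.
Qed.

Lemma gamma_sumE X : nondegenerate X ->
  gamma_sum A X = ev X gamma_num / total active X.
Proof.
move=> hX; rewrite /gamma_num rmorph_sum mulr_suml /=.
apply: eq_bigr => -[i j] hp /=; have /andP[/= ij dij] := hp.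
rewrite gamma_denomE // ev_edge_num.
have W0 : total active X != 0 by apply/prodf_neq0 => t; exact: hX.
have e : edge (i, j) || edge (j, i) by apply/orP; left.
have S0 : star X i j != 0 by exact: star_neq0.
have S1 : star X j i != 0 by apply: star_neq0; rewrite // orbC.
have := edge_num_star active_triple X ij (fun t => @edge_active i j t e).
have : (-1) ^+ n * (-1) ^+ n = 1 :> R by rewrite -expr2 sqrr_sign.
have := signr_eq0 R n.
move: (edge_num _ _ _ _) (total _ _) (star X i j) (star X j i) (minor2 X i j ^+ _) W0 S0 S1.
move: ((-1) ^+ n : R) => sg nu W S S' m W0 S0 S1 /negbT s0 ss h.
rewrite (_ : nu = sg * m * W / (S * S')); last first.
  by rewrite -h; field; rewrite S0 S1.
have sv : sg^-1 = sg by rewrite -[LHS]mul1r -ss mulfK.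
rewrite invfM sv; field.
by rewrite W0 S0 S1.
Qed.

(** The first row has entries k + 1, with positive sums and non-zero differences, which makes each
    triple an explicit linear form in the second row. If [t'] has an index outside [t], the second
    row is its indicator; otherwise the two triples differ only in their centre. *)
Lemma active_separated t t' : active t -> active t' -> t' != t ->
  exists X, [/\ tval X t = 0, X 0 t.1.2 + X 0 t.1.1 != 0 & tval X t' != 0].
Proof.
move: t t' => [[c a] b] [[c' a'] b'] /active_triple ht /active_triple ht' tt'.
pose p (k : 'I_n) : R := k.+1%:R.
pose X y : 'M[R]_(2, n) := \matrix_(r, k) if r == 0 then p k else y k.
have X0 y k : X y 0 k = p k by rewrite mxE eqxx.
have X1 y k : X y 1 k = y k by rewrite mxE.
have p_gt0 k : 0 < p k by rewrite ltr0n.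
have pp k l : p k + p l != 0 by rewrite gt_eqF // addr_gt0.
have p_inj k l : k != l -> p k - p l != 0.
  by apply: contra; rewrite subr_eq0 eqr_nat eqSS => /eqP e; apply/eqP/val_inj.
have tE y (i j k : 'I_n) : triple (X y) i j k =
    (p i + p j) * y k + (p i - p k) * y j - (p j + p k) * y i.
  by rewrite /triple /minor2 !X0 !X1; ring.
have /and3P[/= ab ca cb] := ht; have /and3P[/= ab' ca' cb'] := ht'.
have nab : a != b by apply: contraTneq ab => ->; rewrite ltnn.
have nab' : a' != b' by apply: contraTneq ab' => ->; rewrite ltnn.
have [/existsP[l /andP[l1 l2]]|hno] := boolP [exists l,
    (l \in [:: c'; a'; b']) && (l \notin [:: c; a; b])].
  pose y (k : 'I_n) : R := (k == l)%:R.
  have yl k : k != l -> y k = 0 by rewrite /y => /negbTE ->.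
  have yll : y l = 1 by rewrite /y eqxx.
  move: l2; rewrite !inE !negb_or ![l == _]eq_sym => /and3P[lc la lb].
  exists (X y); rewrite /tval /= !X0 !tE; split.
  - by rewrite !yl // !mulr0 subr0 addr0.
  - exact: pp.
  move: l1; rewrite !inE => /or3P[] /eqP e; subst l.
  - rewrite yll (yl a') 1?[a' == _]eq_sym // (yl b') 1?[b' == _]eq_sym //.
    by rewrite !mulr0 !mulr1 add0r subr0 p_inj.
  - rewrite yll (yl c') // (yl b') 1?[b' == _]eq_sym //.
    by rewrite !mulr0 !mulr1 !add0r oppr_eq0 pp.
  - by rewrite yll (yl c') // (yl a') // !mulr0 !mulr1 subr0 addr0 pp.
have sub k : k \in [:: c'; a'; b'] -> k \in [:: c; a; b].
  move=> hk; apply: contraNT hno => hk'; apply/existsP; exists k.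
  by rewrite hk hk'.
(* A zero of the form of [t] with y_c = 0. The forms centred at a and b take the values 2 p_c (p_a +
   p_c) and 2 p_c (p_c + p_b) there. *)
pose y (k : 'I_n) : R := if k == a then p a + p c else
  if k == b then p c + p b else 0.
have ya : y a = p a + p c by rewrite /y eqxx.
have yb : y b = p c + p b by rewrite /y eq_sym (negbTE nab) eqxx.
have yc : y c = 0 by rewrite /y (negbTE ca) (negbTE cb).
have tz : tval (X y) (c, a, b) = 0 by rewrite /tval tE ya yb yc; ring.
have t1 : triple (X y) c a b != 0.
  rewrite tE ya yb yc (_ : _ - _ = p c * 2 * (p a + p c)); last by ring.
  by rewrite !mulf_neq0 // gt_eqF.
have t2 : triple (X y) c b a != 0.
  rewrite tE ya yb yc (_ : _ - _ = p c * 2 * (p c + p b)); last by ring.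
  by rewrite !mulf_neq0 // gt_eqF.
have t1r : triple (X y) b a c != 0 by rewrite triple_rev oppr_eq0.
have t2r : triple (X y) a b c != 0 by rewrite triple_rev oppr_eq0.
exists (X y); split=> //=; first by rewrite !X0.
have hc := sub c' (mem_head _ _).
have ha : a' \in [:: c; a; b] by apply: sub; rewrite !inE eqxx orbT.
have hb : b' \in [:: c; a; b] by apply: sub; rewrite !inE eqxx !orbT.
rewrite /tval /=; move: hc ha hb; rewrite !inE.
move=> /or3P[] /eqP ec /or3P[] /eqP ea /or3P[] /eqP eb;
  move: ca' cb' nab' ab' tt'; rewrite ec ea eb ?eqxx // => _ _ _ ab' tt'.
- by move: ab'; rewrite ltnNge (ltnW ab).
Qed.

Lemma tval_coordp_neq0 t : is_triple t -> tval coordp t != 0.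
Proof.
move: t => [[c a] b] /and3P[/= ab ca cb].
pose X : 'M[R]_(2, n) := \matrix_(r, k) if r == 0 then 1 else (k == b)%:R.
have ba : a != b by apply: contraTneq ab => ->; rewrite ltnn.
suff : ev X (tval coordp (c, a, b)) != 0 by apply: contraNneq => ->; rewrite rmorph0.
rewrite ev_tval /tval /triple /minor2 /= !mxE /= eqxx (negbTE ba) (negbTE cb).
by rewrite !mul0r !mulr0 !mul1r !subr0 add0r -natrD pnatr_eq0.
Qed.

Lemma edge_num_sym X i j :
  edge_num active X j i = - edge_num active X i j.
Proof.
rewrite /edge_num [minor2 X j i]minor2C [(- minor2 _ _ _) ^+ _]exprNn.
have -> : (-1) ^+ (2 * n - 5) = -1 :> R.
  have -> : (2 * n - 5 = 2 * (n - 3) + 1)%N by move: hn; lia.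
  by rewrite exprD exprM sqrrN expr1n expr1n mul1r expr1.
rewrite (eq_bigl (fun t => active t && off_edges i j t)); last first.
  by move=> t; rewrite /off_edges [~~ on_edge j i t && _]andbC.
ring.
Qed.

Lemma edge_num_eq0 t X i j : active t -> tval X t = 0 -> off_edges i j t ->
  edge_num active X i j = 0.
Proof.
by move=> h1 h2 h3; rewrite /edge_num (bigD1 t) /= ?h1 // h2 mul0r mulr0.
Qed.

(* On this divisor x_b + x_c is a multiple of x_a + x_c, which makes the factors
   of the edge (b, c) proportional to those of (a, c). *)
Lemma edge_num_cancel t X : removable t -> tval X t = 0 ->
  X 0 t.1.2 + X 0 t.1.1 != 0 -> (forall t', active t' -> t' != t -> tval X t' != 0) ->
  edge_num active X t.1.2 t.1.1 + edge_num active X t.2 t.1.1 = 0.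
Proof.
move: t => [[c a] b] /= ht tz u0 hX.
have /andP[/= h3 hsg] := ht; have /and3P[/= ab ca cb] := h3.
have nab : a != b by apply: contraTneq ab => ->; rewrite ltnn.
have [dac dbc] : minor2 A a c != 0 /\ minor2 A b c != 0 by move: hsg; lia.
have hnz i j k : i != j -> k != j -> i != k ->
    (minor2 A i j != 0) || (minor2 A k j != 0) -> (j, i, k) != (c, a, b) ->
    (j, k, i) != (c, a, b) -> triple X i j k != 0.
  move=> ij kj ik hA t1 t2.
  have [lt|ge] := ltnP i k.
    apply: (hX (j, i, k)) => //; rewrite /active /is_triple /= lt.
    by rewrite ![j == _]eq_sym ij kj.
  rewrite triple_rev oppr_eq0; apply: (hX (j, k, i)) => //.
  rewrite /active /is_triple /= ![j == _]eq_sym ij kj orbC hA !andbT.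
  by rewrite ltn_neqAle ge andbT eq_sym.
pose W : R := \prod_(t | active t && (t != (c, a, b))) tval X t.
pose S1 : R := \prod_(l < n | [&& l != a, l != c & l != b]) triple X a c l.
pose T1 : R := \prod_(l < n | [&& l != b, l != c & l != a]) triple X b c l.
pose sn : R := (-1) ^+ n.
(* At X the factor of [(c, a, b)] is zero, so it is cancelled among polynomials before
   evaluation. *)
have key (x y : 'I_n) (sg : mpoly K R) : x != c -> y != c -> x != y ->
    minor2 A x c != 0 -> triple coordp x c y = sg * tval coordp (c, a, b) ->
    ev X sg * edge_num active X x c *
      (\prod_(l < n | [&& l != x, l != c & l != y]) triple X x c l) * star X c x =
    sn * minor2 X x c ^+ (2 * n - 5) * W.
  move=> xc yc xy dxc hsg'.
  have hx : edge (x, c) || edge (c, x).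
    rewrite /edge /= [c == x]eq_sym xc /= [minor2 A c x]minor2C oppr_gt0.
    by case: ltgtP dxc.
  have := edge_num_star active_triple coordp xc (fun t => @edge_active x c t hx).
  rewrite (star_split _ (_ : y != x) yc) 1?eq_sym // hsg'.
  rewrite /total (bigD1 (c, a, b)) /=; last exact: removable_active.
  move: (tval_coordp_neq0 h3); set z := tval _ _ => z0 h.
  have h' : sg * edge_num active coordp x c *
      (\prod_(l < n | [&& l != x, l != c & l != y]) triple coordp x c l) *
      star coordp c x = (-1) ^+ n * minor2 coordp x c ^+ (2 * n - 5) *
      \prod_(t | active t && (t != (c, a, b))) tval coordp t.
    apply: (mulfI z0); rewrite [RHS]mulrCA -[RHS]h; ring.
  have E4 : ev X (\prod_(l < n | [&& l != x, l != c & l != y]) triple coordp x c l) =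
      \prod_(l < n | [&& l != x, l != c & l != y]) triple X x c l.
    by rewrite rmorph_prod; apply: eq_bigr => l _; rewrite -rmorph_triple ev_coordp.
  have E5 : ev X (\prod_(t | active t && (t != (c, a, b))) tval coordp t) = W.
    by rewrite rmorph_prod; apply: eq_bigr => t _; exact: ev_tval.
  move: h' (ev_edge_num X x c) (ev_star X c x) (ev_minor2 X x c) E4 E5.
  move: (\prod_(t | active t && (t != (c, a, b))) tval coordp t) => f5.
  move: (\prod_(l < n | [&& l != x, l != c & l != y]) triple coordp x c l) => f4.
  move: (edge_num active coordp x c) (star coordp c x) (minor2 coordp x c).
  move=> f1 f2 f3 e <- <- <- <- <-; have := congr1 (ev X) e.
  by rewrite !rmorphM !rmorphXn rmorphN1.
have ac : a != c by rewrite eq_sym.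
have bc : b != c by rewrite eq_sym.
have ba : b != a by rewrite eq_sym.
have := key a b 1 ac bc nab dac (esym (mul1r _)); rewrite rmorph1 mul1r -/S1 => k1.
have := key b a (-1) bc ac ba dbc; rewrite mulN1r => /(_ (triple_rev _ _ _ _)).
rewrite rmorphN1 mulN1r !mulNr -/T1 => k2.
pose la := (X 0 c + X 0 b) / (X 0 a + X 0 c).
have b0 : X 0 b = la * (X 0 a + X 0 c) - X 0 c by rewrite /la; field.
have b1 : X 1 b = la * (X 1 a + X 1 c) - X 1 c.
  apply: (mulfI u0); rewrite /la; apply/eqP; rewrite -subr_eq0; apply/eqP.
  rewrite -[RHS]tz /tval /triple /minor2 /=; field; exact: u0.
have tb l : triple X b c l = la * triple X a c l.
  by rewrite /triple /minor2 b0 b1; ring.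
have tc l : triple X c b l = la * triple X c a l.
  by rewrite /triple /minor2 b0 b1; ring.
have tcab : triple X c b a = la * triple X c a b.
  by rewrite /triple /minor2 b0 b1; ring.
have mb : minor2 X b c = la * minor2 X a c by rewrite /minor2 b0 b1; ring.
have la0 : la != 0.
  have : triple X c b a != 0.
    apply: hnz => //; rewrite ?xpair_eqE ?(negbTE ba) ?(negbTE bc) //.
    by rewrite minor2C oppr_eq0 dbc.
  by rewrite tcab mulf_eq0 negb_or => /andP[].
(* There are q = n - 3 indices besides a, b, c. The ratio of the factors is la^q for one star
   without the common divisor and la^(q+1) for the other, which together match the exponent 2n - 5
   of the minors. *)
pose q := #|[pred l : 'I_n | [&& l != a, l != c & l != b]]|.
have hq : (2 * n - 5 = q + q.+1)%N.
  have : (q + 3)%N = n.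
    have := card_off_pair ac; rewrite (cardD1 b) inE /= ba bc => e.
    suff -> : q = #|[predD1 [pred k | (k != a) && (k != c)] & b]|.
      by rewrite -[RHS]e addn3 addn2.
    apply: eq_card => l; rewrite !inE.
    by case: (l == a); case: (l == b); case: (l == c).
  by move=> e; move: hn; rewrite -e; clear; move: q => q'; lia.
have T1E : T1 = la ^+ q * S1.
  rewrite /T1 (eq_bigr (fun l => la * triple X a c l)) => [|l _]; last exact: tb.
  rewrite big_split prodr_const /=; congr (_ ^+ _ * _).
    apply: eq_card => l; rewrite [LHS]unfold_in !inE.
    by case: (l == a); case: (l == b); case: (l == c).
  by apply: eq_bigl => l; case: (l == a); case: (l == b); case: (l == c).
have S2E : star X c b = la ^+ q.+1 * star X c a.
  rewrite (star_split X (ac) (nab)) (star_split X bc ba) tcab.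
  rewrite (eq_bigr (fun l => la * triple X c a l)) => [|l _]; last exact: tc.
  rewrite big_split prodr_const /= exprS mulrACA; congr (_ * (_ ^+ _) * (_ * _)).
    apply: eq_card => l; rewrite [LHS]unfold_in !inE.
    by case: (l == a); case: (l == b); case: (l == c).
  by apply: eq_bigl => l; case: (l == a); case: (l == b); case: (l == c).
have S1n : S1 != 0.
  apply/prodf_neq0 => l /and3P[l1 l2 l3]; apply: hnz => //.
  - by rewrite eq_sym.
  - by rewrite dac.
  - by rewrite !xpair_eqE (negbTE l3) !andbF.
  - by rewrite !xpair_eqE (negbTE l1) andbF.
have S2n : star X c a != 0.
  apply/prodf_neq0 => l /andP[l1 l2]; apply: hnz => //.
  - by rewrite eq_sym.
  - by rewrite minor2C oppr_eq0 dac.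
  - by rewrite !xpair_eqE (negbTE ac).
  - by rewrite !xpair_eqE (negbTE ac).
move: k1 k2; rewrite T1E S2E mb [(la * minor2 X a c) ^+ _]exprMn hq.
clear key hnz hX T1E S2E tb tc; clearbody W sn S1.
move: (edge_num _ _ _ _) (edge_num _ _ _ _) (star X c a) (minor2 X a c ^+ _) S2n.
move=> nu2 nu1 s2 m s2n k1 k2.
have lq : la ^+ (q + q.+1) != 0 by rewrite expf_neq0.
apply: (mulfI (mulf_neq0 lq (mulf_neq0 S1n s2n))); rewrite mulr0.
have e1 : la ^+ (q + q.+1) * (nu1 * S1 * s2) = la ^+ (q + q.+1) * (sn * m * W).
  by rewrite k1.
have e2 : - (la ^+ (q + q.+1) * (nu2 * S1 * s2)) = la ^+ (q + q.+1) * (sn * m * W).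
  rewrite [RHS](_ : _ = sn * (la ^+ (q + q.+1) * m) * W); last by ring.
  by rewrite -k2 exprD; ring.
rewrite (_ : _ * (nu1 + nu2) = la ^+ (q + q.+1) * (nu1 * S1 * s2) -
   - (la ^+ (q + q.+1) * (nu2 * S1 * s2))); last by ring.
by rewrite e1 e2 subrr.
Qed.

(** Every other numerator contains the vanishing factor [tval X t]. The two edges from the ends to
    the centre remain, both in the same orientation, and [edge_num_cancel] applies. *)
Lemma gamma_num_vanish t X : removable t -> tval X t = 0 ->
  X 0 t.1.2 + X 0 t.1.1 != 0 -> (forall t', active t' -> t' != t -> tval X t' != 0) ->
  ev X gamma_num = 0.
Proof.
move=> ht tz u0 hX; have hc := edge_num_cancel ht tz u0 hX.
have at' := removable_active ht.
move: t ht tz u0 hX hc at' => [[c a] b] /= ht tz u0 hX hc at'.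
have /andP[/= h3 hsg] := ht; have /and3P[/= ab ca cb] := h3.
have nab : a != b by apply: contraTneq ab => ->; rewrite ltnn.
rewrite /gamma_num rmorph_sum /=; under eq_bigr do rewrite ev_edge_num.
have rest (p q r : 'I_n * 'I_n) : edge p ->
  off_edges p.1 p.2 (c, a, b) -> edge_num active X p.1 p.2 = 0.
  by move=> _; exact: edge_num_eq0.
have gen (x y : 'I_n * 'I_n) : x != y -> edge x -> edge y ->
  (forall p, edge p -> p != x -> p != y -> off_edges p.1 p.2 (c, a, b)) ->
  \sum_(p | edge p) edge_num active X p.1 p.2 =
  edge_num active X x.1 x.2 + edge_num active X y.1 y.2.
  move=> xy ex ey hoff; rewrite (bigD1 x) //= (bigD1 y) /=; last by rewrite ey eq_sym.
  rewrite big1 ?addr0 // => p /andP[/andP[ep px] py].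
  by apply: (@edge_num_eq0 (c, a, b)) => //; exact: hoff.
have hoff p : edge p -> p != (a, c) -> p != (b, c) -> p != (c, a) -> p != (c, b) ->
    off_edges p.1 p.2 (c, a, b).
  case: p => x y _; rewrite /off_edges /on_edge /= !xpair_eqE !negb_and !negb_or.
  move=> h1 h2 h4 h5; rewrite ![c == _]eq_sym ![a == _]eq_sym ![b == _]eq_sym.
  move: h1 h2 h4 h5.
  by case: (x == a); case: (x == b); case: (x == c); case: (y == a);
     case: (y == b); case: (y == c).
case/orP: hsg => /andP[d1 d2].
  rewrite (gen (a, c) (b, c)) //=.
  - by rewrite xpair_eqE negb_and nab.
  - by rewrite /edge /= d1 eq_sym ca.
  - by rewrite /edge /= d2 eq_sym cb.
  move=> p ep p1 p2; apply: hoff => //; apply: contraTneq ep => ->.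
    by rewrite /edge /= minor2C oppr_gt0 lt_gtF ?andbF.
  by rewrite /edge /= minor2C oppr_gt0 lt_gtF ?andbF.
rewrite (gen (c, a) (c, b)) //=.
- by rewrite edge_num_sym [X in _ + X]edge_num_sym -opprD hc oppr0.
- by rewrite xpair_eqE negb_and nab orbT.
- by rewrite /edge /= minor2C oppr_gt0 d1 ca.
- by rewrite /edge /= minor2C oppr_gt0 d2 cb.
move=> p ep p1 p2; apply: hoff => //; apply: contraTneq ep => ->.
  by rewrite /edge /= lt_gtF ?andbF.
by rewrite /edge /= lt_gtF ?andbF.
Qed.

(** Times [A 0 c], the value is [(A 0 c + A 0 b) * minor2 A a c - (A 0 c + A 0 a) * minor2 A b c].
    In an active triple that is not removable the two terms do not have opposite signs and are not
    both zero, as the first row is positive. *)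
Lemma tval_standard t : active t -> ~~ removable t ->
  tval (map_mx intr A : 'M[R]_(2, n)) t != 0.
Proof.
case: t => [[c a] b] /andP[ht h1] h2.
rewrite /tval /= rmorph_triple intr_eq0.
move: h1 h2; rewrite /removable ht /=; move: (hstandard a) (hstandard b) (hstandard c).
have : A 0 c * minor2 A a b = A 0 b * minor2 A a c - A 0 a * minor2 A b c.
  by rewrite /minor2; ring.
rewrite /triple (minor2C A b c).
move: (A 0 a) (A 0 b) (A 0 c) (minor2 A a c) (minor2 A b c) (minor2 A a b).
move=> pa pb pc x y z e ha hb hc h1 h2; nia.
Qed.

Lemma gamma_rational : exists Nu D : mpoly K R,
  ev (map_mx intr A) D != 0 /\
  forall X, nondegenerate X -> ev X D != 0 -> gamma_sum A X = ev X Nu / ev X D.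
Proof.
pose all := [seq t <- enum {: triples} | active t].
pose bad := [seq t <- enum {: triples} | removable t].
(* [tval] is linear in the second-row entry of column [t.2]; its coefficient is a sum of two
   first-row entries, positive at A by standard form. *)
pose al (t : triples) := coordp 0 t.1.2 + coordp 0 t.1.1.
pose be (t : triples) := minor2 coordp t.1.2 t.1.1
   - coordp 1 t.1.2 * coordp 0 t.2 - coordp 1 t.1.1 * coordp 0 t.2.
pose ka (t : triples) : 'I_K := mxvec_index 1 t.2.
have hall t : (t \in all) = active t by rewrite mem_filter mem_enum andbT.
have hbad t : (t \in bad) = removable t by rewrite mem_filter mem_enum andbT.
have evx X r k : ev X (coordp r k) = X r k.
  by rewrite -[in RHS](ev_coordp X) [RHS]mxE.
have evmx v r k : meval v (coordp r k) = v (mxvec_index r k).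
  by rewrite mxE mevalXU.
have idx (r s : 'I_2) (k l : 'I_n) : (r, k) != (s, l) ->
    mxvec_index r k != mxvec_index s l.
  move=> h; apply: contra h => /eqP e; apply/eqP.
  have [g gK _] := curry_mxvec_bij 2 n.
  by have := congr1 g e; rewrite -[mxvec_index r k]/(uncurry (@mxvec_index 2 n) (r, k))
    -[mxvec_index s l]/(uncurry (@mxvec_index 2 n) (s, l)) !gK.
have fx t r k : (r, k) != (1, t.2) -> free_of (ka t) (coordp r k).
  by move=> h v x; rewrite !evmx upd_other // idx.
have evmm v i j : meval v (minor2 coordp i j) = minor2 (matv v) i j.
  by rewrite meval_matv ev_minor2.
have bne t : removable t -> t.1.2 != t.2 /\ t.1.1 != t.2.
  move=> /removable_active/active_triple/and3P[h1 h2 h3]; split=> //.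
  by apply: contraTneq h1 => ->; rewrite ltnn.
have ral v t : meval v (al t) = matv v 0 t.1.2 + matv v 0 t.1.1.
  by rewrite meval_matv rmorphD /= !evx.
have evtm v t : meval v (tval coordp t) = tval (matv v) t.
  by rewrite meval_matv ev_tval.
have matvK X : matv (fun i => mxvec X 0 i) = X.
  apply/matrixP => i j; rewrite /matv -[in RHS](mxvecK X); congr (vec_mx _ _ _).
  by apply/rowP => l; rewrite mxE.
have [||||||D [Q [hQ hD]]] := @divide_all R K _ bad all (tval coordp) al be ka gamma_num.
- by rewrite filter_uniq // enum_uniq.
- by move=> t; rewrite hall hbad; exact: removable_active.
- move=> t; rewrite hbad => /bne[ta tc]; split.
  + rewrite (_ : mpolyX _ _ = coordp 1 t.2); last by rewrite mxE.
    by rewrite /al /be /tval /triple /minor2; ring.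
  + by move=> v r; rewrite /al !mevalD !fx.
  + move=> v r; rewrite /be /minor2 !mevalB !mevalM !fx //;
      rewrite xpair_eqE negb_and ?ta ?tc ?orbT //.
- move=> t _; exists (fun=> 1); rewrite ral /matv !mxE.
  by rewrite gt_eqF // ltr0n.
- move=> t t'; rewrite hbad hall => /removable_active h1 h2 h3.
  have [X [z u w]] := active_separated h1 h2 h3.
  exists (fun i => mxvec X 0 i); split.
  + by rewrite (evtm _ t) matvK.
  + by rewrite (ral _ t) matvK.
  + by rewrite (evtm _ t') matvK.
- move=> t v; rewrite hbad => h1 h2 h3 h4; rewrite meval_matv.
  apply: (@gamma_num_vanish t) => //.
  + by move: h2; rewrite (evtm v t).
  + by move: h3; rewrite (ral v t).
  + by move=> t' h5 h6; have := h4 t'; rewrite hall (evtm v t') => ->.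
pose good := \prod_(t | active t && ~~ removable t) tval coordp t.
have tot X : total active X = ev X (\prod_(t <- bad) tval coordp t) * ev X good.
  rewrite /total (bigID removable) /= rmorph_prod /good rmorph_prod; congr (_ * _).
    rewrite big_filter big_enum_cond /=; apply: eq_big => [t|t _]; last by symmetry; exact: ev_tval.
    by case: (boolP (removable t)) => [/removable_active ->|_]; rewrite ?andbF.
  by apply: eq_bigr => t _; symmetry; exact: ev_tval.
exists Q, (D * good); split.
  rewrite rmorphM mulf_neq0 //.
    apply: hD => t _; rewrite -[meval _ _]/(ev _ _) rmorphD /= !evx !mxE -rmorphD intr_eq0.
    by rewrite gt_eqF // addr_gt0.
  rewrite /good rmorph_prod; apply/prodf_neq0 => t /andP[h1 h2].
  by rewrite -[GRing.RMorphism.sort _ _]/(ev _ _) ev_tval tval_standard.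
move=> X hX; rewrite rmorphM mulf_eq0 negb_or => /andP[D0 g0].
rewrite gamma_sumE // tot; clearbody good; clear tot; move: D0 g0; rewrite -![GRing.RMorphism.sort _ _]/(ev X _) => D0 g0.
have b0 : ev X (\prod_(t <- bad) tval coordp t) != 0.
  rewrite rmorph_prod prodf_seq_neq0; apply/allP => t; rewrite hbad => h.
  by rewrite -[GRing.RMorphism.sort _ _]/(ev _ _) ev_tval hX ?removable_active.
have e : ev X D * ev X gamma_num = ev X (\prod_(t <- bad) tval coordp t) * ev X Q.
  by have := congr1 (ev X) hQ; rewrite !(rmorphM (ev X)).
apply/eqP; rewrite eqr_div ?mulf_neq0 //; apply/eqP.
transitivity (ev X D * ev X gamma_num * ev X good); [ring|rewrite e; ring].
Qed.

End GammaRational.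

(** * Regularity and the limit at A *)

Section Regularity.
Variables (R : realType) (n : nat).

Lemma continuous_meval m (T : topologicalType) (f : T -> 'I_m -> R) (p : mpoly m R) x :
  (forall i, {for x, continuous (f ^~ i)}) ->
  {for x, continuous (fun y => meval (f y) p)}.
Proof.
move=> hf; elim/mpoly_ring_ind: p => [c|i|p q hp hq|p q hp hq].
- rewrite (_ : (fun y => _) = fun=> c); first exact: cvg_cst.
  by apply/funext => y; rewrite mevalC.
- rewrite (_ : (fun y => _) = f ^~ i); first exact: hf.
  by apply/funext => y; rewrite mevalXU.
- rewrite (_ : (fun y => _) = (fun y => meval (f y) p) + (fun y => meval (f y) q)).
    exact: cvgD.
  by apply/funext => y; rewrite mevalD.
rewrite (_ : (fun y => _) = (fun y => meval (f y) p) * (fun y => meval (f y) q)).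
  exact: cvgM.
by apply/funext => y; rewrite mevalM.
Qed.

Lemma continuous_ev (p : mpoly (2 * n) R) : continuous (fun X : 'M[R]_(2, n) => ev X p).
Proof.
move=> X; apply: continuous_meval => i.
case/mxvec_indexP: i => r k.
rewrite (_ : (fun Y : 'M[R]_(2, n) => _) = (fun Y => Y r k)); first exact: coord_continuous.
by apply/funext => Y; rewrite mxvecE.
Qed.

Lemma ev_neq0_near (p : mpoly (2 * n) R) (X : 'M[R]_(2, n)) : ev X p != 0 ->
  \forall Y \near X, ev Y p != 0.
Proof. exact: cvgr_neq0 (@continuous_ev p X). Qed.

Variable A : 'M[int]_(2, n).
Hypothesis hn : (2 < n)%N.
Hypothesis hstandard : standard_form A.
Let AR : 'M[R]_(2, n) := map_mx intr A.
Variables Nu D : mpoly (2 * n) R.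
Hypothesis hD : ev AR D != 0.
Hypothesis hND : forall X : 'M[R]_(2, n), nondegenerate A X -> ev X D != 0 ->
  gamma_sum A X = ev X Nu / ev X D.

Lemma gamma_regular : \forall Y \near AR, regular_at (gamma_sum A) Y.
Proof.
near=> Y; exists Nu, D; have h : ev Y D != 0 by near: Y; exact: ev_neq0_near.
split=> //; have := ev_neq0_near h; apply: filterS => X hX hz.
by apply: hND => //; exact: no_zero_triple_nondegenerate.
Unshelve. all: by end_near. Qed.

Lemma gamma_removable (L : 'M[R]_(2, n) -> R) : removable_along L (gamma_sum A) AR.
Proof. by apply: filterS gamma_regular => Y h _. Qed.

Lemma continuous_ratio (X : 'M[R]_(2, n)) : ev X D != 0 ->
  {for X, continuous (fun X : 'M[R]_(2, n) => ev X Nu / ev X D)}.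
Proof.
move=> h; apply: (cvgM (@continuous_ev Nu X)).
by apply: cvgV => //; exact: (@continuous_ev D X).
Qed.

Lemma gamma_limit :
  gamma_sum A X @[X --> within (@no_zero_triple n R) (nbhs AR)] --> ev AR Nu / ev AR D.
Proof.
have h := continuous_ratio hD.
apply: cvg_trans (cvg_within_filter _ h); apply: near_eq_cvg.
rewrite /prop_near1 /within /=.
apply: filterS (ev_neq0_near hD) => X hX hz.
by rewrite hND //; exact: no_zero_triple_nondegenerate.
Qed.

End Regularity.

(** * Specialization to symmetric weights *)

Section Perturbation.
Variables (R : realType) (I : finType).
Implicit Types (w : I -> R) (m : {ffun I -> int}).

(** Distinct powers of e turn a non-trivial integral relation into a non-zero polynomial in e. *)
Definition nudge w (e : R) (k : I) : R := w k + e ^+ (enum_rank k).+1.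

Lemma nudge0 w : nudge w 0 =1 w.
Proof. by move=> k; rewrite /nudge expr0n addr0. Qed.

Definition relation_poly w m : {poly R} :=
  \sum_k ((w k)%:P + 'X ^+ (enum_rank k).+1) *~ m k.

Lemma relation_polyE w m e : (relation_poly w m).[e] = \sum_k nudge w e k *~ m k.
Proof.
rewrite /relation_poly horner_sum; apply: eq_bigr => k _.
by rewrite -horner_evalE raddfMz /= /horner_eval hornerD hornerC hornerXn.
Qed.

Lemma relation_poly_neq0 w m : m != 0 -> relation_poly w m != 0.
Proof.
apply: contraNneq => h; apply/eqP/ffunP => k; rewrite ffunE.
have := congr1 (fun p : {poly R} => p`_(enum_rank k).+1) h.
rewrite /relation_poly coef_sum coef0 (bigD1 k) //= big1 => [|l lk].
  rewrite addr0 coefMrz coefD coefC coefXn eqxx add0r.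
  by move/eqP; rewrite intr_eq0 => /eqP.
rewrite coefMrz coefD coefC coefXn add0r eqSS.
by rewrite (inj_eq val_inj) (inj_eq enum_rank_inj) eq_sym (negbTE lk) mul0rz.
Qed.

(** There are countably many relations, each with finitely many roots, whereas the interval has
    positive measure. *)
Lemma independent_dense w (e : R) : 0 < e ->
  exists x, [/\ 0 < x, x < e & independent (nudge w x)].
Proof.
move=> e0; apply: contrapT => hno.
pose bad m : set R := [set x | root (relation_poly w m) x].
have cbad : countable (\bigcup_(m in [set m | m != 0]) bad m).
  apply: bigcup_countable => [|m /= m0]; first exact: countableP.
  apply: finite_set_countable; apply: contrapT => hinf.
  have [B hB sB] := infinite_set_fset (size (relation_poly w m)) hinf.
  have := max_poly_roots (relation_poly_neq0 w m0) (rs := finmap.enum_fset B).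
  rewrite ltnNge sB /= => h.
  suff ha : all (root (relation_poly w m)) (finmap.enum_fset B).
    by have := h ha (finmap.fset_uniq B).
  by apply/allP => x xB; exact: hB.
have sub : `]0, e[%classic `<=` \bigcup_(m in [set m | m != 0]) bad m.
  move=> x; rewrite /= in_itv /= => /andP[x0 xe]; apply: contrapT => hx.
  apply: hno; exists x; split=> // m hm k.
  have [//|mk] := eqVneq (m k) 0; exfalso; apply: hx.
  exists [ffun k => m k].
    by apply: contra mk => /eqP/ffunP/(_ k); rewrite !ffunE => ->.
  rewrite /bad /= /root relation_polyE -[in X in _ == X]hm; apply/eqP.
  by apply: eq_bigr => l _; rewrite ffunE.
have := countable_lebesgue_measure0 (sub_countable (subset_card_le sub) cbad).
rewrite lebesgue_measure_itv /= lte_fin e0 => /eqP.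
by rewrite -EFinB subr0 eqe (gt_eqF e0).
Qed.

Lemma continuous_zero (f : R -> R) : {for 0, continuous f} ->
  (forall e, 0 < e -> exists x, [/\ 0 < x, x < e & f x = 0]) -> f 0 = 0.
Proof.
move=> hf h; apply: contrapT => /eqP f0.
have : \forall x \near (0 : R), f x != 0 by exact: cvgr_neq0 _ hf f0.
case/nbhs_ballP => e /= e0 he.
have [x [x0 xe fx]] := h _ e0.
have := he x; rewrite /ball /= sub0r normrN gtr0_norm // fx eqxx.
by move=> /(_ xe).
Qed.

Lemma continuous_sum (T : Type) (r : seq T) (P : pred T) (F : T -> R -> R) x :
  (forall i, P i -> {for x, continuous (F i)}) ->
  {for x, continuous (fun y => \sum_(i <- r | P i) F i y)}.
Proof.
move=> h; rewrite -fct_sumE.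
apply: (big_ind (fun f : R -> R => {for x, continuous f})) => //; first exact: cvg_cst.
by move=> f g; exact: cvgD.
Qed.

Lemma continuous_prod (T : Type) (r : seq T) (P : pred T) (F : T -> R -> R) x :
  (forall i, P i -> {for x, continuous (F i)}) ->
  {for x, continuous (fun y => \prod_(i <- r | P i) F i y)}.
Proof.
move=> h; rewrite -fct_prodE.
apply: (big_ind (fun f : R -> R => {for x, continuous f})) => //; first exact: cvg_cst.
by move=> f g; exact: cvgM.
Qed.

Lemma continuous_nudge w k : {for 0, continuous (fun e => nudge w e k)}.
Proof.
by apply: cvgD; [exact: cvg_cst|exact: exprn_continuous].
Qed.

Lemma continuous_det3 w b i j k :
  {for 0, continuous (fun e => det3 (nudge w e) b i j k)}.
Proof.
have h l c : {for 0, continuous (fun e => nudge w e l * c)}.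
  by apply: cvgM; [exact: continuous_nudge|exact: cvg_cst].
by apply: cvgD; [apply: cvgB|]; exact: h.
Qed.

Lemma dot_gt0 w (l : {ffun I -> nat}) : (forall k, 0 < w k) ->
  (exists k, (0 < l k)%N) -> 0 < dot w l.
Proof.
move=> hw [k hk]; rewrite /dot (bigD1 k) //=.
apply: ltr_wpDr; last by rewrite pmulrn_lgt0.
by apply: sumr_ge0 => x _; rewrite mulrn_wge0 // ltW.
Qed.

Lemma continuous_leading (w : R -> I -> R) x (L : seq (leaf I)) :
  (forall k, {for x, continuous (w ^~ k)}) -> (forall k, 0 < w x k) ->
  (forall la, la \in L -> leaf_ok la) ->
  {for x, continuous (fun e => leading (w e) L)}.
Proof.
move=> hw w0 hL.
have E e : leading (w e) L = \sum_(la <- L | (la \in L) && (size la.2 + 2 == #|I|)%N)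
    \prod_(l <- la.2 | l \in la.2) (dot (w e) l)^-1.
  by rewrite /leading big_seq_cond; apply: eq_big => // la _; rewrite -big_seq.
rewrite (_ : (fun e => _) = fun e =>
    \sum_(la <- L | (la \in L) && (size la.2 + 2 == #|I|)%N)
    \prod_(l <- la.2 | l \in la.2) (dot (w e) l)^-1); last by apply/funext.
apply: continuous_sum => la /andP[laL _]; apply: continuous_prod => l lla.
have h0 : dot (w x) l != 0 by rewrite gt_eqF // dot_gt0 //; have [+ _] := hL _ laL; exact.
apply: cvgV => //; apply: continuous_sum => k _.
rewrite (_ : (fun _ => _) = fun e => w e k * (l k)%:R).
  by apply: cvgM; [exact: hw|exact: cvg_cst].
by apply/funext => e; rewrite mulr_natr.
Qed.

(** Both sides are continuous at w, as no denominator vanishes there, and agree at arbitrarily small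
    nudges of w. *)
Lemma leading_vertex_sum w b (L : seq (leaf I)) :
  (forall k, 0 < w k) -> (forall la, la \in L -> leaf_ok la) ->
  (forall w, independent w -> leading w L = vertex_sum w b) ->
  (forall i j k, vertex_cond b i j -> k != i -> k != j -> det3 w b i j k != 0) ->
  leading w L = vertex_sum w b.
Proof.
move=> hw hL hi hd; pose f e := leading (nudge w e) L - vertex_sum (nudge w e) b.
have f0 : f 0 = 0.
  apply: continuous_zero => [|e e0]; last first.
    have [x [x0 xe hx]] := independent_dense w e0.
    by exists x; split=> //; rewrite /f hi ?subrr.
  have nw : nudge w 0 = w by apply/funext => k; exact: nudge0.
  apply: cvgB.
    apply: (continuous_leading (w := nudge w)) => [k|k|//]; first exact: continuous_nudge.
    by rewrite nw.
  apply: continuous_sum => i _; apply: continuous_sum => j cij.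
  apply: cvgM; first exact: cvg_cst.
  apply: cvgV; last by apply: continuous_prod => k _; exact: continuous_det3.
  by apply/prodf_neq0 => k /andP[ki kj]; rewrite nw hd.
have nw : nudge w 0 = w by apply/funext => k; exact: nudge0.
by apply/eqP; rewrite -subr_eq0 -f0 /f nw.
Qed.

End Perturbation.

(** * Vertex sums for coordinates and their conjugates *)

Section SymmetricWeights.
Variables (n : nat) (A : 'M[int]_(2, n)).

(* The weights of the coordinates x_1, ..., x_n followed by those of their
   conjugates. *)
Definition signed (k : 'I_(n + n)) : int * int :=
  match fintype.split k with
  | inl j => (A 0 j, A 1 j)
  | inr j => - (A 0 j, A 1 j)
  end.

Definition conj_index (k : 'I_(n + n)) : 'I_(n + n) :=
  match fintype.split k with
  | inl j => rshift n j
  | inr j => lshift n j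
  end.

Definition double (T : Type) (w : 'I_n -> T) (k : 'I_(n + n)) : T :=
  match fintype.split k with inl j => w j | inr j => w j end.

Lemma signed_lshift j : signed (lshift n j) = (A 0 j, A 1 j).
Proof. by rewrite /signed (unsplitK (inl j)). Qed.

Lemma signed_rshift j : signed (rshift n j) = - (A 0 j, A 1 j).
Proof. by rewrite /signed (unsplitK (inr j)). Qed.

Lemma double_lshift T (w : 'I_n -> T) j : double w (lshift n j) = w j.
Proof. by rewrite /double (unsplitK (inl j)). Qed.

Lemma double_rshift T (w : 'I_n -> T) j : double w (rshift n j) = w j.
Proof. by rewrite /double (unsplitK (inr j)). Qed.

Lemma signed_conj k : signed (conj_index k) = - signed k.
Proof.
rewrite /conj_index; case: (splitP k) => j e.
  by rewrite (_ : k = lshift n j) ?signed_lshift ?signed_rshift //; apply: val_inj.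
by rewrite (_ : k = rshift n j) ?signed_lshift ?signed_rshift ?opprK //; apply: val_inj.
Qed.

Lemma unimodular_signed : faithful_weights A -> unimodular signed.
Proof.
move=> [_ hg] g h; have : (`|g| %| 1)%N; last by []. rewrite -hg.
apply/dvdn_biggcdP => -[i j] _ /=.
have := h (lshift n i) (lshift n j); rewrite !signed_lshift /cross /=.
by rewrite /dvdz.
Qed.

Hypothesis hn : (2 < n)%N.
Hypothesis hstandard : standard_form A.

(** Standard form puts the a_j in the open right half-plane and their negatives in the left, so k is
    a coordinate and l a conjugate. The indices are exchanged because the cross product of a_i and -
    a_j is [minor2 A j i]. *)
Lemma vertex_cond_signed k l : vertex_cond signed k l ->
  exists p : 'I_n * 'I_n, [/\ k = lshift n p.2, l = rshift n p.1 & 0 < minor2 A p.1 p.2].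
Proof.
case: (split_ordP k) => i ->; case: (split_ordP l) => j ->;
  rewrite /vertex_cond ?signed_lshift ?signed_rshift /clockwise /counterclockwise /=.
- by rewrite (lt_gtF (hstandard j)) (gt_eqF (hstandard j)) andbF.
- move=> /and3P[_ _]; rewrite /cross /= => h; exists (j, i); split=> //.
  by rewrite /minor2 /=; move: h; move: (A 0 i) (A 0 j) (A 1 i) (A 1 j) => *; nia.
- by rewrite oppr_gt0 oppr_eq0 (lt_gtF (hstandard i)) (gt_eqF (hstandard i)).
- by rewrite oppr_gt0 oppr_eq0 (lt_gtF (hstandard i)) (gt_eqF (hstandard i)).
Qed.

Variable R : realType.
Implicit Type w : 'I_n -> R.

Definition rescaled w : 'M[R]_(2, n) := \matrix_(r, k) ((A r k)%:~R / w k).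

Lemma minor2_rescaled w i j : minor2 (rescaled w) i j = (minor2 A i j)%:~R / (w i * w j).
Proof.
rewrite /minor2 !mxE rmorphB !rmorphM /= invfM.
by move: (w i)^-1 (w j)^-1 => u v; ring.
Qed.

Lemma cross_signed (i j : 'I_n) :
  [/\ cross (signed (lshift n i)) (signed (lshift n j)) = minor2 A i j,
      cross (signed (lshift n i)) (signed (rshift n j)) = - minor2 A i j,
      cross (signed (rshift n i)) (signed (lshift n j)) = - minor2 A i j
    & cross (signed (rshift n i)) (signed (rshift n j)) = minor2 A i j].
Proof.
by rewrite !signed_lshift !signed_rshift /cross /minor2 /=; split; ring.
Qed.

Lemma det3_lshift w (i j k : 'I_n) : (forall l, 0 < w l) ->
  det3 (double w) signed (lshift n i) (rshift n j) (lshift n k) =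
  - (w i * w j * w k * triple (rescaled w) i j k).
Proof.
move=> hw; rewrite /det3 !double_lshift !double_rshift.
have [_ -> _ _] := cross_signed i j; have [-> _ _ _] := cross_signed i k.
have [_ _ -> _] := cross_signed j k; rewrite /triple !minor2_rescaled !rmorphN /=.
by field; rewrite !gt_eqF.
Qed.

Lemma det3_rshift w (i j k : 'I_n) : (forall l, 0 < w l) ->
  det3 (double w) signed (lshift n i) (rshift n j) (rshift n k) =
  w i * w j * w k * triple (rescaled w) j i k.
Proof.
move=> hw; rewrite /det3 !double_lshift !double_rshift.
have [_ -> _ _] := cross_signed i j; have [_ -> _ _] := cross_signed i k.
have [_ _ _ ->] := cross_signed j k.
rewrite /triple !minor2_rescaled (minor2C A i j) !rmorphN /=.
by field; rewrite !gt_eqF.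
Qed.

(** The factor 4 comes from the partners of the two chosen indices, whose determinants are 2 w_j d
    and 2 w_i d for the minor d. Every other conjugate pair gives two determinants that combine to
    one factor of the product over k. *)
Lemma vertex_term_signed w (i j : 'I_n) : (forall l, 0 < w l) -> 0 < minor2 A j i ->
  4 * (\prod_k w k ^+ 2) * vertex_term (double w) signed (lshift n i) (rshift n j) =
  minor2 (rescaled w) j i ^+ (2 * n - 5) /
    \prod_(k < n | (k != j) && (k != i))
      ((minor2 (rescaled w) j i - minor2 (rescaled w) j k - minor2 (rescaled w) i k) *
       (minor2 (rescaled w) j i + minor2 (rescaled w) j k + minor2 (rescaled w) i k)).
Proof.
move=> hw hd; have ij : i != j.
  by apply: contraTneq hd => ->; rewrite /minor2 mulrC subrr.
rewrite /vertex_term card_ord; have [_ -> _ _] := cross_signed i j.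
rewrite -minor2C big_split_ord /=.
rewrite [X in _ / (X * _)](eq_bigl (fun k => (k != i))) => [|k]; last first.
  by rewrite eq_lshift eq_lrshift andbT.
rewrite [X in _ / (_ * X)](eq_bigl (fun k => (k != j))) => [|k]; last first.
  by rewrite eq_rshift eq_rlshift.
rewrite [X in _ / (X * _)](bigD1 j) 1?eq_sym //= [X in _ / (_ * X)](bigD1 i) //=.
rewrite [\prod_k _](bigD1 i) //= (bigD1 j) 1?eq_sym //=.
rewrite det3_lshift // det3_rshift // /triple.
have m0 (k : 'I_n) : minor2 (rescaled w) k k = 0 by rewrite /minor2 mulrC subrr.
rewrite !m0 !addr0 (minor2C (rescaled w) j i).
pose fac k := (minor2 (rescaled w) j i - minor2 (rescaled w) j k - minor2 (rescaled w) i k) *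
       (minor2 (rescaled w) j i + minor2 (rescaled w) j k + minor2 (rescaled w) i k).
pose W2 := \prod_(k < n | (k != i) && (k != j)) w k ^+ 2.
pose P := \prod_(k < n | (k != i) && (k != j)) fac k.
have e : (\prod_(k < n | (k != i) && (k != j))
     det3 (double w) signed (lshift n i) (rshift n j) (lshift n k)) *
   (\prod_(k < n | (k != j) && (k != i))
     det3 (double w) signed (lshift n i) (rshift n j) (rshift n k)) =
   (w i * w j) ^+ (2 * (n - 2)) * W2 * P.
  rewrite [X in _ * X](eq_bigl (fun k => (k != i) && (k != j))) => [|k]; last exact: andbC.
  rewrite -big_split /= (eq_bigr (fun k => (w i * w j) ^+ 2 * (w k ^+ 2 * fac k))).
    rewrite big_split /= prodr_const big_split /= -exprM mulrA; congr (_ ^+ (2 * _) * _ * _).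
    by rewrite -[in RHS](card_off_pair ij) addnK; apply: eq_card => k; rewrite inE.
  move=> k _; rewrite det3_lshift // det3_rshift // /fac /triple.
  by rewrite (minor2C (rescaled w) j i); ring.
rewrite [X in _ * (_ / X) = _]mulrACA e -/W2 [X in _ = _ / X](_ : _ = P); last first.
  by apply: eq_bigl => k; exact: andbC.
have W0 : W2 != 0 by apply/prodf_neq0 => k _; rewrite expf_neq0 // gt_eqF.
have [wi wj] : w i != 0 /\ w j != 0 by rewrite !gt_eqF.
have d0 : ((minor2 A j i)%:~R : R) != 0 by rewrite intr_eq0 gt_eqF.
clear e; rewrite !minor2_rescaled; move: P W2 W0 => P W2 W0.
move: (w i) (w j) wi wj ((minor2 A j i)%:~R : R) d0 => u v u0 v0 d d0.
have -> : (n + n - 3 = 2 * (n - 3) + 3)%N by move: hn; lia.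
have -> : (2 * n - 5 = 2 * (n - 3) + 1)%N by move: hn; lia.
have -> : (2 * (n - 2) = 2 * (n - 3) + 2)%N by move: hn; lia.
move: (2 * (n - 3))%N => q.
rewrite (_ : - (u * v * v * (- (d / (v * u)) - d / (v * u))) = 2 * v * d); last first.
  by field; rewrite u0 v0.
rewrite (_ : u * v * u * (d / (v * u) + d / (v * u)) = 2 * u * d); last first.
  by field; rewrite u0 v0.
rewrite !exprD expr_div_n !exprMn !invfM expr1.
move: (d ^+ q) (u ^+ q) (v ^+ q) (expf_neq0 q u0) (expf_neq0 q v0) P^-1.
move=> dq uq vq uq0 vq0 P'; field.
by rewrite d0 u0 v0 uq0 vq0 W0.
Qed.

Lemma vertex_sum_signed w : (forall l, 0 < w l) ->
  4 * (\prod_k w k ^+ 2) * vertex_sum (double w) signed = gamma_sum A (rescaled w).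
Proof.
move=> hw; rewrite /vertex_sum /gamma_sum pair_big_dep /= mulr_sumr.
rewrite [RHS](eq_bigr (fun p => 4 * (\prod_k w k ^+ 2) *
    vertex_term (double w) signed (lshift n p.2) (rshift n p.1))) => [|[j i] /andP[_ /= h]];
  last by rewrite vertex_term_signed.
rewrite [RHS](reindex_onto (fun p : 'I_(n + n) * 'I_(n + n) =>
  (match fintype.split p.2 with inl j => j | inr j => j end,
   match fintype.split p.1 with inl j => j | inr j => j end))
  (fun p => (lshift n p.2, rshift n p.1))) /=; last first.
  by move=> [j i] _; rewrite (unsplitK (inl i)) (unsplitK (inr j)).
have vc (i j : 'I_n) : 0 < minor2 A j i -> vertex_cond signed (lshift n i) (rshift n j).
  move=> h; rewrite /vertex_cond /clockwise /counterclockwise.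
  have [_ -> _ _] := cross_signed i j; rewrite -minor2C h.
  by rewrite signed_lshift signed_rshift /= hstandard oppr_lt0 hstandard.
symmetry; apply: eq_big => [[k l]|[k l]] /=.
  apply/idP/idP.
    move=> /andP[/andP[_ h]] /eqP[<- <-]; exact: vc.
  move=> /vertex_cond_signed[[j i] /= [-> -> h]].
  rewrite (unsplitK (inl i)) (unsplitK (inr j)) h eqxx !andbT.
  by apply: contraTneq h => ->; rewrite /minor2 mulrC subrr.
by move=> /andP[_ /eqP[-> ->]].
Qed.

(** A vanishing triple, multiplied by w_a w_b w_c, is an integral relation between these weights
    with minors of A as coefficients. *)
Lemma rescaled_nondegenerate w : (forall l, 0 < w l) -> independent w ->
  nondegenerate A (rescaled w).
Proof.
move=> hw hi [[c a] b] /andP[/and3P[/= ab ca cb] hA].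
have ba : b != a by apply: contraTneq ab => ->; rewrite ltnn.
rewrite /tval /= /triple !minor2_rescaled; apply/eqP => h.
pose m (k : 'I_n) : int := if k == a then minor2 A c b else
  if k == b then minor2 A a c else if k == c then minor2 A a b else 0.
have hm : \sum_k w k *~ m k = 0.
  rewrite (bigD1 a) // (bigD1 b) //= (bigD1 c) /=; last by rewrite ca cb.
  rewrite big1 => [|k /andP[/andP[ka kb] kc]]; last first.
    by rewrite /m (negbTE ka) (negbTE kb) (negbTE kc) mulr0z.
  rewrite /m eqxx (negbTE ba) eqxx (negbTE ca) (negbTE cb) eqxx addr0.
  rewrite -[_ *~ minor2 A c b]mulrzr -[_ *~ minor2 A a c]mulrzr -[_ *~ minor2 A a b]mulrzr.
  transitivity (w a * w b * w c * 0); last by rewrite mulr0.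
  by rewrite -h; field; rewrite !gt_eqF.
have ma := hi m hm a; have mb := hi m hm b.
move: ma mb hA; rewrite /m eqxx (negbTE ba) eqxx (minor2C A b c) => /eqP.
by rewrite oppr_eq0 => /eqP -> ->.
Qed.

Lemma det3_signed_neq0 w i j k : (forall l, 0 < w l) ->
  nondegenerate A (rescaled w) -> vertex_cond signed i j -> k != i -> k != j ->
  det3 (double w) signed i j k != 0.
Proof.
move=> hw hX /vertex_cond_signed[[l m] /= [-> -> h]].
have ml : m != l by apply: contraTneq h => ->; rewrite /minor2 mulrC subrr.
have hst (x y z : 'I_n) : (x, y) = (m, l) \/ (x, y) = (l, m) -> z != x ->
    triple (rescaled w) x y z != 0.
  move=> hxy zx; have [->|zy] := eqVneq z y.
    rewrite /triple (_ : minor2 _ y y = 0) ?addr0; last by rewrite /minor2 mulrC subrr.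
    rewrite -mulr2n mulrn_eq0 /= minor2_rescaled mulf_neq0 ?intr_eq0 //.
      by case: hxy => -[-> ->]; rewrite ?(minor2C A l m) ?oppr_eq0 (gt_eqF h).
    by rewrite invr_eq0 mulf_neq0 // gt_eqF.
  have he : [|| (x != y) && (0 < minor2 A x y) | (y != x) && (0 < minor2 A y x)].
    by case: hxy => -[-> ->]; rewrite h [l == m]eq_sym ml ?orbT.
  have := star_neq0 he hX; rewrite /star (bigD1 z) /=; last by rewrite zx zy.
  by rewrite mulf_eq0 negb_or => /andP[].
have wn z : w m * w l * w z != 0 by rewrite !mulf_neq0 // gt_eqF.
case: (split_ordP k) => z -> zi zj.
  rewrite det3_lshift // oppr_eq0 mulf_neq0 ?wn //; apply: hst; first by left.
  by move: zi; rewrite eq_lshift.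
rewrite det3_rshift // mulf_neq0 ?wn //; apply: hst; first by right.
by move: zj; rewrite eq_rshift.
Qed.

(** Along the nudges of w = 1 both sides, the second scaled by the squared weights, are continuous
    and agree at arbitrarily small independent ones. *)
Lemma gamma_value (Nu D : mpoly (2 * n) R) (L : seq (leaf 'I_(n + n))) :
  let AR : 'M[R]_(2, n) := map_mx intr A in
  ev AR D != 0 ->
  (forall X : 'M[R]_(2, n), nondegenerate A X -> ev X D != 0 ->
    gamma_sum A X = ev X Nu / ev X D) ->
  (forall la, la \in L -> leaf_ok la) ->
  (forall w : 'I_(n + n) -> R, independent w -> leading w L = vertex_sum w signed) ->
  ev AR Nu / ev AR D = 4 * leading (fun=> 1) L.
Proof.
move=> AR hD hND hL hi; pose w e := nudge (fun=> 1 : R) e : 'I_n -> R.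
have w0 : w 0 = fun=> 1 by apply/funext => k; exact: nudge0.
have X0 : rescaled (w 0) = AR.
  by apply/matrixP => r k; rewrite !mxE w0 divr1.
have cw k : {for 0, continuous (w ^~ k)} by exact: continuous_nudge.
have cev p : {for 0, continuous (fun e => ev (rescaled (w e)) p)}.
  apply: (continuous_meval (f := fun e => mxvec (rescaled (w e)) 0)) => i.
  case/mxvec_indexP: i => r k.
  rewrite (_ : (fun e => _) = fun e => (A r k)%:~R / w e k).
    apply: cvgM; [exact: cvg_cst|apply: cvgV; last exact: cw].
    by rewrite w0 oner_neq0.
  by apply/funext => e; rewrite mxvecE mxE.
pose f e := ev (rescaled (w e)) Nu / ev (rescaled (w e)) D -
  4 * (\prod_k w e k ^+ 2) * leading (double (w e)) L.
have d0 : double (fun=> 1 : R) = fun=> 1.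
  by apply/funext => k; rewrite /double; case: fintype.split.
suff : f 0 = 0.
  rewrite /f X0 w0 d0 big1 => [/eqP|k _]; last by rewrite expr1n.
  by rewrite mulr1 subr_eq0 => /eqP.
apply: continuous_zero.
  apply: cvgB.
    by apply: cvgM; [exact: cev|apply: cvgV; [rewrite X0|exact: cev]].
  apply: cvgM.
    apply: cvgM; first exact: cvg_cst.
    by apply: continuous_prod => k _; apply: cvgM; exact: cw.
  apply: (continuous_leading (w := fun e => double (w e))) => // k.
    by rewrite /double; case: fintype.split => l; exact: cw.
  by rewrite w0 d0.
move=> e e0.
have : \forall x \near (0 : R), ev (rescaled (w x)) D != 0.
  by apply: (cvgr_neq0 _ (cev D)); rewrite X0.
case/nbhs_ballP => e' /= e'0 he'.
have [|x [x0 xe hx]] := @independent_dense R 'I_n (fun=> 1) (Num.min e e').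
  by rewrite lt_min e0.
move: xe; rewrite lt_min => /andP[xe xe']; exists x; split=> //.
have D0 : ev (rescaled (w x)) D != 0.
  by apply: he'; rewrite /ball /= sub0r normrN gtr0_norm.
have wx k : 0 < w x k by rewrite addr_gt0 // exprn_gt0.
have hX := rescaled_nondegenerate wx hx.
rewrite /f -hND // -vertex_sum_signed //.
(* Doubled weights are never independent, so the equality of leading coefficient and vertex sum is
   itself taken as a limit here. *)
rewrite (@leading_vertex_sum _ _ (double (w x)) signed L) ?subrr //.
  by move=> k; rewrite /double; case: fintype.split.
by move=> i j k; exact: det3_signed_neq0.
Qed.


End SymmetricWeights.

(** * The Hilbert series of the on-shell invariants *)

Local Notation "m +m e" := (mnm_add m e) (at level 50, left associativity).

Section MonomialCount.
Variables (N : nat) (D : nat).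
Implicit Types (m e : multinom N) (P : pred (multinom N)) (k : 'I_N).

(** The degree bound D makes the monomials a finite type; it is chosen above all degrees that are
    counted. *)
Definition mcount P := #|[pred m : bmultinom N D | P (bmnm m)]|.

Lemma eq_mcount P P' : P =1 P' -> mcount P = mcount P'.
Proof. by move=> h; apply: eq_card => m; rewrite !inE h. Qed.

Lemma mcountID P P' : mcount P = (mcount (fun m => P m && P' m) +
  mcount (fun m => P m && ~~ P' m))%N.
Proof.
rewrite /mcount -!sum1_card (bigID (fun m : bmultinom N D => P' (bmnm m))) /=.
by congr (_ + _)%N; apply: eq_bigl => m; rewrite !inE.
Qed.

Lemma mcount_shift e P : (forall m, P m -> (mdeg m < D)%N) ->
  mcount (fun m => P m && lem e m) = mcount (fun m => P (m +m e)).
Proof.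
move=> hP; rewrite /mcount -!sum1_card.
pose up (m : bmultinom N D) : bmultinom N D := insubd m (bmnm m +m e).
pose dn (m : bmultinom N D) : bmultinom N D := insubd m (mnm_sub (bmnm m) e).
have dnE (m : bmultinom N D) : bmnm (dn m) = mnm_sub (bmnm m) e.
  rewrite /dn val_insubd; case: ifP => // /negP[]; apply: leq_ltn_trans (bmdeg m).
  by rewrite !mdegE; apply: leq_sum => i _; rewrite mnmBE leq_subr.
have upE (m : bmultinom N D) : P (bmnm m +m e) -> bmnm (up m) = bmnm m +m e.
  by move=> h; rewrite /up val_insubd hP.
rewrite (reindex_onto up dn) /=.
  apply: eq_bigl => m; rewrite !inE; apply/idP/idP => [/andP[/andP[h1 h2] /eqP h3]|h].
    have e1 : mnm_sub (bmnm (up m)) e = bmnm m by rewrite -dnE h3.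
    by rewrite -e1 submK.
  rewrite upE // h /=; apply/andP; split.
    by apply/forallP => i; rewrite mnmDE leq_addl.
  by apply/eqP/val_inj; rewrite /= dnE upE // addmK.
move=> m /andP[h1 h2]; apply/val_inj => /=.
by rewrite upE dnE submK.
Qed.

Lemma lem_mnm1 k m : lem (mnm1 k) m = (0 < m k)%N.
Proof.
apply/forallP/idP => [/(_ k)|h i]; first by rewrite mnmE eqxx.
by rewrite mnmE; case: eqP => // <-.
Qed.

Variables (V : zmodType) (u : 'I_N -> int * V).
Hypothesis u_gt0 : forall k, 0 < (u k).1.

Definition wsum m : int * V := \sum_k u k *+ m k.

Lemma wsumD m e : wsum (m +m e) = wsum m + wsum e.
Proof.
by rewrite /wsum -big_split; apply: eq_bigr => k _; rewrite mnmDE mulrnDr.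
Qed.

Lemma wsumU k : wsum (mnm1 k) = u k.
Proof.
rewrite /wsum (bigD1 k) //= mnmE eqxx big1 ?addr0 // => i ik.
by rewrite mnmE eq_sym (negbTE ik).
Qed.

Lemma wsum_fst m : (wsum m).1 = \sum_k (u k).1 *+ m k.
Proof.
rewrite /wsum (big_morph fst (id1 := 0) (op1 := +%R)) //.
by apply: eq_bigr => k _; rewrite fstMn.
Qed.

Lemma mdeg_wsum m : (mdeg m)%:Z <= (wsum m).1.
Proof.
rewrite wsum_fst mdegE -natz natr_sum; apply: ler_sum => k _.
by rewrite ler_wMn2r //; have := u_gt0 k; lia.
Qed.

Definition supported (S : seq 'I_N) m := [forall k, (k \notin S) ==> (m k == 0%N)].

Lemma vpart_mcount S p : uniq S -> p.1 < D%:Z ->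
  vpart [seq u k | k <- S] p = mcount (fun m => supported S m && (wsum m == p)).
Proof.
have hus S' : posw [seq u k | k <- S'] by apply/allP => _ /mapP[k _ ->].
elim: S p => [|k S IH] p.
  move=> _ pD /=; have s0 m : supported [::] m -> m = mnm0.
    by move=> /forallP h; apply/mnmP => k; have := h k; rewrite mnmE => /eqP.
  have w0 : wsum mnm0 = 0 by rewrite /wsum big1 // => k _; rewrite mnmE mulr0n.
  rewrite -[vpart _ _]/(nat_of_bool (p == 0)); case: eqP => [p0|p0]; last first.
    symmetry; apply: eq_card0 => m; rewrite !inE; apply/negP => /andP[/s0 -> /eqP h].
    by apply: p0; rewrite -h w0.
  have D0 : (mdeg (mnm0 : multinom N) < D)%N by move: pD; rewrite mdeg0 p0 /=; lia.
  symmetry; rewrite -[RHS](card1 (BMultinom D0)); apply: eq_card => m; rewrite !inE.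
  apply/andP/eqP => [[/s0 h _]|->]; first exact: val_inj.
  by rewrite /= w0 p0; split=> //; apply/forallP => i; rewrite mnmE.
move=> /= /andP[kS uS]; move: p; apply: grade_ind => [p p0 _|p IHp pD].
  rewrite [LHS]vpart_lt0 //; last exact: (hus (k :: S)).
  symmetry; apply: eq_card0 => m; rewrite !inE; apply/negP => /andP[_ /eqP h].
  by have := mdeg_wsum (bmnm m); rewrite h; move: p0; lia.
rewrite vpartS; last exact: (hus (k :: S)).
rewrite IH // IHp; last 2 first.
- by rewrite /= ltrBlDr ltrDl.
- by apply: lt_trans pD; rewrite /= ltrBlDr ltrDl.
rewrite (mcountID (fun m => supported (k :: S) m && (wsum m == p)) (lem (mnm1 k))).
rewrite addnC mcount_shift => [|m /andP[_ /eqP h]]; last first.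
  by have := mdeg_wsum m; rewrite h; move: pD; lia.
congr (_ + _)%N; apply: eq_mcount => m.
  rewrite wsumD wsumU eq_sym subr_eq eq_sym; congr (_ && _).
  apply/forallP/forallP => h i; have := h i; rewrite inE negb_or mnmDE mnmE.
    by case: eqVneq => //= ik; rewrite addn0.
  by case: eqVneq => //= ik; rewrite addn0.
rewrite lem_mnm1 -eqn0Ngt andbAC; congr (_ && _).
apply/forallP/andP => [h|[/forallP h hk] i].
  split; last by have := h k; rewrite kS.
  by apply/forallP => i; have := h i; rewrite inE negb_or; case: (i \notin S) => /= [->|_]; rewrite ?implybT ?andbF.
apply/implyP => iS; have := h i; rewrite inE negb_or iS andbT.
by case: eqVneq => [->|].
Qed.

End MonomialCount.

Section StandardCount.
Variables (R : realType) (n : nat) (A : 'M[int]_(2, n)) (p q : 'I_n).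
Hypothesis pq : p != q.
Local Notation N := (n + n)%N.
Implicit Types (m : multinom N).

Definition weight m : int * int := \sum_k signed A k *+ m k.

Definition tau (j : 'I_n) : multinom N := mnm1 (lshift n j) +m mnm1 (rshift n j).

Definition standard m := ~~ lem (tau p) m && ~~ lem (tau q) m.

Lemma weightD m m' : weight (m +m m') = weight m + weight m'.
Proof.
by rewrite /weight -big_split; apply: eq_bigr => k _; rewrite mnmDE mulrnDr.
Qed.

Lemma weight_tau j : weight (tau j) = 0.
Proof.
have h k : weight (mnm1 k) = signed A k.
  rewrite /weight (bigD1 k) //= mnmE eqxx big1 ?addr0 // => i ik.
  by rewrite mnmE eq_sym (negbTE ik).
by rewrite weightD !h signed_lshift signed_rshift subrr.
Qed.

Lemma mdeg_tau j : mdeg (tau j) = 2.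
Proof. by rewrite mdegD !mdeg1. Qed.

Lemma lem_tau j m : lem (tau j) m = (0 < m (lshift n j))%N && (0 < m (rshift n j))%N.
Proof.
apply/forallP/andP => [h|[h1 h2] i].
  have := h (lshift n j); have := h (rshift n j).
  by rewrite !mnmDE !mnmE !eqxx eq_lrshift eq_rlshift.
rewrite mnmDE !mnmE; case: eqP => [<-|_]; first by rewrite eq_rlshift.
by case: eqP => // <-.
Qed.

Definition invariant_mon d m := (mdeg m == d) && (weight m == 0).

Lemma invariant_mon_shift d j m :
  invariant_mon d (m +m tau j) = (2 <= d)%N && invariant_mon (d - 2)%N m.
Proof.
rewrite /invariant_mon weightD weight_tau addr0 mdegD mdeg_tau andbA; congr (_ && _).
by apply/eqP/andP => [<-|[h /eqP ->]]; [rewrite addnK leq_addl|rewrite subnK].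
Qed.

Lemma lem_tau_shift j j' m : j != j' -> lem (tau j) (m +m tau j') = lem (tau j) m.
Proof.
move=> /negbTE jj; rewrite !lem_tau !mnmDE !mnmE.
by rewrite !eq_lshift !eq_rshift !eq_lrshift !eq_rlshift [j' == j]eq_sym jj !addn0.
Qed.

(** Multiplication by [tau j] maps the monomials of degree d - 2 onto the multiples of [tau j] in
    degree d. *)
Lemma mcount_conv D j (P : nat -> pred (multinom N)) d : (d < D)%N ->
  (forall d m, P d m -> mdeg m = d) ->
  (forall d m, P d (m +m tau j) = (2 <= d)%N && P (d - 2)%N m) ->
  (mcount D (fun m => P d m && ~~ lem (tau j) m))%:R =
  conv (1 - 'X^2) (fun d => (mcount D (P d))%:R) d :> R.
Proof.
move=> dD hP hs; rewrite conv_1Xn (mcountID D (P d) (lem (tau j))) natrD.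
rewrite mcount_shift => [|m /hP ->] //.
rewrite [X in _ = X%:R + _ - _](_ : _ = if (2 <= d)%N then mcount D (P (d - 2)%N) else 0%N).
  by case: ifP => _; rewrite ?subr0 ?add0r // addrAC subrr add0r.
case: ifP => h; first by apply: eq_mcount => m; rewrite hs h.
by apply: eq_card0 => m; rewrite !inE hs h.
Qed.

Lemma standard_count D d : (d < D)%N ->
  (mcount D (fun m => invariant_mon d m && standard m))%:R =
  conv ((1 - 'X^2) ^+ 2)
    (fun d => (vfam (@vone 'I_N) (signed A) (d%:Z, 0))%:R) d :> R.
Proof.
move=> dD; rewrite expr2 conv_mul.
pose P d m := invariant_mon d m && ~~ lem (tau p) m.
rewrite (_ : mcount D _ = mcount D (fun m => P d m && ~~ lem (tau q) m)); last first.
  by apply: eq_mcount => m; rewrite /P /standard andbA.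
rewrite (mcount_conv (P := P)) //; last 2 first.
- by move=> d' m /andP[/andP[/eqP]].
- by move=> d' m; rewrite /P invariant_mon_shift lem_tau_shift // -andbA.
have key d' : (d' < D)%N -> (mcount D (P d'))%:R = conv (1 - 'X^2)
    (fun d => (vfam (@vone 'I_N) (signed A) (d%:Z, 0))%:R) d' :> R.
  move=> d'D; rewrite /P (mcount_conv (P := invariant_mon)) //; last 2 first.
  - by move=> d'' m /andP[/eqP].
  - by move=> d'' m; exact: invariant_mon_shift.
  rewrite !conv_1Xn.
  have base d0 : (d0 < D)%N -> mcount D (invariant_mon d0) =
      vfam (@vone 'I_N) (signed A) (d0%:Z, 0).
    move=> h; rewrite /vfam (@vpart_mcount N D) ?enum_uniq //.
    apply: eq_mcount => m; rewrite /supported /invariant_mon.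
    rewrite (_ : [forall _, _] = true); last first.
      by apply/forallP => k; rewrite mem_enum.
    rewrite /= [wsum _ _]surjective_pairing xpair_eqE; congr (_ && _).
      rewrite wsum_fst (_ : \sum_k _ = (mdeg m)%:Z) //.
      by rewrite mdegE -natz natr_sum.
    rewrite /weight /wsum (big_morph snd (id1 := 0) (op1 := +%R)) //.
    by congr (_ == _); apply: eq_bigr => k _; rewrite sndMn.
  rewrite base //; case: ifP => // h; rewrite base //.
  by apply: leq_ltn_trans d'D; rewrite leq_subr.
rewrite conv_1Xn [RHS]conv_1Xn; congr (_ - _); first exact: key.
by case: ifP => // _; apply: key; rewrite (leq_ltn_trans _ dD) // leq_subr.
Qed.

End StandardCount.

(** * Normal forms modulo the moment map *)

Section NormalForm.
Variables (F : numFieldType) (n : nat) (A : 'M[int]_(2, n)) (p q : 'I_n).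
Hypothesis dpq : minor2 A p q != 0.
Local Notation N := (n + n)%N.
Implicit Types (m s : multinom N) (f g : mpoly N F) (j : 'I_n).

Definition tauX j : mpoly N F := mpolyX F (tau j).

(** Twice the moment map in the complex coordinates, where x_j conj(x_j) is a monomial; see
    [cplx_relation]. *)
Definition relation (i : 'I_2) : mpoly N F := \sum_j (A i j)%:~R *: tauX j.

Definition relation_ideal f := exists g : 'I_2 -> mpoly N F, f = \sum_i g i * relation i.

Lemma relation_ideal0 : relation_ideal 0.
Proof. by exists (fun=> 0); rewrite big1 // => i _; rewrite mul0r. Qed.

Lemma relation_idealD f g : relation_ideal f -> relation_ideal g -> relation_ideal (f + g).
Proof.
move=> [a ->] [b ->]; exists (fun i => a i + b i); rewrite -big_split.
by apply: eq_bigr => i _; rewrite mulrDl.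
Qed.

Lemma relation_idealMl f g : relation_ideal g -> relation_ideal (f * g).
Proof.
move=> [a ->]; exists (fun i => f * a i); rewrite mulr_sumr.
by apply: eq_bigr => i _; rewrite mulrA.
Qed.

Lemma relation_idealZ (c : F) g : relation_ideal g -> relation_ideal (c *: g).
Proof. by rewrite -mul_mpolyC; exact: relation_idealMl. Qed.

Lemma relation_ideal_sum (I : Type) (r : seq I) (P : pred I) (f : I -> mpoly N F) :
  (forall i, P i -> relation_ideal (f i)) -> relation_ideal (\sum_(i <- r | P i) f i).
Proof. by move=> h; apply: big_ind => //; [exact: relation_ideal0|exact: relation_idealD]. Qed.

Lemma relation_mem i : relation_ideal (relation i).
Proof.
exists (fun k => (k == i)%:R); rewrite (bigD1 i) //= eqxx mul1r big1 ?addr0 // => k /negbTE ->.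
by rewrite mul0r.
Qed.

Let d : F := (minor2 A p q)%:~R.

Let d0 : d != 0. Proof. by rewrite intr_eq0. Qed.

Let pq : p != q.
Proof. by apply: contraNneq dpq => ->; rewrite /minor2 mulrC subrr. Qed.

(** Cramer's rule for [tauX p] and [tauX q] in the two relations. *)
Definition solution j : mpoly N F :=
  if j == p then d^-1 *: ((A 1 q)%:~R *: relation 0 - (A 0 q)%:~R *: relation 1)
  else if j == q then d^-1 *: ((A 0 p)%:~R *: relation 1 - (A 1 p)%:~R *: relation 0)
  else 0.

(* Modulo the relations, tauX p and tauX q are linear combinations of the other
   tauX k; sigma j is tauX j with this substitution performed. *)
Definition sigma j : mpoly N F := tauX j - solution j.

Lemma sigma_ideal j : relation_ideal (tauX j - sigma j).
Proof.
have h (a b : F) i k : relation_ideal (a *: relation i - b *: relation k).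
  rewrite -scaleNr; apply: relation_idealD; apply: relation_idealZ; exact: relation_mem.
rewrite /sigma opprB addrC subrK /solution.
by case: eqP => _; [|case: eqP => _; last exact: relation_ideal0];
  apply: relation_idealZ.
Qed.

(** The substituted elements satisfy the relations exactly, not just modulo the ideal; this is why
    normal forms vanish on the ideal. *)
Lemma sum_sigma i : \sum_j (A i j)%:~R *: sigma j = 0.
Proof.
rewrite /sigma; under eq_bigr do rewrite scalerBr.
rewrite sumrB -/(relation i) [X in _ - X](bigD1 p) //= [X in _ - (_ + X)](bigD1 q) 1?eq_sym //=.
rewrite big1 => [|j /andP[jp jq]]; last first.
  by rewrite /solution (negbTE jp) (negbTE jq) scaler0.
rewrite /solution eqxx [q == p]eq_sym (negbTE pq) eqxx addr0.
rewrite -!mul_mpolyC.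
have e : mpolyC N d^-1 * mpolyC N d = 1 by rewrite -mpolyCM mulVf // mpolyC1.
have ed : d = (A 0 p)%:~R * (A 1 q)%:~R - (A 1 p)%:~R * (A 0 q)%:~R.
  by rewrite /d /minor2 rmorphB !rmorphM.
move: e; rewrite [in X in _ * X = _]ed mpolyCB !mpolyCM.
have i01 : i = 0 \/ i = 1.
  by case: i => -[|[|//]] hi; [left|right]; exact: val_inj.
by case: i01 => ->; move: (relation 0) (relation 1) (mpolyC N d^-1) => r0 r1 x e;
  [rewrite -[X in X - _]mul1r|rewrite -[X in X - _]mul1r]; rewrite -e; ring.
Qed.

Lemma sigma_free j : j != p -> j != q -> sigma j = tauX j.
Proof. by move=> /negbTE jp /negbTE jq; rewrite /sigma /solution jp jq subr0. Qed.

Definition tau_linear f := exists c : 'I_n -> F, f = \sum_(k | (k != p) && (k != q)) c k *: tauX k.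

Lemma sigma_linear j : tau_linear (sigma j).
Proof.
have e0 (a b : F) (i k : 'I_2) : a *: relation i - b *: relation k =
    \sum_j (a * (A i j)%:~R - b * (A k j)%:~R) *: tauX j.
  rewrite /relation !scaler_sumr -sumrB; apply: eq_bigr => l _.
  by rewrite !scalerA -scalerBl.
have [->|jp] := eqVneq j p.
  exists (fun k => - d^-1 * (minor2 A k q)%:~R).
  rewrite /sigma /solution eqxx e0 (bigD1 p) //= [in X in _ - X](bigD1 q) 1?eq_sym //=.
  rewrite [X in _ *: (_ + (X + _))](_ : _ = 0); last first.
    by rewrite [_ * (A 0 q)%:~R]mulrC subrr scale0r.
  rewrite add0r scalerDr scalerA.
  rewrite (_ : d^-1 * _ = 1); last by rewrite -[RHS](mulVf d0) /d /minor2 rmorphB !rmorphM; ring.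
  rewrite scale1r opprD addrA subrr add0r scaler_sumr -sumrN.
  apply: eq_bigr => k _; rewrite scalerA -scaleNr /minor2 rmorphB !rmorphM /=; congr (_ *: _); ring.
have [->|jq] := eqVneq j q.
  exists (fun k => - d^-1 * (minor2 A p k)%:~R).
  rewrite /sigma /solution eqxx [q == p]eq_sym (negbTE pq) e0.
  rewrite (bigD1 p) //= [in X in _ - X](bigD1 q) 1?eq_sym //=.
  rewrite [X in _ *: (X + _)](_ : _ = 0); last first.
    by rewrite [_ * (A 1 p)%:~R]mulrC subrr scale0r.
  rewrite add0r scalerDr scalerA.
  rewrite (_ : d^-1 * _ = 1); last by rewrite -[RHS](mulVf d0) /d /minor2 rmorphB !rmorphM; ring.
  rewrite scale1r opprD addrA subrr add0r scaler_sumr -sumrN.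
  apply: eq_bigr => k _; rewrite scalerA -scaleNr /minor2 rmorphB !rmorphM /=; congr (_ *: _); ring.
exists (fun k => (k == j)%:R); rewrite sigma_free // (bigD1 j) /=; last by rewrite jp jq.
by rewrite eqxx scale1r big1 ?addr0 // => k /andP[_ /negbTE ->]; rewrite scale0r.
Qed.

Definition unpaired m : multinom N :=
  Multinom (mktuple (fun k => (m k - m (conj_index k))%N)).

Definition pairs m j : nat := minn (m (lshift n j)) (m (rshift n j)).

(** The monomial is factored into products x_j conj(x_j) and a part free of them; each product is
    then replaced by [sigma j]. *)
Definition nf m : mpoly N F := mpolyX F (unpaired m) * \prod_j sigma j ^+ pairs m j.

Lemma unpairedE m k : unpaired m k = (m k - m (conj_index k))%N.
Proof. by rewrite multinomE tnth_mktuple. Qed.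

Lemma conj_lshift j : conj_index (lshift n j) = rshift n j.
Proof. by rewrite /conj_index (unsplitK (inl j)). Qed.

Lemma conj_rshift j : conj_index (rshift n j) = lshift n j.
Proof. by rewrite /conj_index (unsplitK (inr j)). Qed.

Lemma tauXE j : tauX j = mpolyX F (mnm1 (lshift n j)) * mpolyX F (mnm1 (rshift n j)).
Proof. exact: mpolyXD. Qed.

Lemma mpolyX_pairs m : mpolyX F m = mpolyX F (unpaired m) * \prod_j tauX j ^+ pairs m j.
Proof.
rewrite [LHS]mpolyXE_id (mpolyXE_id _ (unpaired m)) !big_split_ord /= -!big_split /=.
apply: eq_bigr => j _; rewrite !unpairedE conj_lshift conj_rshift tauXE exprMn mulrACA -!exprD.
by rewrite /pairs; congr (_ ^+ _ * _ ^+ _); lia.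
Qed.

Lemma nf_ideal m : relation_ideal (mpolyX F m - nf m).
Proof.
rewrite mpolyX_pairs /nf -mulrBr; apply: relation_idealMl.
pose eqv f g := relation_ideal (f - g).
have eqvM f f' g g' : eqv f f' -> eqv g g' -> eqv (f * g) (f' * g').
  move=> h h'; rewrite /eqv (_ : _ - _ = g * (f - f') + f' * (g - g')); last by ring.
  by apply: relation_idealD; exact: relation_idealMl.
have eqv1 : eqv 1 1 by rewrite /eqv subrr; exact: relation_ideal0.
apply: (big_ind2 eqv) => // j _; elim: (pairs m j) => [|e IH]; first by rewrite !expr0.
by rewrite !exprS; apply: eqvM => //; exact: sigma_ideal.
Qed.

Lemma nf_standard m : standard p q m -> nf m = mpolyX F m.
Proof.
rewrite /standard !lem_tau => /andP[hp hq]; rewrite mpolyX_pairs /nf; congr (_ * _).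
apply: eq_bigr => j _; have [->|jp] := eqVneq j p.
  by rewrite /pairs (_ : minn _ _ = 0%N) ?expr0 //; move: hp; lia.
have [->|jq] := eqVneq j q; last by rewrite sigma_free.
by rewrite /pairs (_ : minn _ _ = 0%N) ?expr0 //; move: hq; lia.
Qed.

Lemma nf_tau m j : nf (m +m tau j) = sigma j * nf m.
Proof.
rewrite /nf (_ : unpaired (m +m tau j) = unpaired m); last first.
  apply/mnmP => k; rewrite !unpairedE !mnmDE !mnmE; case: (split_ordP k) => l ->;
  by rewrite ?conj_lshift ?conj_rshift ?eq_lshift ?eq_rshift ?eq_lrshift ?eq_rlshift;
    case: (j == l) => /=; lia.
rewrite mulrCA; congr (_ * _).
rewrite (bigD1 j) //= [in RHS](bigD1 j) //= mulrA -exprS; congr (_ ^+ _ * _).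
  rewrite /pairs !mnmDE !mnmE !eqxx eq_lrshift eq_rlshift; lia.
apply: eq_bigr => k; rewrite eq_sym => /negbTE kj; congr (_ ^+ _).
by rewrite /pairs !mnmDE !mnmE eq_lshift eq_rshift eq_lrshift eq_rlshift kj !addn0.
Qed.

Definition paired_mon (e : nat) m := [/\ mdeg m = (2 * e)%N,
  forall j, m (lshift n j) = m (rshift n j), m (lshift n p) = 0%N & m (lshift n q) = 0%N].

Definition paired_poly e f := forall m, mcoeff m f != 0 -> paired_mon e m.

Lemma mcoeffM_neq0 f g m : mcoeff m (f * g) != 0 ->
  exists m1 m2, [/\ m = m1 +m m2, mcoeff m1 f != 0 & mcoeff m2 g != 0].
Proof.
rewrite -mcoeff_msupp => /msuppM_le /allpairsP[[m1 m2] [/= h1 h2 ->]].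
by exists m1, m2; rewrite -!mcoeff_msupp.
Qed.

Lemma paired_polyM e e' f g : paired_poly e f -> paired_poly e' g ->
  paired_poly (e + e') (f * g).
Proof.
move=> hf hg m /mcoeffM_neq0[m1 [m2 [-> /hf[a1 a2 a3 a4] /hg[b1 b2 b3 b4]]]].
split=> [|j||]; rewrite ?mnmDE ?a2 ?b2 ?mdegD ?a1 ?b1 ?mulnDr //.
  by rewrite -a2 -b2 a3 b3.
by rewrite -a2 -b2 a4 b4.
Qed.

Lemma paired_poly1 : paired_poly 0 1.
Proof.
move=> m; rewrite mcoeff1; case: (m =P mnm0) => [-> _|]; last by rewrite eqxx.
by split=> [|j||]; rewrite ?mdeg0 ?mnmE.
Qed.

Lemma sigma_paired j : paired_poly 1 (sigma j).
Proof.
have [c ->] := sigma_linear j; move=> m; rewrite raddf_sum /= => h.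
have /existsP[k /andP[/andP[kp kq]]] : [exists k, ((k != p) && (k != q)) &&
    (mcoeff m (c k *: tauX k) != 0)].
  apply: contraNT h => /existsPn h; apply/eqP/big1 => k hk.
  by have := h k; rewrite hk /= negbK => /eqP.
rewrite mcoeffZ mcoeffX; case: (tau k =P m) => [<- _|_]; last by rewrite mulr0 eqxx.
split=> [|l||]; rewrite ?mdeg_tau ?mnmDE ?mnmE //.
- by rewrite !eq_lshift !eq_rshift !eq_lrshift !eq_rlshift addn0.
- by rewrite eq_lshift eq_rlshift (negbTE kp).
- by rewrite eq_lshift eq_rlshift (negbTE kq).
Qed.

(** Each sigma combines products x_k conj(x_k) with k other than p and q, all of degree 2 and weight
    0, and at most one coordinate of each conjugate pair occurs in the unpaired part. *)
Lemma nf_support m s : mcoeff s (nf m) != 0 ->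
  [/\ standard p q s, mdeg s = mdeg m & weight A s = weight A m].
Proof.
have hprod : paired_poly (\sum_j pairs m j) (\prod_j sigma j ^+ pairs m j).
  elim/big_rec2: _ => [|j e f _ h]; first exact: paired_poly1.
  apply: paired_polyM => //; elim: (pairs m j) => [|k IH].
    by rewrite expr0; exact: paired_poly1.
  by rewrite exprS -add1n; apply: paired_polyM => //; exact: sigma_paired.
move=> /mcoeffM_neq0[m1 [m2 [-> h1 /hprod [a1 a2 a3 a4]]]].
have {h1} -> : m1 = unpaired m.
  by move: h1; rewrite mcoeffX; case: (unpaired m =P m1) => [->//|_]; rewrite eqxx.
split.
- by rewrite /standard !lem_tau !mnmDE !unpairedE !conj_lshift !conj_rshift -!a2 a3 a4; lia.
- rewrite mdegD a1 !mdegE !big_split_ord /= big_distrr /= -!big_split /=.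
  by apply: eq_bigr => j _; rewrite !unpairedE conj_lshift conj_rshift /pairs; lia.
rewrite weightD /weight !big_split_ord /= -!big_split /=; apply: eq_bigr => j _.
rewrite !unpairedE conj_lshift conj_rshift a2 signed_lshift signed_rshift.
rewrite !mulNrn subrr addr0; move: (m (lshift n j)) (m (rshift n j)) (A 0 j, A 1 j) => a b x.
case: (leqP a b) => hab.
  by rewrite (eqP hab) mulr0n sub0r -[in RHS](subnK hab) mulrnDr opprD addrCA subrr addr0.
have hab' := ltnW hab.
by rewrite (eqP hab') mulr0n subr0 -[in RHS](subnK hab') mulrnDr addrK.
Qed.

Definition normal (D : nat) f : mpoly N F :=
  \sum_(m : bmultinom N D) mcoeff (bmnm m) f *: nf (bmnm m).

Lemma normalD D : {morph normal D : f g / f + g}.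
Proof.
move=> f g; rewrite /normal -big_split; apply: eq_bigr => m _.
by rewrite mcoeffD scalerDl.
Qed.

Lemma normalZ D c f : normal D (c *: f) = c *: normal D f.
Proof.
by rewrite /normal scaler_sumr; apply: eq_bigr => m _; rewrite mcoeffZ scalerA.
Qed.

Lemma normal0 D : normal D 0 = 0.
Proof. by rewrite /normal big1 // => m _; rewrite mcoeff0 scale0r. Qed.

Lemma normal_sum D (I : Type) (r : seq I) (P : pred I) (f : I -> mpoly N F) :
  normal D (\sum_(i <- r | P i) f i) = \sum_(i <- r | P i) normal D (f i).
Proof. exact: (big_morph _ (@normalD D) (@normal0 D)). Qed.

Lemma normalX D m : normal D (mpolyX F m) = if (mdeg m < D)%N then nf m else 0.
Proof.
rewrite /normal; case: ifP => hm.
  rewrite (bigD1 (BMultinom hm)) //= mcoeffX eqxx scale1r big1 ?addr0 // => m' hm'.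
  rewrite mcoeffX eq_sym (_ : _ == _ = false) ?scale0r //.
  by apply/negbTE; apply: contra hm' => /eqP e; apply/eqP/val_inj.
rewrite big1 // => m' _; rewrite mcoeffX; case: eqP => [e|_]; last by rewrite scale0r.
by move: hm; rewrite e bmdeg.
Qed.

(** A monomial times a relation becomes the normal form of the monomial times the relation between
    the sigmas, which is zero. All its terms have equal degree, so truncation at D keeps or drops
    them together. *)
Lemma normal_relation D f : relation_ideal f -> normal D f = 0.
Proof.
move=> [g ->]; rewrite normal_sum big1 // => i _.
elim/mpolyind: (g i) => [|c m r _ _ IH]; first by rewrite mul0r normal0.
rewrite mulrDl normalD IH addr0 -scalerAl normalZ.
rewrite /relation mulr_sumr normal_sum (eq_bigr (fun j =>
  (A i j)%:~R *: normal D (mpolyX F (m +m tau j)))) => [|j _]; last first.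
  by rewrite -scalerAr normalZ mpolyXD.
have [h|h] := boolP (mdeg m + 2 < D)%N; last first.
  rewrite big1 ?scaler0 // => j _.
  by rewrite normalX mdegD mdeg_tau (negbTE h) scaler0.
rewrite (eq_bigr (fun j => ((A i j)%:~R *: sigma j) * nf m)) => [|j _].
  by rewrite -mulr_suml sum_sigma mul0r scaler0.
by rewrite normalX mdegD mdeg_tau h nf_tau scalerAl.
Qed.

Lemma normal_congr D f : (msize f <= D)%N -> relation_ideal (f - normal D f).
Proof.
move=> h; rewrite [X in X - _](mpolywE h) /normal -sumrB; apply: relation_ideal_sum => m _.
by rewrite -scalerBr; apply: relation_idealZ; exact: nf_ideal.
Qed.

Lemma mcoeff_normal D f s : mcoeff s (normal D f) != 0 ->
  exists m, [/\ mcoeff m f != 0, standard p q s, mdeg s = mdeg m & weight A s = weight A m].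
Proof.
rewrite /normal raddf_sum /= => h.
have /existsP[m] : [exists m : bmultinom N D,
    mcoeff s (mcoeff (bmnm m) f *: nf (bmnm m)) != 0].
  apply: contraNT h => /existsPn h; apply/eqP/big1 => k _.
  by have := h k; rewrite negbK => /eqP.
rewrite mcoeffZ mulf_eq0 negb_or => /andP[h1 /nf_support[h2 h3 h4]].
by exists (bmnm m).
Qed.

End NormalForm.

(* A fixed structure on R[i], so that polynomial rings over it are inferred in
   one way only. *)
Definition cfield (R : realType) : numFieldType := complex R.

(** * Passage between real and complex coordinates *)

Section Complexification.
Variables (R : realType) (n : nat).
Local Notation C := (cfield R).
Local Notation N := (n + n)%N.
Implicit Types (f g : mpoly N C) (P Q : mpoly N R) (h : 'I_N -> mpoly N C).

Definition ii : C := Complex 0 1.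

Lemma sqr_ii : ii * ii = -1.
Proof. by rewrite -expr2; exact: (@sqr_i R). Qed.

Lemma ii_neq0 : ii != 0.
Proof. by apply/eqP => -[/eqP]; rewrite oner_eq0. Qed.

Definition toC (x : R) : C := real_complex R x.

Lemma toC_additive : {morph toC : x y / x - y}.
Proof. exact: (rmorphB (real_complex R)). Qed.
Lemma toC_multiplicative : monoid_morphism toC.
Proof. by split; [exact: (rmorph1 (real_complex R))|exact: (rmorphM (real_complex R))]. Qed.
HB.instance Definition _ := GRing.isZmodMorphism.Build R C toC toC_additive.
HB.instance Definition _ := GRing.isMonoidMorphism.Build R C toC toC_multiplicative.

Lemma complex_split (x : C) : x = toC (complex.Re x) + ii * toC (complex.Im x).
Proof. exact: complexE. Qed.

Definition subst h f : mpoly N C := mmap (@mpolyC N C) h f.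
HB.instance Definition _ h := GRing.RMorphism.copy (subst h) (mmap (@mpolyC N C) h).

Lemma substC h c : subst h (mpolyC N c) = mpolyC N c.
Proof. exact: mmapC. Qed.

Lemma substX h k : subst h (mpolyX C (mnm1 k)) = h k.
Proof. by rewrite /subst mmapX mmap1U. Qed.

Lemma substZ h c f : subst h (c *: f) = c *: subst h f.
Proof. by rewrite -!mul_mpolyC [LHS]rmorphM /= -/(subst h _) substC. Qed.

Lemma substD h f g : subst h (f + g) = subst h f + subst h g.
Proof. exact: rmorphD. Qed.

Lemma substB h f g : subst h (f - g) = subst h f - subst h g.
Proof. exact: rmorphB. Qed.

Lemma substM h f g : subst h (f * g) = subst h f * subst h g.
Proof. exact: rmorphM. Qed.

Lemma meval_subst (e : 'I_N -> C) h f :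
  meval e (subst h f) = meval (fun t => meval e (h t)) f.
Proof.
elim/mpoly_ring_ind: f => [c|k|f g hf hg|f g hf hg].
- by rewrite substC !mevalC.
- by rewrite substX mevalXU.
- by rewrite substD [LHS]mevalD [RHS]mevalD; congr (_ + _).
- by rewrite substM [LHS]mevalM [RHS]mevalM; congr (_ * _).
Qed.

Lemma subst_subst h h' f : (forall k, subst h' (h k) = mpolyX C (mnm1 k)) ->
  subst h' (subst h f) = f.
Proof.
move=> hh; elim/mpoly_ring_ind: f => [c|k|f g hf hg|f g hf hg].
- by rewrite !substC.
- by rewrite substX hh.
- by rewrite 2!substD; congr (_ + _).
- by rewrite 2!substM; congr (_ * _).
Qed.

Lemma subst_homog h d f : (forall k, h k \is ishomog1 1 (@mdeg N)) ->
  f \is ishomog1 d (@mdeg N) -> subst h f \is ishomog1 d (@mdeg N).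
Proof.
move=> hh hf; rewrite /subst /mmap big_seq; apply: rpred_sum => m hm.
rewrite mul_mpolyC; apply: rpredZ.
have <- : mdeg m = d by exact: (dhomogP _ _ _ hf m hm).
rewrite mdegE /mmap1.
elim/big_rec2: _ => [|k e g _ hg]; first exact: dhomog1.
by apply: dhomogM => //; have := dhomogMn (m k) (hh k); rewrite mul1n.
Qed.

(* The coordinates X, Y of V in terms of x = X + iY and conj x = X - iY. *)
Definition real_coord (t : 'I_N) : mpoly N C :=
  match fintype.split t with
  | inl j => 2^-1 *: (mpolyX C (mnm1 (lshift n j)) + mpolyX C (mnm1 (rshift n j)))
  | inr j => (2 * ii)^-1 *: (mpolyX C (mnm1 (lshift n j)) - mpolyX C (mnm1 (rshift n j)))
  end.

Definition cplx_coord (t : 'I_N) : mpoly N C :=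
  match fintype.split t with
  | inl j => mpolyX C (mnm1 (lshift n j)) + ii *: mpolyX C (mnm1 (rshift n j))
  | inr j => mpolyX C (mnm1 (lshift n j)) - ii *: mpolyX C (mnm1 (rshift n j))
  end.

Let splitL (j : 'I_n) : fintype.split (lshift n j) = inl j. Proof. exact: (unsplitK (inl j)). Qed.
Let splitR (j : 'I_n) : fintype.split (rshift n j) = inr j. Proof. exact: (unsplitK (inr j)). Qed.

Lemma mpolyXU_homog (F : numFieldType) (k : 'I_N) : mpolyX F (mnm1 k) \is ishomog1 1 (@mdeg N).
Proof. by rewrite dhomogX; apply/eqP; exact: mdeg1. Qed.

Lemma real_coord_homog k : real_coord k \is ishomog1 1 (@mdeg N).
Proof.
rewrite /real_coord; case: fintype.split => j; apply: rpredZ.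
  by apply: rpredD; exact: mpolyXU_homog.
by apply: rpredB; exact: mpolyXU_homog.
Qed.

Lemma cplx_coord_homog k : cplx_coord k \is ishomog1 1 (@mdeg N).
Proof.
rewrite /cplx_coord; case: fintype.split => j; [apply: rpredD|apply: rpredB];
  do ?apply: rpredZ; exact: mpolyXU_homog.
Qed.

Lemma half_add (f : mpoly N C) : 2^-1 *: (f + f) = f.
Proof.
by rewrite -[f + f]mulr2n -[f *+ 2]scaler_nat scalerA mulVf ?scale1r ?pnatr_eq0.
Qed.

Lemma to_realK f : subst real_coord (subst cplx_coord f) = f.
Proof.
have h2 : (2 : C) != 0 by rewrite pnatr_eq0.
apply: subst_subst => k; have i0 := ii_neq0.
rewrite /cplx_coord; case: (split_ordP k) => j ->; rewrite ?splitL ?splitR;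
  rewrite ?substB ?substD substZ !substX /real_coord splitL splitR scalerA;
  rewrite (_ : ii * _ = 2^-1); try by field; rewrite i0.
  by rewrite -scalerDr addrACA subrr addr0 half_add.
by rewrite -scalerBr opprB addrC addrA subrK half_add.
Qed.

Lemma to_cplxK f : subst cplx_coord (subst real_coord f) = f.
Proof.
have h2 : (2 : C) != 0 by rewrite pnatr_eq0.
apply: subst_subst => k; have i0 := ii_neq0.
rewrite /real_coord; case: (split_ordP k) => j ->; rewrite ?splitL ?splitR;
  rewrite substZ ?substB ?substD !substX /cplx_coord splitL splitR.
  by rewrite addrACA subrr addr0 half_add.
rewrite opprB addrC addrA subrK invfM mulrC -scalerA half_add scalerA mulVf ?scale1r //.
Qed.

Definition embed P : mpoly N C := map_mpoly toC P.
HB.instance Definition _ := GRing.RMorphism.copy embed (map_mpoly toC).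

Lemma mcoeff_embed P m : mcoeff m (embed P) = toC (mcoeff m P).
Proof. exact: mcoeff_map_mpoly. Qed.

Lemma embedD P Q : embed (P + Q) = embed P + embed Q. Proof. exact: rmorphD. Qed.
Lemma embedM P Q : embed (P * Q) = embed P * embed Q. Proof. exact: rmorphM. Qed.

Definition reC (x : C) : R := complex.Re x.
Definition imC (x : C) : R := complex.Im x.

Lemma reC_additive : {morph reC : x y / x - y}. Proof. by move=> [a b] [a' b']. Qed.
Lemma imC_additive : {morph imC : x y / x - y}. Proof. by move=> [a b] [a' b']. Qed.
HB.instance Definition _ := GRing.isZmodMorphism.Build C R reC reC_additive.
HB.instance Definition _ := GRing.isZmodMorphism.Build C R imC imC_additive.

Definition rep f : mpoly N R := map_mpoly reC f.
Definition imp f : mpoly N R := map_mpoly imC f.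
HB.instance Definition _ := GRing.Additive.copy rep (map_mpoly reC).
HB.instance Definition _ := GRing.Additive.copy imp (map_mpoly imC).

Lemma mcoeff_rep f m : mcoeff m (rep f) = complex.Re (mcoeff m f).
Proof. exact: mcoeff_map_mpoly. Qed.

Lemma mcoeff_imp f m : mcoeff m (imp f) = complex.Im (mcoeff m f).
Proof. exact: mcoeff_map_mpoly. Qed.

Lemma mcoeff_split P Q m :
  mcoeff m (embed P + ii *: embed Q) = toC (mcoeff m P) + ii * toC (mcoeff m Q).
Proof.
rewrite [LHS]mcoeffD; congr (_ + _); first exact: mcoeff_embed.
by rewrite [LHS]mcoeffZ; congr (_ * _); exact: mcoeff_embed.
Qed.

Lemma cplx_split f : f = embed (rep f) + ii *: embed (imp f).
Proof.
apply/mpolyP => m; rewrite [LHS]complex_split [RHS]mcoeff_split.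
by congr (toC _ + _ * toC _); symmetry; [exact: mcoeff_rep|exact: mcoeff_imp].
Qed.

Lemma rep_split P Q : rep (embed P + ii *: embed Q) = P.
Proof.
apply/mpolyP => m; rewrite [LHS]mcoeff_rep mcoeff_split /=.
by rewrite mul0r mul1r subr0 addr0.
Qed.

Lemma imp_split P Q : imp (embed P + ii *: embed Q) = Q.
Proof.
apply/mpolyP => m; rewrite [LHS]mcoeff_imp mcoeff_split /=.
by rewrite mul0r mul1r !add0r.
Qed.

Lemma mul_embed_split f P : f * embed P = embed (rep f * P) + ii *: embed (imp f * P).
Proof.
rewrite (embedM (rep f) P) (embedM (imp f) P) [X in X * _ = _](cplx_split f).
move: (embed (rep f)) (embed (imp f)) (embed P) => x y z.
by rewrite mulrDl -scalerAl.
Qed.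

Lemma rep_mul f P : rep (f * embed P) = rep f * P.
Proof. by rewrite mul_embed_split; exact: rep_split. Qed.

Lemma imp_mul f P : imp (f * embed P) = imp f * P.
Proof. by rewrite mul_embed_split; exact: imp_split. Qed.

Lemma coeff_homog (S T : nzRingType) d (f : mpoly N S) (g : mpoly N T) :
  f \is ishomog1 d (@mdeg N) -> (forall m, mcoeff m f = 0 -> mcoeff m g = 0) ->
  g \is ishomog1 d (@mdeg N).
Proof.
move=> hf h; apply/dhomogP => m; rewrite mcoeff_msupp => hm.
by apply: (dhomogP _ _ _ hf); rewrite mcoeff_msupp; apply: contraNneq hm => /h ->.
Qed.

Lemma rep_homog d f : f \is ishomog1 d (@mdeg N) -> rep f \is ishomog1 d (@mdeg N).
Proof.
move=> hf; apply: (coeff_homog hf) => m e; by rewrite mcoeff_rep e.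
Qed.

Lemma imp_homog d f : f \is ishomog1 d (@mdeg N) -> imp f \is ishomog1 d (@mdeg N).
Proof.
move=> hf; apply: (coeff_homog hf) => m e; by rewrite mcoeff_imp e.
Qed.

Lemma embed_homog d P : P \is ishomog1 d (@mdeg N) -> embed P \is ishomog1 d (@mdeg N).
Proof.
move=> hf; apply: (coeff_homog hf) => m e; by rewrite mcoeff_embed e.
Qed.

Lemma meval_embed (e : 'I_N -> R) P :
  meval (fun t => toC (e t)) (embed P) = toC (meval e P).
Proof.
elim/mpoly_ring_ind: P => [c|k|f g hf hg|f g hf hg].
- by rewrite /embed map_mpolyC !mevalC.
- by rewrite /embed map_mpolyX !mevalXU.
- by rewrite embedD [LHS]mevalD [in RHS]mevalD [RHS]rmorphD; congr (_ + _).
- by rewrite embedM [LHS]mevalM [in RHS]mevalM [RHS]rmorphM; congr (_ * _).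
Qed.

Variable A : 'M[int]_(2, n).

Definition complexify P : mpoly N C := subst real_coord (embed P).

Lemma complexifyK P : subst cplx_coord (complexify P) = embed P.
Proof. exact: to_cplxK. Qed.

Lemma complexify_homog d P : P \is ishomog1 d (@mdeg N) ->
  complexify P \is ishomog1 d (@mdeg N).
Proof. by move=> h; apply: subst_homog real_coord_homog (embed_homog h). Qed.

Lemma embedZ (c : R) P : embed (c *: P) = toC c *: embed P.
Proof.
apply/mpolyP => m; rewrite [LHS]mcoeff_embed [in LHS]mcoeffZ [RHS]mcoeffZ [LHS]rmorphM.
by congr (_ * _); symmetry; exact: mcoeff_embed.
Qed.

Lemma embed_sum (I : finType) (P : I -> mpoly N R) : embed (\sum_j P j) = \sum_j embed (P j).
Proof. exact: rmorph_sum. Qed.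

Lemma subst_sum h (I : finType) (f : I -> mpoly N C) :
  subst h (\sum_j f j) = \sum_j subst h (f j).
Proof. exact: rmorph_sum. Qed.

Lemma embedU k : embed (mpolyX R (mnm1 k)) = mpolyX C (mnm1 k).
Proof. exact: map_mpolyX. Qed.

Lemma embed_sqr P : embed (P ^+ 2) = embed P * embed P.
Proof. exact: rmorphM. Qed.

Lemma subst_tau j : subst cplx_coord (tauX C j) =
  embed (mpolyX R (mnm1 (lshift n j)) ^+ 2 + mpolyX R (mnm1 (rshift n j)) ^+ 2).
Proof.
rewrite tauXE [LHS]substM !substX [RHS]embedD !embed_sqr !embedU /cplx_coord splitL splitR.
rewrite -!mul_mpolyC.
have e : mpolyC N ii * mpolyC N ii = -1 by rewrite -mpolyCM sqr_ii mpolyCN mpolyC1.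
move: (mpolyC N ii) e (mpolyX C _) (mpolyX C _) => u e y x.
transitivity (x * x - (u * u) * (y * y)); first ring.
by rewrite e; ring.
Qed.

Lemma cplx_relation i :
  subst cplx_coord (relation C A i) = 2 *: embed (moment R A i).
Proof.
rewrite /moment embedZ scalerA (fmorphV toC) (rmorph_nat toC) divff ?pnatr_eq0 // scale1r.
rewrite /relation subst_sum embed_sum; apply: eq_bigr => j _.
by rewrite [LHS]substZ [RHS]embedZ (rmorph_int toC) subst_tau.
Qed.

Lemma complexify_moment i : complexify (moment R A i) = 2^-1 *: relation C A i.
Proof.
have := congr1 (subst real_coord) (cplx_relation i).
rewrite (to_realK (relation C A i)) [X in _ = X]substZ => ->.
by rewrite scalerA mulVf ?scale1r ?pnatr_eq0.
Qed.

Lemma complexify_ideal P : moment_ideal A P -> relation_ideal A (complexify P).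
Proof.
move=> [f ->]; rewrite /complexify embed_sum subst_sum; apply: relation_ideal_sum => i _.
have -> : subst real_coord (embed (f i * moment R A i)) =
    (2^-1 *: complexify (f i)) * relation C A i.
  rewrite (embedM (f i)) [LHS]substM -[X in _ * X]/(complexify (moment R A i)).
  rewrite complexify_moment -[X in X * _ = _]/(complexify (f i)).
  by move: (complexify _) (relation _ _ _) => x y; rewrite -scalerAr -scalerAl.
by apply: relation_idealMl; exact: relation_mem.
Qed.

(** In real coordinates the moment map has real coefficients, so the real and imaginary parts of the
    cofactors can be taken separately. *)
Lemma relation_ideal_split P Q :
  relation_ideal A (complexify P + ii *: complexify Q) ->
  moment_ideal A P /\ moment_ideal A Q.
Proof.
move=> [g hg].
have e : embed P + ii *: embed Q = \sum_i (2 *: subst cplx_coord (g i)) * embed (moment R A i).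
  transitivity (subst cplx_coord (\sum_i g i * relation C A i)).
    rewrite -hg [RHS]substD [X in _ = _ + X]substZ.
    exact: (congr2 +%R (esym (complexifyK P)) (congr1 ( *:%R ii) (esym (complexifyK Q)))).
  rewrite [LHS]subst_sum; apply: eq_bigr => i _.
  rewrite [LHS]substM (cplx_relation i); move: (subst _ _) (embed _) => x y.
  by rewrite -scalerAl -scalerAr.
split.
  exists (fun i => rep (2 *: subst cplx_coord (g i))).
  rewrite -[LHS](rep_split P Q) e [LHS](raddf_sum rep).
  by apply: eq_bigr => i _; exact: rep_mul.
exists (fun i => imp (2 *: subst cplx_coord (g i))).
rewrite -[LHS](imp_split P Q) e [LHS](raddf_sum imp).
by apply: eq_bigr => i _; exact: imp_mul.
Qed.

End Complexification.

(** * Invariant polynomials and monomials of weight zero *)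

Section TorusInvariance.
Variables (R : realType) (n : nat) (A : 'M[int]_(2, n)).
Local Notation C := (cfield R).
Local Notation N := (n + n)%N.
Implicit Types (v : 'rV[C]_n) (f : mpoly N C) (P : mpoly N R).

(** The points (1 + it)/(1 - it) of the circle, for natural t, would be infinitely many roots of
    X^|k| - 1. *)
Lemma circle_pow (k : int) : (forall z : C, `|z| = 1 -> z ^ k = 1) -> k = 0.
Proof.
move=> hk; have {}hk (z : C) : `|z| = 1 -> z ^+ `|k| = 1.
  move=> hz; have := hk z hz; case: k {hk} => k //.
  by rewrite NegzE -exprnN => /(congr1 GRing.inv); rewrite invrK invr1.
apply/eqP; rewrite -absz_eq0; apply/negP => /negP; rewrite -lt0n => k0.
pose u (t : nat) : C := Complex 1 t%:R; pose w (t : nat) : C := Complex 1 (- t%:R).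
have w0 t : w t != 0 by apply/eqP => -[/eqP]; rewrite oner_eq0.
have nu t : `|u t / w t| = 1.
  have e : `|u t| = `|w t| by rewrite !normc_def /= sqrrN.
  by rewrite normrM normfV e divff // normr_eq0.
have inj : injective (fun t => u t / w t).
  move=> t t' /eqP; rewrite eqr_div // => /eqP e.
  have := congr1 (@complex.Im R) e; rewrite /= !mul1r !mulr1 => /eqP.
  rewrite addrC -subr_eq0 (_ : _ - _ = 2 * (t%:R - t'%:R)); last by ring.
  by rewrite mulf_eq0 pnatr_eq0 /= subr_eq0 eqr_nat => /eqP.
have p0 : 'X^`|k| - 1 != 0 :> {poly C} by rewrite -size_poly_eq0 size_XnsubC.
have := max_poly_roots p0 (rs := [seq u t / w t | t <- iota 0 `|k|.+1]).
rewrite size_map size_iota size_XnsubC // ltnn => h; suff : false by [].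
apply: h; last by rewrite map_inj_uniq // iota_uniq.
apply/allP => _ /mapP[t _ ->]; rewrite rootE !hornerE.
by rewrite hk // subrr.
Qed.

Definition cpt v (t : 'I_N) : C :=
  match fintype.split t with inl j => v 0 j | inr j => conjc (v 0 j) end.

Lemma cpt_lshift v j : cpt v (lshift n j) = v 0 j.
Proof. by rewrite /cpt (unsplitK (inl j)). Qed.

Lemma cpt_rshift v j : cpt v (rshift n j) = conjc (v 0 j).
Proof. by rewrite /cpt (unsplitK (inr j)). Qed.

Lemma real_coords_lshift v j : real_coords v (lshift n j) = complex.Re (v 0 j).
Proof. by rewrite /real_coords (unsplitK (inl j)). Qed.

Lemma real_coords_rshift v j : real_coords v (rshift n j) = complex.Im (v 0 j).
Proof. by rewrite /real_coords (unsplitK (inr j)). Qed.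

Local Notation rpt v := (fun k => toC (real_coords v k)).

Lemma meval_cplx_coord v t : meval (rpt v) (cplx_coord R t) = cpt v t.
Proof.
rewrite /cplx_coord; case: (split_ordP t) => j ->;
  rewrite ?(unsplitK (inl j)) ?(unsplitK (inr j)).
  rewrite cpt_lshift mevalD mevalZ !mevalXU real_coords_lshift real_coords_rshift.
  by rewrite -complex_split.
rewrite cpt_rshift mevalB mevalZ !mevalXU real_coords_lshift real_coords_rshift.
rewrite [RHS]complex_split; case: (v 0 j) => a b /=.
by rewrite rmorphN mulrN.
Qed.

Lemma meval_cpt v f : meval (cpt v) f = meval (rpt v) (subst (@cplx_coord R n) f).
Proof. by rewrite meval_subst; apply: meval_eq => t; rewrite meval_cplx_coord. Qed.

Lemma meval_complexify v P : meval (cpt v) (complexify P) = toC (meval (real_coords v) P).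
Proof. by rewrite meval_cpt complexifyK; exact: meval_embed. Qed.

Lemma meval_rep_imp v f :
  meval (rpt v) f = toC (meval (real_coords v) (rep f)) + ii R * toC (meval (real_coords v) (imp f)).
Proof.
rewrite [in LHS](cplx_split f) [LHS]mevalD; congr (_ + _); first exact: meval_embed.
by rewrite [LHS]mevalZ; congr (_ * _); exact: meval_embed.
Qed.

(** In real coordinates the points [cpt v] are all the real ones, and those with natural coordinates
    suffice. *)
Lemma cpt_vanish f : (forall v, meval (cpt v) f = 0) -> f = 0.
Proof.
move=> h; suff e : subst (@cplx_coord R n) f = 0.
  by rewrite -(to_realK f) e; exact: rmorph0.
apply: mpoly_eq0 => e.
pose v : 'rV[C]_n := \row_j (toC (e (lshift n j))%:R + ii R * toC (e (rshift n j))%:R).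
rewrite -[RHS](h v) meval_cpt; apply: meval_eq => k.
rewrite -(rmorph_nat (@toC R)); congr toC.
case: (split_ordP k) => j ->; rewrite ?real_coords_lshift ?real_coords_rshift mxE /=.
  by rewrite mul0r mul1r subr0 addr0.
by rewrite mul0r mul1r !add0r.
Qed.

Definition chi (z1 z2 : C) (m : multinom N) : C :=
  z1 ^ (weight A m).1 * z2 ^ (weight A m).2.

Lemma conj_circle (z : C) (a : int) : `|z| = 1 -> conjc (z ^ a) = z ^ (- a).
Proof.
move=> hz; have z0 : z != 0 by rewrite -normr_eq0 hz oner_neq0.
rewrite (_ : conjc (z ^ a) = (conjc z) ^ a); last exact: (rmorphXz (@conjc R)).
suff -> : conjc z = z^-1 by exact: exprz_inv.
apply: (mulfI z0); rewrite divff //.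
have := add_Re2_Im2 z; rewrite hz expr1n => <-.
by case: (z) => x y; apply/eqP; rewrite eq_complex /= !expr2; apply/andP; split; apply/eqP; ring.
Qed.

Lemma cpt_torus z1 z2 v t : `|z1| = 1 -> `|z2| = 1 ->
  cpt (torus_act A z1 z2 v) t =
  z1 ^ (signed A t).1 * z2 ^ (signed A t).2 * cpt v t.
Proof.
move=> h1 h2; case: (split_ordP t) => j ->.
  by rewrite !cpt_lshift signed_lshift mxE.
rewrite !cpt_rshift signed_rshift mxE /= -!conj_circle //.
by rewrite [LHS](rmorphM (@conjc R)) (rmorphM (@conjc R)).
Qed.

Lemma meval_torus z1 z2 v m : `|z1| = 1 -> `|z2| = 1 ->
  meval (cpt (torus_act A z1 z2 v)) (mpolyX C m) = chi z1 z2 m * meval (cpt v) (mpolyX C m).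
Proof.
move=> h1 h2; rewrite !mevalX.
have pw (z : C) (F : 'I_N -> int) : `|z| = 1 ->
    z ^ (\sum_k F k *+ m k) = \prod_k (z ^ F k) ^+ m k.
  move=> hz; have z0 : z != 0 by rewrite -normr_eq0 hz oner_neq0.
  rewrite (big_morph (fun x => z ^ x) (fun a b => expfzDr a b z0) (expr0z z)).
  by apply: eq_bigr => k _; rewrite -mulr_natr natz -exprz_exp.
rewrite /chi /weight (big_morph fst (id1 := 0) (op1 := +%R)) //.
rewrite (big_morph snd (id1 := 0) (op1 := +%R)) //.
rewrite (eq_bigr (fun k => (signed A k).1 *+ m k)) => [|k _]; last exact: fstMn.
rewrite [X in _ * z2 ^ X * _](eq_bigr (fun k => (signed A k).2 *+ m k)) => [|k _]; last exact: sndMn.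
rewrite !pw // -!big_split /=; apply: eq_bigr => k _.
by rewrite cpt_torus // !exprMn.
Qed.

(** The torus multiplies each monomial by its character at the points [cpt v]. Invariance makes the
    polynomial with coefficients c_m (chi_m - 1) vanish at all of them, so the characters in the
    support are trivial. *)
Lemma invariant_weight P m : torus_invariant A P ->
  mcoeff m (complexify P) != 0 -> weight A m = 0.
Proof.
move=> hP hm; set f := complexify P in hm.
have key z1 z2 : `|z1| = 1 -> `|z2| = 1 -> chi z1 z2 m = 1.
  move=> h1 h2; pose D := (maxn (msize f) (mdeg m).+1).
  have hD : (mdeg m < D)%N by rewrite /D leq_max ltnSn orbT.
  pose Q := \sum_(m : bmultinom N D)
    (mcoeff (bmnm m) f * (chi z1 z2 (bmnm m) - 1)) *: mpolyX C (bmnm m).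
  have Q0 : Q = 0.
    apply: cpt_vanish => v; rewrite /Q raddf_sum /=.
    rewrite (eq_bigr (fun m : bmultinom N D =>
      mcoeff (bmnm m) f * meval (cpt (torus_act A z1 z2 v)) (mpolyX C (bmnm m)) -
      mcoeff (bmnm m) f * meval (cpt v) (mpolyX C (bmnm m)))) => [|m' _]; last first.
      by rewrite mevalZ meval_torus //; ring.
    have hf w : meval (cpt w) f = \sum_(m : bmultinom N D)
        mcoeff (bmnm m) f * meval (cpt w) (mpolyX C (bmnm m)).
      rewrite {1}(mpolywE (leq_maxl (msize f) (mdeg m).+1)) raddf_sum /=.
      by apply: eq_bigr => m' _; rewrite mevalZ.
    by rewrite sumrB -!hf /f !meval_complexify hP // subrr.
  have := congr1 (mcoeff m) Q0; rewrite mcoeff0 /Q raddf_sum /=.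
  rewrite (bigD1 (BMultinom hD)) //= mcoeffZ mcoeffX eqxx mulr1 big1 => [|m' hm'].
    by rewrite addr0 => /eqP; rewrite mulf_eq0 (negbTE hm) subr_eq0 => /eqP.
  rewrite mcoeffZ mcoeffX (_ : (bmnm m' == m) = false) ?mulr0 //.
  by apply/negbTE; apply: contra hm' => /eqP e; apply/eqP/val_inj.
rewrite [weight A m]surjective_pairing; congr pair; apply: circle_pow => z hz.
  by rewrite -[RHS](key z 1) ?normr1 // /chi exp1rz mulr1.
by rewrite -[RHS](key 1 z) ?normr1 // /chi exp1rz mul1r.
Qed.

Lemma rep_imp_invariant m : weight A m = 0 ->
  torus_invariant A (rep (subst (@cplx_coord R n) (mpolyX C m))) /\
  torus_invariant A (imp (subst (@cplx_coord R n) (mpolyX C m))).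
Proof.
move=> hm; set f := subst _ _.
have key z1 z2 v : `|z1| = 1 -> `|z2| = 1 ->
    meval (rpt (torus_act A z1 z2 v)) f = meval (rpt v) f.
  move=> h1 h2; rewrite /f -!meval_cpt meval_torus // /chi hm.
  by rewrite !expr0z !mul1r.
have part (x y x' y' : R) : toC x + ii R * toC y = toC x' + ii R * toC y' -> x = x' /\ y = y'.
  move=> e; have := congr1 (@complex.Re R) e; have := congr1 (@complex.Im R) e.
  by rewrite /= !mul0r !mul1r !subr0 !addr0 !add0r.
split=> z1 z2 v h1 h2; have := key z1 z2 v h1 h2;
  by rewrite (meval_rep_imp (torus_act A z1 z2 v)) (meval_rep_imp v) => /part[].
Qed.

End TorusInvariance.

(** * Dimensions of the graded pieces *)

Section OnShellDimension.
Variables (R : realType) (n : nat) (A : 'M[int]_(2, n)).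
Local Notation C := (cfield R).
Local Notation N := (n + n)%N.
Implicit Types (f : mpoly N C) (P Q : mpoly N R).

Lemma complexify_comb (I : finType) (r : I -> R) (b : I -> mpoly N R) :
  complexify (\sum_i r i *: b i) = \sum_i toC (r i) *: complexify (b i).
Proof.
rewrite /complexify embed_sum subst_sum; apply: eq_bigr => i _.
by rewrite embedZ [LHS]substZ.
Qed.

Lemma complexifyB P Q : complexify (P - Q) = complexify P - complexify Q.
Proof.
have embedB : embed (P - Q) = embed P - embed Q by exact: rmorphB.
exact: (etrans (congr1 (subst (@real_coord R n)) embedB) (substB _ _ _)).
Qed.

Lemma complexify_split f :
  f = complexify (rep (subst (@cplx_coord R n) f)) +
      ii R *: complexify (imp (subst (@cplx_coord R n) f)).
Proof.
rewrite -[LHS]to_realK [X in subst _ X = _](cplx_split (subst _ f)).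
by rewrite [LHS]substD; congr (_ + _); exact: substZ.
Qed.

Lemma homog_msize d f : f \is ishomog1 d (@mdeg N) -> (msize f <= d.+1)%N.
Proof.
move=> hf; rewrite msizeE; apply/bigmax_leqP_seq => m hm _.
by rewrite (_ : mdeg m = d) //; exact: (dhomogP _ _ _ hf m hm).
Qed.

(* The coefficients of the normal forms of an on-shell basis at the invariant
   standard monomials form an invertible matrix. *)
Theorem hilb_on_standard (p q : 'I_n) d : minor2 A p q != 0 ->
  hilb_on R A d = mcount d.+1 (fun m => invariant_mon A d m && standard p q m).
Proof.
move=> hpq; have [b [hb hbas]] := hilb_onP R A d.
move: (hilb_on R A d) b hb hbas => k b hb hbas.
pose S := [pred m : bmultinom N d.+1 | invariant_mon A d (bmnm m) && standard p q (bmnm m)].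
rewrite -[RHS]/(#|S|).
pose cb i : mpoly N C := complexify (b i).
pose nb i := normal A p q d.+1 (cb i).
have cb_homog i : cb i \is ishomog1 d (@mdeg N).
  by apply: complexify_homog; case: (hb i).
have nb_supp i s : mcoeff s (nb i) != 0 -> invariant_mon A d s && standard p q s.
  move=> /(mcoeff_normal hpq)[m [hm hs hdeg hw]].
  rewrite hs andbT /invariant_mon hdeg hw; apply/andP; split; apply/eqP.
    by apply: (dhomogP _ _ _ (cb_homog i)); rewrite mcoeff_msupp.
  by have [_ hi] := hb i; exact: invariant_weight hi hm.
pose M : 'M[C]_(k, #|S|) := \matrix_(i, j) mcoeff (bmnm (enum_val j)) (nb i).
have inv0 : invariant_deg A d (0 : mpoly N R).
  by split; [exact: dhomog0|move=> z1 z2 v _ _; rewrite !meval0].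
have free (r : 'I_k -> R) : moment_ideal A (\sum_i r i *: b i) -> forall i, r i = 0.
  move=> hr; have [c0 [_ hu]] := hbas 0 inv0.
  have e1 : c0 = 0.
    by apply: hu; rewrite sub0r big1 ?oppr0; [exact: moment_ideal0|move=> i _; rewrite mxE scale0r].
  have e2 : c0 = \row_i (- r i).
    apply: hu; rewrite sub0r -sumrN.
    by under eq_bigr do rewrite mxE scaleNr opprK.
  by move=> i; move: e2; rewrite e1 => /rowP/(_ i); rewrite !mxE => /eqP; rewrite eq_sym oppr_eq0 => /eqP.
(* A kernel vector is a complex combination of basis elements with zero normal form, hence in the
   relation ideal; its real and imaginary parts are relations between the basis classes. *)
have Mfree : row_free M.
  apply: inj_row_free => c hc.
  have e : complexify (\sum_i reC (c 0 i) *: b i) + ii R *: complexify (\sum_i imC (c 0 i) *: b i) =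
      \sum_i c 0 i *: cb i.
    rewrite !complexify_comb scaler_sumr -big_split; apply: eq_bigr => i _.
    rewrite /cb; move: (complexify (b i)) => x; rewrite /= scalerA -scalerDl.
    by rewrite -[X in X *: _ = _]complex_split.
  have nz : normal A p q d.+1 (\sum_i c 0 i *: cb i) = 0.
    rewrite normal_sum; apply/mpolyP => s; rewrite mcoeff0 raddf_sum /=.
    have cE i : mcoeff s (normal A p q d.+1 (c 0 i *: cb i)) = c 0 i * mcoeff s (nb i).
      by rewrite normalZ mcoeffZ.
    rewrite (eq_bigr _ (fun i _ => cE i)).
    have [/existsP[i0 hi0]|/existsPn h] := boolP [exists i, mcoeff s (nb i) != 0]; last first.
      by apply: big1 => i _; have := h i; rewrite negbK => /eqP ->; rewrite mulr0.
    have hs := nb_supp _ _ hi0.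
    have hd : (mdeg s < d.+1)%N by move: hs => /andP[/andP[/eqP ->]].
    have hS : BMultinom hd \in S by rewrite inE.
    have /rowP/(_ (enum_rank_in hS (BMultinom hd))) := hc; rewrite !mxE => e0.
    rewrite -[RHS]e0; apply: eq_bigr => i _.
    by rewrite mxE enum_rankK_in.
  have [hP hQ] : moment_ideal A (\sum_i reC (c 0 i) *: b i) /\
      moment_ideal A (\sum_i imC (c 0 i) *: b i).
    apply: relation_ideal_split; rewrite e.
    have hsz : (msize (\sum_i c 0 i *: cb i) <= d.+1)%N.
      by apply: homog_msize; apply: rpred_sum => i _; apply: rpredZ; exact: cb_homog.
    by have := normal_congr hpq hsz; rewrite nz subr0.
  apply/rowP => i; rewrite [RHS]mxE [LHS]complex_split.
  rewrite -[complex.Re _]/(reC (c 0 i)) -[complex.Im _]/(imC (c 0 i)).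
  by rewrite (free _ hP i) (free _ hQ i) !rmorph0 mulr0 addr0.
(* A standard monomial is its own normal form. If it is invariant, its real and imaginary parts
   expand in the basis, which expresses it through the normal forms of the basis. *)
have Mfull : row_full M.
  rewrite -sub1mx; apply/row_subP => l; apply/submxP.
  have : enum_val l \in S by exact: enum_valP.
  rewrite inE => /andP[/andP[/eqP sdeg /eqP swt] sstd].
  set s := bmnm (enum_val l) in sdeg swt sstd.
  pose f := subst (@cplx_coord R n) (mpolyX C s).
  have fh : f \is ishomog1 d (@mdeg N).
    by apply: subst_homog; [exact: cplx_coord_homog|rewrite dhomogX; apply/eqP].
  have [hP hQ] := rep_imp_invariant R swt.
  have [c1 [h1 _]] := hbas (rep f) (conj (rep_homog fh) hP).
  have [c2 [h2 _]] := hbas (imp f) (conj (imp_homog fh) hQ).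
  have nE P (c : 'rV[R]_k) : moment_ideal A (P - \sum_i c 0 i *: b i) ->
      normal A p q d.+1 (complexify P) = \sum_i toC (c 0 i) *: nb i.
    move=> /complexify_ideal/(normal_relation hpq d.+1).
    rewrite complexifyB complexify_comb -scaleN1r normalD normalZ scaleN1r.
    move/eqP; rewrite subr_eq0 => /eqP ->.
    rewrite normal_sum; apply: eq_bigr => i _; exact: normalZ.
  have key : mpolyX C s = \sum_i (toC (c1 0 i) + ii R * toC (c2 0 i)) *: nb i.
    have <- : normal A p q d.+1 (mpolyX C s) = mpolyX C s.
      by rewrite normalX sdeg ltnSn nf_standard.
    rewrite [LHS](congr1 (normal A p q d.+1) (complexify_split (mpolyX C s))) -/f [LHS]normalD.
    rewrite [X in X + _ = _](nE _ _ h1) [X in _ + X = _]normalZ [X in _ + _ *: X = _](nE _ _ h2).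
    rewrite scaler_sumr -big_split; apply: eq_bigr => i _.
    by rewrite scalerDl -scalerA.
  exists (\row_i (toC (c1 0 i) + ii R * toC (c2 0 i))).
  apply/rowP => j; rewrite !mxE.
  have := congr1 (mcoeff (bmnm (enum_val j))) key; rewrite mcoeffX raddf_sum /=.
  have -> : (s == bmnm (enum_val j)) = (l == j).
    by rewrite -(inj_eq (@enum_val_inj _ S)) -(inj_eq val_inj).
  by move=> ->; apply: eq_bigr => i _; rewrite !mxE mcoeffZ.
by rewrite -(eqP Mfree) (eqP Mfull).
Qed.

Lemma hilb_on_conv : faithful_weights A -> forall d,
  (hilb_on R A d)%:R = conv ((1 - 'X^2) ^+ 2)
    (fun d => (vfam (@vone 'I_N) (signed A) (d%:Z, 0))%:R) d :> R.
Proof.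
move=> [_ hg] d.
have [p [q hpq]] : exists p q, minor2 A p q != 0.
  case: (pickP (fun x : 'I_n * 'I_n => minor2 A x.1 x.2 != 0)) => [[p q] h|h].
    by exists p, q.
  move: hg; rewrite big1 // => x _; have := h x; by move/negbFE/eqP => ->.
have pq : p != q by apply: contraNneq hpq => ->; rewrite /minor2 mulrC subrr.
by rewrite -(standard_count R A pq (ltnSn d)) (hilb_on_standard d hpq).
Qed.

End OnShellDimension.

Theorem theorem4p2 (R : realType) (n : nat) (hn : (2 < n)%N)
    (A : 'M[int]_(2, n)) (hfaithful : faithful_weights A)
    (hstandard : standard_form A) :
  let AR : 'M[R]_(2, n) := map_mx intr A in
  exists gamma0 : R,
    [/\ pole_at1 (hilb_on R A) (2 * n - 4) gamma0,
        gamma_sum A X @[X --> within (@no_zero_triple n R) (nbhs AR)]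
          --> gamma0,
        forall i j k : 'I_n, i != j -> i != k -> j != k ->
          0 < minor2 A i j ->
          removable_along
            (fun X => minor2 X i j - minor2 X i k - minor2 X j k)
            (gamma_sum A) AR /\
          removable_along
            (fun X => minor2 X i j + minor2 X i k + minor2 X j k)
            (gamma_sum A) AR
      & generic_weights A ->
        gamma0 =
          \sum_(p : 'I_n * 'I_n | (p.1 != p.2) && (0 < minor2 A p.1 p.2))
            (minor2 A p.1 p.2)%:~R ^+ (2 * n - 5) /
            \prod_(k < n | (k != p.1) && (k != p.2))
              ((minor2 A p.1 p.2 - minor2 A p.1 k - minor2 A p.2 k)%:~R *
               (minor2 A p.1 p.2 + minor2 A p.1 k + minor2 A p.2 k)%:~R)].
Proof.
move=> AR.
have [Nu [D [hD hND]]] := gamma_rational R hn hstandard.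
have hu := unimodular_signed hfaithful.
have [L [hL hp hi]] := polar_symmetric R (@signed_conj n A) hu.
have g0 := polar_symmetric_gt0 (@signed_conj n A) hu hp.
have val := gamma_value hn hstandard hD hND hL hi.
(* By [val] this number is also the value at A of the rational function that extends [gamma_sum]. *)
exists (4 * leading (fun=> 1) L); rewrite -val; split.
- rewrite val; have -> : (2 * n - 4 = (#|'I_(n + n)| - 2) - 2)%N.
    by rewrite card_ord; move: hn; lia.
  apply: polar_pole hp _ _; first by rewrite card_ord; move: hn; lia.
    by rewrite gt_eqF.
  by move=> d; exact: (hilb_on_conv R hfaithful).
- exact: (gamma_limit hD hND).
- by move=> i j k _ _ _ _; split; exact: (gamma_removable hD hND).
move=> [_ _ hgen].
have e i j : minor2 AR i j = (minor2 A i j)%:~R by exact: rmorph_minor2.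
have hz : no_zero_triple AR.
  by move=> i j k h1 h2 h3; rewrite !e -!rmorphD intr_eq0 hgen.
rewrite -hND //; last exact: no_zero_triple_nondegenerate.
apply: eq_bigr => p _; rewrite !e; congr (_ / _); apply: eq_bigr => k _.
by rewrite !e -!rmorphB -!rmorphD.
Qed.
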